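(* Consider a general state space model and the i.i.d. Monte Carlo filter as described in the context, with observations fixed. Assume that for every $t$ the map $x\mapsto a_t(x,\cdot)$ is continuous into $L_1(\mu)$ and that for all $t$, $x$, $y$, $0<b_t(x,y)\le C(t,y)<\infty$. Then for all $t$, all $y_{1:t}$ and all functions $\psi$ with $\sigma_t^2(\psi)<\infty$, the recursively defined asymptotic variance $$V_t(\psi)=\sigma_t^2(\psi)+\frac{1}{p^2(y_t\mid y_{1:t-1})}V_{t-1}\big(L_t(\psi-m_t(\psi))\big),\qquad V_0(\psi)=\sigma_0^2(\psi),$$ is finite. Moreover, if $\sigma_s^2(\psi_s)<\infty$ for $s=0,1,\dots,t$, then the vector $\sqrt N\big(M_{N,s}(\psi_s)-m_s(\psi_s)\big)_{s=0,\dots,t}$ converges in distribution as $N\to\infty$ to a centered normal random vector with covariance matrix $(V_{r,s}(\psi_r,\psi_s))_{r,s=0,\dots,t}$, where $V_{t,t}(\psi,\phi)=\big(V_t(\psi+\phi)-V_t(\psi)-V_t(\phi)\big)/2$, and for $r<t$ $$V_{r,t}(\psi_r,\psi_t)=V_{r,t-1}\Big(\psi_r,\ \frac{L_t(\psi_t-m_t(\psi_t))}{p(y_t\mid y_{1:t-1})}\Big),\qquad V_{t,r}(\psi_t,\psi_r)=V_{r,t}(\psi_r,\psi_t).$$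
   Context: State space model: state space $E$ a complete separable metric space with Borel $\sigma$-field and reference measure $\mu$; $X_0\sim a_0\,d\mu$, $X_t\mid X_{t-1}=x'\sim a_t(x',x)\,d\mu(x)$; conditionally on $(X_t)$ the $Y_t$ are independent with $Y_t\mid X_t=x\sim b_t(x,y)\,d\nu(y)$. Observations $y_1,y_2,\dots$ are fixed. Filter densities: $f_{0|0}=a_0$, $f_{t|t}(x)\propto b_t(x,y_t)\int f_{t-1|t-1}(x')a_t(x',x)\,d\mu(x')$. $p(y_t\mid y_{1:t-1})=\iint f_{t-1|t-1}(x')a_t(x',x)b_t(x,y_t)\,d\mu(x')\,d\mu(x)$. Monte Carlo filter: $x_{1,0},\dots,x_{N,0}$ i.i.d. from $a_0$; conditionally on all particles up to time $t-1$, $x_{1,t},\dots,x_{N,t}$ are i.i.d. from $f^N_{t|t}(x)\propto b_t(x,y_t)\frac1N\sum_j a_t(x_{j,t-1},x)$. Notation: $M_{N,s}(\psi)=\frac1N\sum_{j=1}^N\psi(x_{j,s})$, $m_s(\psi)=\int\psi f_{s|s}\,d\mu$, $\sigma_s^2(\psi)=\int(\psi-m_s(\psi))^2f_{s|s}\,d\mu$, and $L_t\psi(x)=\int a_t(x,x')b_t(x',y_t)\psi(x')\,d\mu(x')$. *)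

(* Defs.v *)
From HB Require Import structures.
From mathcomp Require Import all_boot all_order all_algebra.
From mathcomp Require Import all_classical all_reals all_analysis.
Set Implicit Arguments. Unset Strict Implicit. Unset Printing Implicit Defensive.
Import Order.TTheory GRing.Theory Num.Theory.
Import numFieldNormedType.Exports.
Local Open Scope classical_set_scope.
Local Open Scope ring_scope.

Definition Borel (T : ptopologicalType) := g_sigma_algebraType (@open T).

Definition Rint d (X : measurableType d) (R : realType)
  (mu : {measure set X -> \bar R}) (f : X -> R) : R :=
  fine (\int[mu]_x (f x)%:E)%E.

Section Filter.
Context {R : realType} {dE : measure_display} {E : measurableType dE}
  (mu : {measure set E -> \bar R})
  (a0 : E -> R)
  (a : nat -> E -> E -> R)        (* transition densities a_t(x',x), t >= 1 *)
  (g : nat -> E -> R).            (* likelihoods g t x = b_t(x, y_t), t >= 1 *)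

Fixpoint filt (t : nat) : E -> R :=
  match t with
  | 0 => a0
  | s.+1 =>
    let u := fun x => g s.+1 x * Rint mu (fun x' => filt s x' * a s.+1 x' x) in
    fun x => u x / Rint mu u
  end.

(* p(y_t | y_{1:t-1}), t >= 1 *)
Definition pY (t : nat) : R :=
  Rint mu (fun x => g t x * Rint mu (fun x' => filt t.-1 x' * a t x' x)).

Definition mf (s : nat) (psi : E -> R) : R := Rint mu (fun x => psi x * filt s x).

Definition sigma2 (s : nat) (psi : E -> R) : \bar R :=
  (\int[mu]_x ((psi x - mf s psi) ^+ 2 * filt s x)%:E)%E.

Definition Lop (t : nat) (psi : E -> R) : E -> R :=
  fun x => Rint mu (fun x' => a t x x' * g t x' * psi x').

Fixpoint Vvar (t : nat) (psi : E -> R) : \bar R :=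
  match t with
  | 0 => sigma2 0 psi
  | s.+1 => (sigma2 s.+1 psi +
             ((pY s.+1) ^- 2)%:E * Vvar s (Lop s.+1 (fun x => (psi x - mf s.+1 psi)%R)))%E
  end.

(* Vcov r k psi phi = V_{r, r+k}(psi, phi) *)
Fixpoint Vcov (r k : nat) (psi phi : E -> R) : R :=
  match k with
  | 0 => (fine (Vvar r (fun x => psi x + phi x)) - fine (Vvar r psi)
          - fine (Vvar r phi)) / 2
  | k'.+1 => Vcov r k' psi
      (fun x => Lop (r + k'.+1) (fun z => phi z - mf (r + k'.+1) phi) x
                / pY (r + k'.+1))
  end.

Definition Sigma (t : nat) (psi : nat -> E -> R) : 'M[R]_t.+1 :=
  \matrix_(i, j) if (i <= j)%N then Vcov i (j - i) (psi i) (psi j)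
                 else Vcov j (i - j) (psi j) (psi i).

(* particle filter density f^N_{t|t}(x), given the particles xs at time t-1 *)
Definition fN (t N : nat) (xs : nat -> E) : E -> R :=
  let u := fun z => g t z * ((\sum_(j < N) a t (xs j) z) / N%:R) in
  fun x => u x / Rint mu u.

(* X j s = particle x_{j,s}: x_{1,0},..,x_{N,0} iid a_0, and, conditionally on
   all particles up to time s, x_{1,s+1},..,x_{N,s+1} iid f^N_{s+1|s+1}.
   The conditional structure is expressed on the generating pi-system of
   cylinder events of the history. *)
Definition is_particle_filter {dO} {Omega : measurableType dO}
  (P : probability Omega R) (N : nat) (X : nat -> nat -> Omega -> E) : Prop :=
  [/\ (forall j s, measurable_fun setT (X j s)),
      (forall B : nat -> set E, (forall j, measurable (B j)) ->
         P (\bigcap_(j in `I_N) (X j 0 @^-1` B j)) =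
         (\prod_(j < N) \int[mu]_(x in B j) (a0 x)%:E)%E) &
      (forall (s : nat) (C : nat -> nat -> set E) (B : nat -> set E),
         (forall j r, measurable (C j r)) -> (forall j, measurable (B j)) ->
         let A := \bigcap_(j in `I_N) \bigcap_(r in `I_s.+1) (X j r @^-1` C j r) in
         P (A `&` \bigcap_(j in `I_N) (X j s.+1 @^-1` B j)) =
         (\int[P]_(w in A)
            \prod_(j < N) \int[mu]_(x in B j) (fN s.+1 N (fun i => X i s w) x)%:E)%E)].

Definition MN (N : nat) (Xs : nat -> E) (psi : E -> R) : R :=
  (\sum_(j < N) psi (Xs j)) / N%:R.

End Filter.

Definition centered_normal_law {R : realType} {d} {Omega : measurableType d}
  (P : probability Omega R) (W : Omega -> R) (v : R) : Prop :=
  measurable_fun setT W /\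
  ((0 < v /\ forall B : set R, measurable B ->
       P (W @^-1` B) = normal_prob 0 (Num.sqrt v) B)
   \/ (v = 0 /\ P (W @^-1` [set 0]) = 1%E)).

Definition gaussian_vector {R : realType} {d} {Omega : measurableType d} {n : nat}
  (P : probability Omega R) (Z : Omega -> 'rV[R]_n) (S : 'M[R]_n) : Prop :=
  forall u : 'rV[R]_n,
    centered_normal_law P (fun w => \sum_i u 0 i * Z w 0 i)
      (\sum_i \sum_j u 0 i * S i j * u 0 j).

Definition cvg_in_law {R : realType} {n : nat} (dO : nat -> measure_display)
  (Omega : forall N, measurableType (dO N)) (P : forall N, probability (Omega N) R)
  (Z : forall N, Omega N -> 'rV[R]_n)
  {dL} {OmegaL : measurableType dL} (PL : probability OmegaL R)
  (ZL : OmegaL -> 'rV[R]_n) : Prop :=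
  forall f : 'rV[R]_n -> R, continuous f -> (exists M, forall v, `|f v| <= M) ->
    ((fun N => \int[P N]_w (f (Z N w))%:E) @ \oo --> \int[PL]_w (f (ZL w))%:E)%E.

(* Main.v *)
Require Import Defs.
From HB Require Import structures.
From mathcomp Require Import all_boot all_order all_algebra.
From mathcomp Require Import all_classical all_reals all_analysis.
From mathcomp Require Import measurable_realfun ring lra.
Import Order.TTheory GRing.Theory Num.Theory.
Import numFieldNormedType.Exports.
Local Open Scope classical_set_scope.
Local Open Scope ring_scope.
Set Implicit Arguments. Unset Strict Implicit. Unset Printing Implicit Defensive.
Local Notation Rint := Defs.Rint.

(** Given the past, the particles at time [t] are i.i.d. from a random kernel [K] whose
    integrals are ratios of empirical means of the previous generation. Truncation together
    with the conditional Chebyshev and Markov inequalities gives, by induction on [t], laws of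
    large numbers for [K] and for the particles.

    For the central limit theorem, condition on the past and expand the cosine to second order:
    the last coordinate contributes the factor [exp (- sigma_t^2 / 2)], and what remains is
    its conditional bias [sqrt N * (K psi_t - m_t psi_t)], which up to a term tending to zero in
    probability is the fluctuation at time [t - 1] of [L_t (psi_t - m_t psi_t) / p_t]. It is
    absorbed in the coordinate [t - 1], so that induction yields the limit of
    [E cos (u . Z_N + th)]. Bounded continuous functions are uniformly close, on boxes, to
    trigonometric polynomials (Bernstein polynomials in sines), so tightness turns this into
    convergence in law. *)

(** * Trigonometric polynomials and convergence in law *)

(** Cosines with a phase replace complex exponentials: the expectations of [cos (u . Z + th)] over
    all [u] and [th] carry the whole characteristic function. The obstacle is integrability. A test
    function is only square integrable under the filter, while the kernel of the particles is random
    and may fail to integrate it at exceptional positions. Two facts help: null sets of the filter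
    are almost surely avoided by all particles, and the likelihood bound makes [L_t] act on square
    integrable functions by Cauchy-Schwarz. Conditional estimates are made on events of the past on
    which the moments of the kernel are bounded; the probabilities of these events tend to one.
    Integrals take a default value where they do not exist, so [L_t] is linear only almost
    everywhere; the variance is therefore rewritten as a bilinear form that does not see null sets.
    The Gaussian limit has to be constructed; the positive semidefiniteness this requires is read
    off from the backward recursion, which writes the limiting quadratic form as a sum of
    variances. *)

Section TrigBounds.
Variable R : realType.
Implicit Types x a v : R.

(** The Taylor inequalities below form a chain: the difference of the two sides vanishes at zero and
    its derivative is the previous inequality, starting from [cos_le1]. *)
Lemma nondecreasing_from0 (f f' : R -> R) :
  (forall x, is_derive x 1 f (f' x)) -> (forall x, 0 <= x -> 0 <= f' x) ->
  forall x, 0 <= x -> f 0 <= f x.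
Proof.
move=> df f'0 x x0.
apply: (@ger0_derive1_ndecr _ f 0 x) => //.
- by move=> z; rewrite in_itv/= => /andP[/ltW z0 _]; rewrite derive1E (@derive_val _ _ _ _ _ _ _ (df z)) f'0.
- apply: continuous_subspaceT => z; apply: differentiable_continuous.
  by apply/derivable1_diffP; exact: ex_derive.
Qed.

Lemma sin_le_id x : 0 <= x -> sin x <= x.
Proof.
move=> x0; rewrite -subr_ge0.
have := @nondecreasing_from0 (fun y => y - sin y) (fun y => 1 - cos y) _ _ _ x0.
rewrite sin0 subr0; apply.
by move=> y _; rewrite subr_ge0 cos_le1.
Qed.

Lemma cos_ge_quad x : 1 - x ^+ 2 / 2 <= cos x.
Proof.
wlog x0 : x / 0 <= x => [h|].
  have [/h//|/ltW x0] := leP 0 x.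
  by rewrite -cosN -sqrrN h// oppr_ge0.
rewrite -subr_ge0.
have := @nondecreasing_from0 (fun y => cos y - (1 - y ^+ 2 / 2)) (fun y => y - sin y) _ _ _ x0.
rewrite cos0 expr0n/= mul0r !subr0 subrr; apply.
- move=> y; apply: is_derive_eq; rewrite /GRing.scale/=; lra.
- by move=> y y0; rewrite subr_ge0 sin_le_id.
Qed.

Lemma sin_ge_cubic x : 0 <= x -> x - x ^+ 3 / 6 <= sin x.
Proof.
move=> x0; rewrite -subr_ge0.
have := @nondecreasing_from0 (fun y => sin y - (y - y ^+ 3 / 6)) (fun y => cos y - (1 - y ^+ 2 / 2)) _ _ _ x0.
rewrite sin0 expr0n/= mul0r !subr0; apply.
- move=> y; apply: is_derive_eq; rewrite /GRing.scale/=; lra.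
- by move=> y y0; rewrite subr_ge0 cos_ge_quad.
Qed.

Lemma cos_le_quartic x : cos x <= 1 - x ^+ 2 / 2 + x ^+ 4 / 24.
Proof.
wlog x0 : x / 0 <= x => [h|].
  have [/h//|/ltW x0] := leP 0 x.
  by rewrite -cosN -(sqrrN x) (_ : x ^+ 4 = (- x) ^+ 4) ?h ?oppr_ge0// ; ring.
rewrite -subr_ge0.
have := @nondecreasing_from0 (fun y => 1 - y ^+ 2 / 2 + y ^+ 4 / 24 - cos y) (fun y => sin y - (y - y ^+ 3 / 6)) _ _ _ x0.
rewrite cos0 !expr0n/= !mul0r !subr0 addr0 subrr; apply.
- move=> y; apply: is_derive_eq; rewrite /GRing.scale/=; lra.
- by move=> y y0; rewrite subr_ge0 sin_ge_cubic.
Qed.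

Lemma cos_taylor2 x : `|cos x - 1 + x ^+ 2 / 2| <= x ^+ 2 /\
  `|cos x - 1 + x ^+ 2 / 2| <= `|x| ^+ 3.
Proof.
have h1 := cos_ge_quad x; have h2 := cos_le_quartic x; have h3 := cos_le1 x.
have x2 : 0 <= x ^+ 2 by exact: sqr_ge0.
rewrite ger0_norm; last by lra.
split; first by lra.
have -> : `|x| ^+ 3 = `|x| * x ^+ 2 by rewrite exprS real_normK ?num_real.
have e4 : x ^+ 4 = x ^+ 2 * x ^+ 2 by ring.
have e2 : x ^+ 2 = `|x| ^+ 2 by rewrite real_normK ?num_real.
have n0 := normr_ge0 x.
(* Up to 24 the term [x ^+ 4 / 24] is at most [|x| ^+ 3]; beyond it, [cos x <= 1] leaves only
   [x ^+ 2 / 2]. *)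
have [l|l] := leP `|x| 24; last by nra.
rewrite e4 e2 in h2 *; nra.
Qed.

Lemma sin_taylor1 x : `|sin x - x| <= x ^+ 2 /\ `|sin x - x| <= `|x| ^+ 3.
Proof.
wlog x0 : x / 0 <= x => [h|].
  have [/h//|/ltW x0] := leP 0 x.
  have := h (- x); rewrite oppr_ge0 => /(_ x0).
  have -> : sin (- x) - - x = - (sin x - x) by rewrite sinN opprB opprK addrC.
  by rewrite !normrN sqrrN.
have h1 := sin_ge_cubic x0; have h2 := sin_le_id x0; have h3 := sin_geN1 x.
rewrite ler0_norm; last by lra.
rewrite (ger0_norm x0).
split; last first.
  have : 0 <= x ^+ 3 by rewrite exprn_ge0.
  lra.
have [l|l] := leP x 6.
  have : x ^+ 3 <= 6 * x ^+ 2 by rewrite exprS ler_wpM2r// sqr_ge0.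
  lra.
by nra.
Qed.

(** Second-order expansion in Lindeberg's form: increments above the threshold [d] pay their square,
    smaller ones pay the cubic remainder, at most [d] times their square. *)
Lemma cosD_taylor2 a x (d : R) : 0 <= d ->
  `|cos (a + x) - (cos a - x * sin a - x ^+ 2 / 2 * cos a)| <=
  2 * (x ^+ 2 * (d < `|x|)%R%:R + d * x ^+ 2).
Proof.
move=> d0.
have [c1 c2] := cos_taylor2 x; have [s1 s2] := sin_taylor1 x.
have x2 : 0 <= x ^+ 2 by exact: sqr_ge0.
have -> : cos (a + x) - (cos a - x * sin a - x ^+ 2 / 2 * cos a) =
  cos a * (cos x - 1 + x ^+ 2 / 2) - sin a * (sin x - x).
  by rewrite cosD; ring.
apply: (le_trans (ler_normB _ _)); rewrite !normrM.
have ca : `|cos a| <= 1 by rewrite ler_norml cos_geN1 cos_le1.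
have sa : `|sin a| <= 1 by rewrite ler_norml sin_geN1 sin_le1.
have e3 : `|x| ^+ 3 = `|x| * x ^+ 2 by rewrite exprS real_normK ?num_real.
have b1 : `|cos a| * `|cos x - 1 + x ^+ 2 / 2| <= `|cos x - 1 + x ^+ 2 / 2|.
  by rewrite ler_piMl.
have b2 : `|sin a| * `|sin x - x| <= `|sin x - x| by rewrite ler_piMl.
have [l|l] := ltP d `|x|; rewrite /= ?mulr1 ?mulr0.
  have : 0 <= d * x ^+ 2 by rewrite mulr_ge0.
  by lra.
have : `|x| * x ^+ 2 <= d * x ^+ 2 by rewrite ler_wpM2r.
by lra.
Qed.

Lemma expRN_taylor1 v : 0 <= v -> `|expR (- v) - (1 - v)| <= v ^+ 2.
Proof.
move=> v0; have h := expR_ge1Dx (- v); rewrite ger0_norm; last by lra.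
have h2 := expR_ge1Dx v.
have p0 : 0 < 1 + v by lra.
rewrite expRN; have : (expR v)^-1 <= (1 + v)^-1 by rewrite lef_pV2 ?posrE ?expR_gt0.
have : (1 + v)^-1 <= 1 - v + v ^+ 2.
  rewrite -(ler_pM2l p0) divff ?gt_eqF//.
  have : 0 <= v ^+ 3 by rewrite exprn_ge0.
  rewrite exprS expr2; nra.
lra.
Qed.

(** The derivative [cos] is at least 1/2 on [[-1, 1]], by [cos_ge_quad]. This controls the inverse
    of the sine, used below to place the nodes of the approximation. *)
Lemma sin_lower_lip a x : -1 <= a -> a <= x -> x <= 1 -> (x - a) / 2 <= sin x - sin a.
Proof.
move=> a1 ax x1.
pose f (y : R) := sin y - y / 2.
have df (y : R) : is_derive y 1 f (cos y - 2^-1).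
  by apply: is_derive_eq; rewrite /GRing.scale/=; lra.
have := @ger0_derive1_ndecr _ f a x _ _ _ a x (lexx _) ax (lexx _).
rewrite /f; move=> h; suff : sin a - a / 2 <= sin x - x / 2 by lra.
apply: h => [z _|z|].
- exact: ex_derive.
- rewrite in_itv/= => /andP[az zx]; rewrite derive1E (@derive_val _ _ _ _ _ _ _ (df z)).
  have := cos_ge_quad z; have : z ^+ 2 <= 1 by rewrite expr2; nra.
  lra.
- apply: continuous_subspaceT => z; apply: differentiable_continuous.
  by apply/derivable1_diffP; exact: ex_derive.
Qed.

Lemma cosM a x : cos a * cos x = 2^-1 * cos (a + x) + 2^-1 * cos (a - x).
Proof. by rewrite cosD cosB; lra. Qed.

End TrigBounds.

Section TrigPoly.
Variables (R : realType) (n : nat).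
Implicit Types (u z : 'rV[R]_n).

Definition dot u z : R := \sum_i u 0 i * z 0 i.

(** The phase [th] covers sines, and the product-to-sum formula makes the class an algebra. *)
Inductive trig_poly : ('rV[R]_n -> R) -> Prop :=
| trig_cos u th : trig_poly (fun z => cos (dot u z + th))
| trig_add f g : trig_poly f -> trig_poly g -> trig_poly (fun z => f z + g z)
| trig_scale c f : trig_poly f -> trig_poly (fun z => c * f z).

Lemma dotDl u v z : dot (u + v) z = dot u z + dot v z.
Proof. by rewrite /dot -big_split; apply: eq_bigr => i _; rewrite mxE mulrDl. Qed.

Lemma dotNl u z : dot (- u) z = - dot u z.
Proof. by rewrite /dot -sumrN; apply: eq_bigr => i _; rewrite mxE mulNr. Qed.

Lemma dot0l z : dot 0 z = 0.
Proof. by rewrite /dot big1// => i _; rewrite mxE mul0r. Qed.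

Lemma dotZl (c : R) u z : dot (c *: u) z = c * dot u z.
Proof. by rewrite /dot mulr_sumr; apply: eq_bigr => i _; rewrite mxE mulrA. Qed.

Lemma dot_delta i z : dot (delta_mx 0 i) z = z 0 i.
Proof.
rewrite /dot (bigD1 i)//= mxE !eqxx mul1r big1 ?addr0// => j ji.
by rewrite mxE eqxx (negbTE ji) mul0r.
Qed.

Lemma trig_cst c : trig_poly (fun=> c).
Proof.
have -> : (fun=> c) = (fun z => c * cos (dot 0 z + 0)).
  by apply/funext => z; rewrite dot0l addr0 cos0 mulr1.
exact/trig_scale/trig_cos.
Qed.

Lemma trig_mul f g : trig_poly f -> trig_poly g -> trig_poly (fun z => f z * g z).
Proof.
move=> hf; elim: hf g => {f} [u th|f1 f2 h1 IH1 h2 IH2|c f h IH] g hg.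
- elim: hg => {g} [v th'|g1 g2 h1 IH1 h2 IH2|c g h IH].
  + have -> : (fun z => cos (dot u z + th) * cos (dot v z + th')) =
      (fun z => 2^-1 * cos (dot (u + v) z + (th + th')) +
                2^-1 * cos (dot (u - v) z + (th - th'))).
      apply/funext => z; rewrite cosM; congr (_ * cos _ + _ * cos _).
        by rewrite dotDl; ring.
      by rewrite dotDl dotNl; ring.
    by apply: trig_add; apply/trig_scale/trig_cos.
  + under eq_fun do rewrite mulrDr.
    exact: trig_add.
  + under eq_fun do rewrite mulrCA.
    exact: trig_scale.
- under eq_fun do rewrite mulrDl.
  by apply: trig_add; [exact: IH1|exact: IH2].
- under eq_fun do rewrite -mulrA.
  by apply: trig_scale; exact: IH.
Qed.

Lemma trig_sin_coord c i : trig_poly (fun z => sin (c * z 0 i)).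
Proof.
have -> : (fun z => sin (c * z 0 i)) = (fun z => cos (dot (c *: delta_mx 0 i) z + - (pi / 2))).
  by apply/funext => z; rewrite dotZl dot_delta cosB cos_pihalf sin_pihalf mulr0 add0r mulr1.
exact: trig_cos.
Qed.

End TrigPoly.

(** * Multivariate Bernstein averages *)

Section Bernstein.
Variable R : realType.

(* Expectation of [phi] under the binomial law, unfolding one Bernoulli trial at a time. *)
Fixpoint bern (m : nat) (y : R) (phi : nat -> R) : R :=
  if m is m'.+1 then y * bern m' y (phi \o S) + (1 - y) * bern m' y phi
  else phi 0%N.

Lemma bern_le m y (phi psi : nat -> R) : 0 <= y <= 1 ->
  (forall k, (k <= m)%N -> phi k <= psi k) -> bern m y phi <= bern m y psi.
Proof.
move=> /andP[y0 y1]; elim: m phi psi => [|m IH] phi psi h /=; first exact: h.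
apply: lerD; apply: ler_wpM2l; rewrite ?subr_ge0//; apply: IH => k km; apply: h => //.
exact: leq_trans km _.
Qed.

Lemma bern_affine m y a b (phi : nat -> R) :
  bern m y (fun k => a + b * phi k) = a + b * bern m y phi.
Proof.
elim: m phi => [//|m IH] phi /=.
rewrite (_ : (fun k => a + b * phi k) \o S = (fun k => a + b * (phi \o S) k))//.
by rewrite !IH; ring.
Qed.

(** Second moment of a binomial variable; the shift [s] absorbs the unit that a success adds in the
    induction. *)
Lemma bern_sqr m y s :
  bern m y (fun k => (k%:R + s) ^+ 2) = (m%:R * y + s) ^+ 2 + m%:R * (y * (1 - y)).
Proof.
elim: m s => [|m IH] s /=; first by rewrite !mul0r !add0r addr0.
rewrite (_ : (fun k => (k%:R + s) ^+ 2) \o S = (fun k => (k%:R + (s + 1)) ^+ 2)).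
  by rewrite !IH -natr1; ring.
by apply/funext => k /=; rewrite -natr1; congr (_ ^+ 2); ring.
Qed.

(** Chebyshev's argument behind Bernstein's theorem: the quadratic penalty averages to the binomial
    variance [m y (1 - y)], which is at most [m / 4]. *)
Lemma bern_dist m y e C c (phi : nat -> R) : 0 <= y <= 1 -> 0 <= C ->
  (forall k, (k <= m)%N -> `|phi k - c| <= e + C * (k%:R - m%:R * y) ^+ 2) ->
  `|bern m y phi - c| <= e + C * (m%:R / 4).
Proof.
move=> y01 C0 h.
have v : bern m y (fun k => (k%:R - m%:R * y) ^+ 2) <= m%:R / 4.
  rewrite bern_sqr subrr expr0n/= add0r ler_wpM2l//.
  by have : 0 <= (y - 2^-1) ^+ 2 := sqr_ge0 _; rewrite expr2; nra.
have v' : C * bern m y (fun k => (k%:R - m%:R * y) ^+ 2) <= C * (m%:R / 4).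
  exact: ler_wpM2l.
rewrite ler_distl; apply/andP; split.
  have : bern m y (fun k => (c - e) + (- C) * (k%:R - m%:R * y) ^+ 2) <= bern m y phi.
    apply: bern_le => // k /h; rewrite ler_distl => /andP[+ _]; lra.
  by rewrite bern_affine; lra.
have : bern m y phi <= bern m y (fun k => (c + e) + C * (k%:R - m%:R * y) ^+ 2).
  by apply: bern_le => // k /h; rewrite ler_distl => /andP[_]; lra.
by rewrite bern_affine; lra.
Qed.

Fixpoint bernN (m : nat) (ys : seq R) (phi : seq nat -> R) : R :=
  if ys is y :: ys' then bern m y (fun k => bernN m ys' (fun s => phi (k :: s)))
  else phi [::].

Lemma bernN_dist m ys e C c phi : (forall y, y \in ys -> 0 <= y <= 1) -> 0 <= C ->
  (forall s, size s = size ys -> all (fun k => (k <= m)%N) s ->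
    `|phi s - c| <= e + C * \sum_(i < size ys)
       ((nth 0%N s i)%:R - m%:R * nth 0 ys i) ^+ 2) ->
  `|bernN m ys phi - c| <= e + C * ((size ys)%:R * (m%:R / 4)).
Proof.
elim: ys e phi => [|y ys IH] e phi y01 C0 h /=.
  by have := h [::] erefl erefl; rewrite big_ord0 mul0r.
have -> : e + C * ((size ys).+1%:R * (m%:R / 4)) =
  (e + C * ((size ys)%:R * (m%:R / 4))) + C * (m%:R / 4) by rewrite -natr1; ring.
apply: bern_dist => //; first by apply: y01; rewrite mem_head.
(* The penalty of the first coordinate is moved into the constant [e], which the induction keeps
   general. *)
move=> k km; rewrite addrAC; apply: IH => //.
  by move=> y' y'ys; apply: y01; rewrite in_cons y'ys orbT.
move=> s ss sm; apply: (le_trans (h (k :: s) _ _)) => /=; first by rewrite ss.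
  by rewrite km.
by rewrite big_ord_recl/= mulrDr addrA.
Qed.

Lemma trig_bern n m (y : 'rV[R]_n -> R) (phi : nat -> 'rV[R]_n -> R) :
  trig_poly y -> (forall k, trig_poly (phi k)) ->
  trig_poly (fun z => bern m (y z) (phi^~ z)).
Proof.
move=> hy; elim: m phi => [|m IH] phi h /=; first exact: h.
apply: trig_add; apply: trig_mul => //.
- exact: (IH (fun k => phi k.+1)).
- have -> : (fun z => 1 - y z) = (fun z => 1 + -1 * y z).
    by apply/funext => z; rewrite mulN1r.
  by apply: trig_add; [exact: trig_cst|exact: trig_scale].
- exact: IH.
Qed.

Lemma trig_bernN n m (I : Type) (s : seq I) (y : I -> 'rV[R]_n -> R) (phi : seq nat -> R) :
  (forall i, trig_poly (y i)) ->
  trig_poly (fun z => bernN m [seq y i z | i <- s] phi).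
Proof.
move=> hy; elim: s phi => [|i s IH] phi /=; first exact: trig_cst.
by apply: trig_bern => // k; exact: IH.
Qed.

End Bernstein.

(** * Approximation on boxes by trigonometric polynomials *)

Section Approximation.
Variables (R : realType) (n : nat).

(** The covering form of compactness, with [eta] tending to zero from the right as filter; only the
    centre [z] has to range over the cube. *)
Lemma cube_unif_continuous (f : 'rV[R]_n -> R) (K e : R) : continuous f -> 0 < e ->
  exists2 eta : R, 0 < eta & forall z z' : 'rV[R]_n, (forall i, `|z 0 i| <= K) ->
    (forall i, `|z 0 i - z' 0 i| < eta) -> `|f z - f z'| < e.
Proof.
move=> cf e0.
pose A : set 'rV[R]_n := [set z | forall i, (`[-K, K]%classic : set R) (z ord0 i)].
have cA : compact A by exact: (@rV_compact R n (fun=> `[-K, K]%classic) (fun=> @segment_compact R (- K) K)).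
move/compact_near_coveringP : cA => /(_ R (0:R)^'+
  (fun eta z => forall z' : 'rV[R]_n, ball z eta z' -> `|f z - f z'| < e) _) h.
have [eta/= eta0 H] : \forall eta \near (0:R)^'+, A `<=` (fun z => forall z' : 'rV[R]_n, ball z eta z' -> `|f z - f z'| < e).
  apply: h => z Az.
  have e2 : 0 < e / 2 by rewrite divr_gt0.
  have /nbhs_ballP[r/= r0 hr] : \forall x \near z, `|f z - f x| < e / 2.
    by have /cvgrPdist_lt/(_ _ e2) := cf z.
  exists (ball z (r / 2), [set eta | 0 < eta < r / 2]) => /=.
    split; first by apply: nbhsx_ballx; rewrite divr_gt0.
    by near=> y; apply/andP; split; near: y; [exact: nbhs_right_gt|apply: nbhs_right_lt; rewrite divr_gt0].
  move=> [x eta]/= [zx /andP[eta0 etar]] z' xz'.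
  have hx : `|f z - f x| < e / 2.
    by apply: hr; apply: le_ball zx; lra.
  have hz' : `|f z - f z'| < e / 2.
    apply: hr; apply: le_ball (ball_triangle zx xz'); lra.
  rewrite distrC in hx; have := ler_distD (f z) (f x) (f z'); lra.
have := H (eta / 2); rewrite /ball_ /=; have /[swap]/[apply] : 0 < eta / 2 by rewrite divr_gt0.
have -> : `|0 - eta / 2| < eta by rewrite sub0r normrN gtr0_norm ?divr_gt0//; lra.
move=> /(_ isT) HA.
exists (eta / 2); first by rewrite divr_gt0.
move=> z z' zK zz'; apply: HA.
  by move=> i /=; rewrite in_itv/= -ler_norml.
split; first by rewrite divr_gt0.
by move=> i j; rewrite !ord1; exact: zz'.
Unshelve. all: by end_near. Qed.

Definition clip (x : R) := Num.max (-1) (Num.min 1 x).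

(** [asin] is not Lipschitz at the ends of its domain. Clipping its values to [[-1, 1]], where the
    sine has slope at least 1/2, restores a Lipschitz bound with constant 2. *)
Lemma asin_clip_lip (x q : R) : -1 <= x <= 1 -> 0 <= q <= 1 ->
  `|x - clip (asin (2 * q - 1))| <= 2 * `|sin x - (2 * q - 1)|.
Proof.
move=> x1 q01.
have as1 : -1 <= 2 * q - 1 <= 1 by lra.
have hsin : sin (asin (2 * q - 1)) = 2 * q - 1 by rewrite asinK.
rewrite -{2}hsin; set b := asin _.
have b1 : - (pi / 2) <= b by exact: asin_geNpi2.
have b2 : b <= pi / 2 by exact: asin_lepi2.
have p1 : 1 <= pi / 2 :> R by have := pi_ge2 R; lra.
have {hsin q01 as1} : True by [].
have sinmono (u v : R) : - (pi / 2) <= u -> u <= v -> v <= pi / 2 -> sin u <= sin v.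
  move=> u1 uv v2; have [->//|uv'] := eqVneq u v.
  have {uv'}uv' : u < v by rewrite lt_neqAle uv'.
  by rewrite ltW// ltr_sin// in_itv/= ?u1 ?v2 ?andbT//=; [exact: le_trans uv v2|exact: le_trans u1 uv].
have lip (u v : R) : -1 <= u <= 1 -> -1 <= v <= 1 -> `|u - v| <= 2 * `|sin u - sin v|.
  wlog uv : u v / u <= v => [hw|] u1 v1.
    have [/hw|/ltW/hw] := leP u v; first exact.
    by rewrite (distrC u) (distrC (sin u)); apply.
  have := @sin_lower_lip _ u v; move=> /(_ ltac:(lra) uv ltac:(lra)) hl.
  by rewrite distrC (distrC (sin u)) !ger0_norm; lra.
move=> _; rewrite /clip.
(* When [b] leaves [[-1, 1]] the clipped value is an endpoint, whose sine lies between [sin b] and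
   [sin x] by monotonicity, so the bound only improves. *)
have [bl|bl] := leP b (-1).
  have -> : Num.min 1 b = b by apply/min_idPr; lra.
  have -> : Num.max (-1) b = -1 by apply/max_idPl.
  apply: (le_trans (lip _ _ _ _)) => //; first by lra.
  have h1 := sinmono b (-1) b1 bl ltac:(lra).
  have h2 := sinmono (-1) x ltac:(lra) ltac:(lra) ltac:(lra).
  by rewrite !ger0_norm; lra.
have [bu|bu] := leP b 1.
  have -> : Num.max (-1) b = b by apply/max_idPr; lra.
  by apply: lip => //; lra.
have -> : Num.max (-1) 1 = 1 :> R by apply/max_idPr; lra.
apply: (le_trans (lip _ _ _ _)) => //; first by lra.
have h1 := sinmono 1 b ltac:(lra) (ltW bu) b2.
have h2 := sinmono x 1 ltac:(lra) ltac:(lra) ltac:(lra).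
by rewrite !ler0_norm; lra.
Qed.

(** Bernstein averages in the variables [(1 + sin (z_i / K)) / 2], which stay in [[0, 1]] for every
    [z]. Being averages of values of [f], they obey the bound [M] on the whole space and not only on
    the box, as tightness arguments require. *)
Lemma trig_approx (f : 'rV[R]_n -> R) (M K e : R) : continuous f ->
  (forall v, `|f v| <= M) -> 0 < K -> 0 < e ->
  exists T : 'rV[R]_n -> R, [/\ trig_poly T, (forall z, `|T z| <= M) &
    forall z : 'rV[R]_n, (forall i, `|z 0 i| <= K) -> `|f z - T z| <= e].
Proof.
move=> cf fM K0 e0.
have M0 : 0 <= M by apply: le_trans (fM 0).
have e2 : 0 < e / 2 by rewrite divr_gt0.
have [eta eta0 ueta] := @cube_unif_continuous f K _ cf e2.
(* [asin_clip_lip], the passage from [q] to [2 * q - 1] and the scale [K] put a factor [4 * K]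
   between the deviation [|q - y i z|] and the distance from the node to [z]. *)
pose d := eta / (4 * K).
have d0 : 0 < d by rewrite divr_gt0// mulr_gt0.
(* Large enough for the Chebyshev term [M * n / (2 * d ^+ 2 * m)] to be at most [e / 2]. *)
pose m := (Num.trunc (M * n%:R / (d ^+ 2 * e))).+1.
have m0 : 0 < m%:R :> R by rewrite ltr0n.
have hm : M * n%:R / (d ^+ 2 * e) <= m%:R.
  by rewrite ltW// truncnS_gt.
pose y (i : 'I_n) (z : 'rV[R]_n) := 2^-1 + 2^-1 * sin (K^-1 * z 0 i).
pose node (k : nat) := K * clip (asin (2 * (k%:R / m%:R) - 1)).
pose phi (s : seq nat) := f (\row_i node (nth 0%N s i)).
have y01 z : forall v, v \in [seq y i z | i <- enum 'I_n] -> 0 <= v <= 1.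
  move=> v /mapP[i _ ->]; rewrite /y.
  by have := sin_le1 (K^-1 * z 0 i); have := sin_geN1 (K^-1 * z 0 i); lra.
exists (fun z => bernN m [seq y i z | i <- enum 'I_n] phi); split.
- apply: trig_bernN => i; apply: trig_add; first exact: trig_cst.
  exact/trig_scale/trig_sin_coord.
- move=> z; rewrite -[X in `|X|]subr0.
  have -> : M = M + 0 * ((size [seq y i z | i <- enum 'I_n])%:R * (m%:R / 4)) by rewrite mul0r addr0.
  by apply: (bernN_dist (y01 z)) => // s _ _; rewrite mul0r addr0 subr0; exact: fM.
- move=> z zK; rewrite distrC.
  (* With this constant, a single coordinate deviating by [d] makes the penalty at least [2 * M]. *)
  pose C := 2 * M / (d ^+ 2 * m%:R ^+ 2).
  have C0 : 0 <= C by apply: divr_ge0; apply: mulr_ge0 => //; exact: sqr_ge0.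
  have := @bernN_dist R m [seq y i z | i <- enum 'I_n] (e / 2) C (f z) phi (y01 z) C0.
  rewrite size_map size_enum_ord => H; apply: (le_trans (H _)).
    move=> s ss sm.
    have Csum0 : 0 <= C * \sum_(i < n) ((nth 0%N s i)%:R - m%:R * nth 0 [seq y i0 z | i0 <- enum 'I_n] i) ^+ 2.
      by rewrite mulr_ge0// sumr_ge0// => i _; exact: sqr_ge0.
    have [allc|/existsNP[i /negP]] := pselect (forall i : 'I_n, `|(nth 0%N s i)%:R / m%:R - y i z| < d).
      rewrite ler_wpDr// ltW// distrC; apply: ueta => // i; rewrite mxE.
      have ki : ((nth 0%N s i) <= m)%N by move/all_nthP : sm => /(_ 0%N i); apply; rewrite ss.
      have := allc i; set k := nth 0%N s i in ki *; rewrite /node; set q := k%:R / m%:R.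
      have q01 : 0 <= q <= 1.
        by rewrite /q divr_ge0//= ler_pdivrMr// mul1r ler_nat.
      set x := K^-1 * z 0 i => hy.
      have x1 : -1 <= x <= 1.
        have Ki : 0 < K^-1 by rewrite invr_gt0.
        by rewrite -ler_norml /x normrM (gtr0_norm Ki) mulrC ler_pdivrMr// mul1r.
      have -> : z 0 i = K * x by rewrite /x mulrA mulfV ?gt_eqF// mul1r.
      rewrite -mulrBr normrM gtr0_norm//.
      have hb : `|x - clip (asin (2 * q - 1))| <= 4 * `|q - y i z|.
        apply: (le_trans (asin_clip_lip x1 q01)).
        rewrite distrC (_ : 2 * q - 1 - sin x = 2 * (q - y i z)); last by rewrite /y -/x; field.
        by rewrite normrM (ger0_norm (ler0n _ 2)) mulrA -natrM.
      have : K * (4 * `|q - y i z|) < K * (4 * d) by rewrite ltr_pM2l// ltr_pM2l.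
      have -> : K * (4 * d) = eta by rewrite /d; field; rewrite gt_eqF.
      apply: le_lt_trans; by rewrite ler_pM2l.
    rewrite -leNgt => di.
    have h2M : `|phi s - f z| <= 2 * M.
      apply: (le_trans (ler_normB _ _)); have := fM z; have := fM (\row_i node (nth 0%N s i)).
      rewrite /phi; lra.
    apply: (le_trans h2M); apply: ler_wpDl; first exact: ltW.
    rewrite (bigD1 i)//= mulrDr ler_wpDr//.
      by rewrite mulr_ge0// sumr_ge0// => j _; exact: sqr_ge0.
    have -> : nth 0 [seq y i0 z | i0 <- enum 'I_n] i = y i z.
      by rewrite (nth_map i) ?size_enum_ord// nth_ord_enum.
    have -> : (nth 0%N s i)%:R - m%:R * y i z = m%:R * ((nth 0%N s i)%:R / m%:R - y i z).
      by rewrite mulrBr mulrCA mulfV ?mulr1// gt_eqF.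
    rewrite exprMn /C.
    have hd : d ^+ 2 <= ((nth 0%N s i)%:R / m%:R - y i z) ^+ 2.
      by rewrite -[leRHS]real_normK ?num_real// lerXn2r ?nnegrE// ltW.
    have -> : 2 * M / (d ^+ 2 * m%:R ^+ 2) * (m%:R ^+ 2 * ((nth 0%N s i)%:R / m%:R - y i z) ^+ 2) =
      2 * M * (((nth 0%N s i)%:R / m%:R - y i z) ^+ 2 / d ^+ 2).
      by field; rewrite !gt_eqF.
    by rewrite ler_peMr ?mulr_ge0// ler_pdivlMr ?mul1r// exprn_gt0.
  have -> : C * (n%:R * (m%:R / 4)) = (M * n%:R / (d ^+ 2 * e)) * (e / 2) / m%:R.
    by rewrite /C; field; rewrite !gt_eqF.
  have : M * n%:R / (d ^+ 2 * e) * (e / 2) / m%:R <= e / 2.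
    by rewrite ler_pdivrMr// mulrC ler_pM2l.
  lra.
Qed.

End Approximation.

(** * Expectations of bounded variables *)

Section BoundedExpectation.
Context {R : realType} {d} {T : measurableType d} (P : probability T R).
Implicit Types f g : T -> R.

Lemma bounded_integrable f (M : R) : measurable_fun setT f ->
  (forall x, `|f x| <= M) -> P.-integrable setT (EFin \o f).
Proof.
move=> mf fM.
apply: (@le_integrable _ _ _ P setT measurableT _ (EFin \o cst M)).
- exact/measurable_EFinP.
- move=> x _ /=; rewrite lee_fin; apply: (le_trans (fM x)).
  by rewrite ger0_norm//; exact: le_trans (fM x).
- exact: finite_measure_integrable_cst.
Qed.

Lemma integral_EFin_bounded f (M : R) : measurable_fun setT f ->
  (forall x, `|f x| <= M) -> (\int[P]_x (f x)%:E)%E = (\int[P]_x f x)%:E.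
Proof.
move=> mf fM; rewrite /Rintegral fineK//.
exact/integrable_fin_num/(bounded_integrable mf fM).
Qed.

Lemma Rintegral_prob_cst (c : R) : \int[P]_x c = c.
Proof. by rewrite Rintegral_cst//= probability_setT mulr1. Qed.

Lemma Rintegral_bounded_le f (M : R) : measurable_fun setT f ->
  (forall x, `|f x| <= M) -> `|\int[P]_x f x| <= M.
Proof.
move=> mf fM; rewrite -[leRHS](Rintegral_prob_cst M).
apply: (le_trans (le_normr_Rintegral _ (bounded_integrable mf fM))) => //.
apply: le_Rintegral => //.
- apply: (@bounded_integrable _ M); first exact: measurableT_comp.
  by move=> x; rewrite normr_id.
- exact: finite_measure_integrable_cst.
Qed.

(** Turns pointwise estimates valid outside an event of small probability into estimates of
    expectations; statements in probability are exploited through it. *)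
Lemma Rintegral_dist_le f g (M e dl : R) (B : set T) : measurable_fun setT f ->
  measurable_fun setT g -> (forall x, `|f x| <= M) -> (forall x, `|g x| <= M) ->
  measurable B -> (P B <= dl%:E)%E -> (forall x, ~ B x -> `|f x - g x| <= e) ->
  0 <= e -> `|\int[P]_x f x - \int[P]_x g x| <= e + 2 * M * dl.
Proof.
move=> mf mg fM gM mB PB fg e0.
have fgM x : `|f x - g x| <= 2 * M.
  by apply: (le_trans (ler_normB _ _)); have := fM x; have := gM x; lra.
have M0 : 0 <= M by have := fgM point; have := normr_ge0 (f point - g point); lra.
have mfg : measurable_fun setT (fun x => f x - g x) by exact: measurable_funB.
rewrite -RintegralB//; [|exact: bounded_integrable fM|exact: bounded_integrable gM].
apply: (le_trans (le_normr_Rintegral _ (bounded_integrable mfg fgM))) => //.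
have mI : measurable_fun setT (fun x => e + 2 * M * \1_B x).
  by apply: measurable_funD => //; apply: measurable_funM => //; exact: measurable_indic.
have iI : P.-integrable setT (EFin \o (fun x => e + 2 * M * \1_B x)).
  apply: (@bounded_integrable _ (e + 2 * M)) => // x; rewrite ger0_norm.
    by rewrite indicE; case: (x \in B); rewrite ?mulr1 ?mulr0 ?addr0//; lra.
  by rewrite addr_ge0// !mulr_ge0.
apply: (@le_trans _ _ (\int[P]_x (e + 2 * M * \1_B x))).
  apply: le_Rintegral => //.
    apply: (@bounded_integrable _ (2 * M)); first exact: measurableT_comp.
    by move=> x; rewrite normr_id.
  move=> x _; rewrite indicE; case: (boolP (x \in B)) => xB.
    by rewrite mulr1; have := fgM x; lra.
  by rewrite mulr0 addr0; apply: fg => /mem_set; rewrite (negbTE xB).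
have iB : P.-integrable setT (EFin \o (\1_B : T -> R)).
  apply: (@bounded_integrable _ 1); first exact: measurable_indic.
  by move=> x; rewrite indicE; case: (x \in B); rewrite ?normr1 ?normr0.
rewrite RintegralD//.
- rewrite RintegralZl// Rintegral_prob_cst lerD2l ler_wpM2l ?mulr_ge0//.
  rewrite /Rintegral integral_indic// setIT.
  by rewrite -lee_fin fineK ?fin_num_measure.
- exact: finite_measure_integrable_cst.
- by have := integrableZl (measurableT) (2 * M) iB; apply: eq_integrable.
Qed.

Lemma probability_bigsetU_le (I : Type) (s : seq I) (B : I -> set T) (dl : R) :
  (forall i, measurable (B i)) -> (forall i, (P (B i) <= dl%:E)%E) ->
  (P (\big[setU/set0]_(i <- s) B i) <= ((size s)%:R * dl)%:E)%E.
Proof.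
move=> mB PB; elim: s => [|i s IH]; first by rewrite big_nil measure0 mul0r.
rewrite big_cons; apply: (le_trans (measureU2 _ _ _)) => //.
  by apply: bigsetU_measurable.
rewrite /= -natr1 mulrDl mul1r addrC EFinD.
exact: leeD.
Qed.

(** Continuity from above along the events [k < |f|], whose intersection is empty. *)
Lemma tight_single f (dl : R) : measurable_fun setT f -> 0 < dl ->
  exists K : R, exists B, [/\ measurable B, (P B <= dl%:E)%E & forall w, ~ B w -> `|f w| <= K].
Proof.
move=> mf dl0.
pose F (k : nat) := [set w | k%:R < `|f w|].
have mF k : measurable (F k).
  rewrite (_ : F k = (Num.norm \o f) @^-1` `]k%:R, +oo[%classic).
    by rewrite -[X in measurable X]setTI; apply: measurableT_comp.
  by apply/seteqP; split => w /=; rewrite in_itv/= andbT.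
have F0 : \bigcap_n F n = set0.
  apply/seteqP; split => // w h.
  have := h (Num.trunc `|f w|).+1 I; rewrite /F/= => /ltW.
  by rewrite leNgt truncnS_gt.
have : (P \o F) @ \oo --> P (\bigcap_n F n).
  apply: nonincreasing_cvg_mu => //.
  - by rewrite ltey_eq fin_num_measure.
  - by rewrite F0.
  - move=> m n mn; apply/subsetPset => w /=; apply: le_lt_trans.
    by rewrite ler_nat.
rewrite F0 measure0 => /fine_cvgP[_ /cvgrPdist_le/(_ _ dl0)[k _ /(_ k (leqnn _))]].
rewrite /= sub0r normrN => h.
exists k%:R, (F k); split => //.
  rewrite -(fineK (fin_num_measure P _ (mF k))) lee_fin.
  exact: le_trans (ler_norm _) h.
by move=> w /negP; rewrite -leNgt.
Qed.

End BoundedExpectation.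

Lemma measurable_cosT {R : realType} : measurable_fun setT (@cos R).
Proof. by apply: continuous_measurable_fun; exact: continuous_cos. Qed.

Section RowVectors.
Context {R : realType} {n : nat} {d} {T : measurableType d}.

Lemma measurable_dot (u : 'rV[R]_n) (Z : T -> 'rV[R]_n) :
  (forall i, measurable_fun setT (fun w => Z w 0 i)) ->
  measurable_fun setT (fun w => dot u (Z w)).
Proof.
move=> mZ; apply: measurable_sum => i.
by apply: measurable_funM.
Qed.

Lemma measurable_trig (f : 'rV[R]_n -> R) (Z : T -> 'rV[R]_n) : trig_poly f ->
  (forall i, measurable_fun setT (fun w => Z w 0 i)) ->
  measurable_fun setT (fun w => f (Z w)).
Proof.
move=> hf mZ; elim: hf => {f} [u th|f g _ mf _ mg|c f _ mf].
- apply: (measurableT_comp (@measurable_cosT R)).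
  by apply: measurable_funD => //; exact: measurable_dot.
- exact: measurable_funD.
- exact: measurable_funM.
Qed.

Lemma trig_bounded (f : 'rV[R]_n -> R) : trig_poly f -> exists M, forall z, `|f z| <= M.
Proof.
elim => {f} [u th|f g _ [M hM] _ [M' hM']|c f _ [M hM]].
- by exists 1 => z; rewrite ler_norml cos_geN1 cos_le1.
- by exists (M + M') => z; apply: (le_trans (ler_normD _ _)); exact: lerD.
- by exists (`|c| * M) => z; rewrite normrM ler_wpM2l.
Qed.

(** Only the coordinates of [Z] are known to be measurable, so [f (Z w)] is obtained as the
    pointwise limit of trigonometric polynomials that approximate [f] on growing boxes. *)
Lemma measurable_cont_row (f : 'rV[R]_n -> R) (M : R) (Z : T -> 'rV[R]_n) : continuous f ->
  (forall v, `|f v| <= M) ->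
  (forall i, measurable_fun setT (fun w => Z w 0 i)) ->
  measurable_fun setT (fun w => f (Z w)).
Proof.
move=> cf fM mZ.
have /choice[T_ hT] : forall k : nat, exists g : 'rV[R]_n -> R, trig_poly g /\
    forall z : 'rV[R]_n, (forall i, `|z 0 i| <= k.+1%:R) -> `|f z - g z| <= k.+1%:R^-1.
  move=> k; have [||g [? _ ?]] := @trig_approx R n f M k.+1%:R k.+1%:R^-1 cf fM.
  - by rewrite ltr0n.
  - by rewrite invr_gt0 ltr0n.
  by exists g.
apply: (@measurable_fun_cvg _ _ _ _ (fun k w => T_ k (Z w))).
  by move=> k; apply: measurable_trig => //; exact: (hT k).1.
move=> w _; apply/cvgrPdist_le => e e0.
pose b := (\sum_i `|Z w 0 i|).
exists (maxn (Num.trunc b) (Num.trunc e^-1)) => // k; rewrite /= geq_max => /andP[k1 k2].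
apply: (le_trans ((hT k).2 _ _)).
  move=> i; apply: (@le_trans _ _ b).
    by rewrite /b (bigD1 i)//= lerDl sumr_ge0.
  apply: (le_trans (ltW (truncnS_gt b))); by rewrite ler_nat.
rewrite invf_ple ?posrE ?invr_gt0 ?ltr0n//.
by apply: (le_trans (ltW (truncnS_gt e^-1))); rewrite ler_nat.
Qed.

End RowVectors.

(** * Continuity theorem for cosines with phase *)

Section Levy.
Context {R : realType} {n : nat} (dO : nat -> measure_display)
  (Omega : forall N, measurableType (dO N)) (P : forall N, probability (Omega N) R)
  (Z : forall N, Omega N -> 'rV[R]_n)
  {dL} {OmegaL : measurableType dL} (PL : probability OmegaL R) (ZL : OmegaL -> 'rV[R]_n).
Hypothesis mZ : forall N i, measurable_fun setT (fun w => @Z N w 0 i).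
Hypothesis mZL : forall i, measurable_fun setT (fun w => ZL w 0 i).
Hypothesis cvg_cos : forall u th,
  (\int[P N]_w cos (dot u (@Z N w) + th)) @[N --> \oo] --> \int[PL]_w cos (dot u (ZL w) + th).

Lemma cvg_trig f : trig_poly f ->
  (\int[P N]_w f (@Z N w)) @[N --> \oo] --> \int[PL]_w f (ZL w).
Proof.
have bi d (T : measurableType d) (Q : probability T R) (X : T -> 'rV[R]_n) h :
    (forall i, measurable_fun setT (fun w => X w 0 i)) -> trig_poly h ->
    Q.-integrable setT (EFin \o (fun w => h (X w))).
  move=> mX hf; have [M hM] := trig_bounded hf.
  exact: bounded_integrable (measurable_trig hf mX) (fun w => hM (X w)).
elim => {f} [u th|f g hf IHf hg IHg|c f hf IHf].
- exact: cvg_cos.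
- rewrite RintegralD//; [|exact: bi|exact: bi].
  under eq_fun do (rewrite RintegralD//; [|exact: bi|exact: bi]).
  exact: cvgD.
- rewrite RintegralZl//; last exact: bi.
  under eq_fun do (rewrite RintegralZl//; last exact: bi).
  by apply: cvgM => //; exact: cvg_cst.
Qed.

Hypothesis tight : forall dl : R, 0 < dl -> exists K : R, \forall N \near \oo, forall i,
  exists B, [/\ measurable B, (P N B <= dl%:E)%E & forall w, ~ B w -> `|@Z N w 0 i| <= K].

Lemma levy_continuity : cvg_in_law P Z PL ZL.
Proof.
move=> f cf [M' fM']; pose M : R := M'; have fM v : `|f v| <= M by exact: fM'.
have M0 : 0 <= M by exact: le_trans (fM 0).
have mfL := measurable_cont_row cf fM mZL.
have mfN N := measurable_cont_row cf fM (@mZ N).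
rewrite (integral_EFin_bounded PL mfL (fun w => fM _)).
under eq_fun => N do rewrite (integral_EFin_bounded (P N) (mfN N) (fun w => fM _)).
apply: cvg_EFin; first by near=> N.
apply/cvgrPdist_le => e e0.
(* Five parts: two for comparing [f] with [g] under the limit law, two under [P N], one for the
   convergence of the integrals of [g]. *)
pose e' := e / 5; have e'0 : 0 < e' by rewrite divr_gt0.
(* A union bound over the [n] coordinates costs [2 * M * n * dl <= e']; the added 1 keeps the
   divisor positive. *)
pose dl := e' / (2 * M * n%:R + 1).
have D0 : 0 < 2 * M * n%:R + 1 by rewrite ltr_wpDl// !mulr_ge0.
have dl0 : 0 < dl by rewrite divr_gt0.
have [K hK] := tight dl0.
have /choice[KL hKL] : forall i, exists K : R, exists B, [/\ measurable B, (PL B <= dl%:E)%E & forall w, ~ B w -> `|ZL w 0 i| <= K].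
  by move=> i; exact: tight_single.
pose K' := 1 + `|K| + \sum_i `|KL i|.
have S0 : 0 <= \sum_i `|KL i| by exact: sumr_ge0.
have K'0 : 0 < K' by rewrite /K'; have := normr_ge0 K; lra.
have [g [tg gM fg]] := trig_approx cf fM K'0 e'0.
have approx d (T : measurableType d) (Q : probability T R) (X : T -> 'rV[R]_n) :
    (forall i, measurable_fun setT (fun w => X w 0 i)) ->
    (forall i, exists B, [/\ measurable B, (Q B <= dl%:E)%E & forall w, ~ B w -> `|X w 0 i| <= K']) ->
    `|\int[Q]_w f (X w) - \int[Q]_w g (X w)| <= 2 * e'.
  move=> mX /choice[B hB].
  pose BB := \big[setU/set0]_(i <- enum 'I_n) B i.
  have mBB : measurable BB by apply: bigsetU_measurable => i _; case: (hB i).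
  have QBB : (Q BB <= (n%:R * dl)%:E)%E.
    rewrite -{1}(card_ord n) cardE; apply: probability_bigsetU_le => i; by case: (hB i).
  have := @Rintegral_dist_le _ _ _ Q (fun w => f (X w)) (fun w => g (X w)) M e' (n%:R * dl) BB.
  move=> /(_ (measurable_cont_row cf fM mX) (measurable_trig tg mX) (fun w => fM _) (fun w => gM _) mBB QBB) h.
  apply: (le_trans (h _ (ltW e'0))).
    move=> w nB; apply: fg => i; case: (hB i) => _ _; apply.
    by move=> Bw; apply: nB; rewrite /BB big_enum/= (bigD1 i)//=; left.
  have -> : 2 * M * (n%:R * dl) = e' * ((2 * M * n%:R) / (2 * M * n%:R + 1)).
    by rewrite /dl; field; rewrite gt_eqF.
  have : (2 * M * n%:R) / (2 * M * n%:R + 1) <= 1 by rewrite ler_pdivrMr// mul1r; lra.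
  move=> hh; have : e' * ((2 * M * n%:R) / (2 * M * n%:R + 1)) <= e' by rewrite ler_piMr// ltW.
  lra.
have aL := approx _ _ PL ZL mZL.
have {}aL : `|\int[PL]_w f (ZL w) - \int[PL]_w g (ZL w)| <= 2 * e'.
  apply: aL => i; have [B [mB PB hB]] := hKL i; exists B; split => // w /hB hw.
  apply: (le_trans hw); apply: (le_trans (ler_norm _)).
  have : `|KL i| <= \sum_i `|KL i| by rewrite (bigD1 i)//= lerDl sumr_ge0.
  by rewrite /K'; have := normr_ge0 K; lra.
have /cvgrPdist_le/(_ _ e'0) cg := cvg_trig tg.
near=> N.
have aN : `|\int[P N]_w f (@Z N w) - \int[P N]_w g (@Z N w)| <= 2 * e'.
  apply: approx => // i.
  have /(_ i)[B [mB PB hB]] : forall i, exists B, [/\ measurable B, (P N B <= dl%:E)%E & forall w, ~ B w -> `|@Z N w 0 i| <= K].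
    by near: N.
  exists B; split => // w /hB hw.
  by apply: (le_trans hw); apply: (le_trans (ler_norm _)); rewrite /K'; lra.
have gN : `|\int[PL]_w g (ZL w) - \int[P N]_w g (@Z N w)| <= e' by near: N.
have e5 : e = 5 * e' by rewrite /e'; field.
move: aL aN gN => /=; rewrite !ler_norml !lerBlDr !lerBrDr e5; lra.
Unshelve. all: by end_near. Qed.

End Levy.

(** * Densities and Gaussian vectors *)

Section Density.
Context {R : realType} {d} {T : measurableType d} (mu : {measure set T -> \bar R}).
Implicit Type f : T -> R.

Definition density f (A : set T) : \bar R := (\int[mu]_(x in A) (f x)%:E)%E.

Lemma density_semi_sigma_additive f : measurable_fun setT f -> (forall x, 0 <= f x) ->
  semi_sigma_additive (density f).
Proof.
move=> mf f0 F mF tF mUF; rewrite /density ge0_integral_bigcup//.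
- apply: is_cvg_ereal_nneg_natsum_cond => n _ _; apply: integral_ge0 => x _.
  by rewrite lee_fin.
- by apply/measurable_funTS; exact/measurable_EFinP.
- by move=> x _; rewrite lee_fin.
Qed.

Lemma density0 f : density f set0 = 0%E.
Proof. by rewrite /density integral_set0. Qed.

Lemma density_ge0 f : (forall x, 0 <= f x) -> forall A, (0 <= density f A)%E.
Proof. by move=> f0 A; apply: integral_ge0 => x _; rewrite lee_fin. Qed.

Definition densM f (mf : measurable_fun setT f) (f0 : forall x, 0 <= f x) :
  {measure set T -> \bar R} :=
  HB.pack (density f) (isMeasure.Build _ _ _ (density f) (density0 f)
    (density_ge0 f0) (density_semi_sigma_additive mf f0)).

Definition densP f (mf : measurable_fun setT f) (f0 : forall x, 0 <= f x)
  (f1 : (\int[mu]_x (f x)%:E = 1)%E) : probability T R :=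
  HB.pack (density f) (isMeasure.Build _ _ _ (density f) (density0 f)
    (density_ge0 f0) (density_semi_sigma_additive mf f0))
   (Measure_isProbability.Build _ _ _ (densM mf f0) f1).

Local Open Scope ereal_scope.
Import HBNNSimple.

Section Integral.
Variables (f : T -> R) (mf : measurable_fun setT f) (f0 : forall x, (0 <= f x)%R).
Variable m : {measure set T -> \bar R}.
Hypothesis mE : forall A, measurable A -> m A = density f A.

Let mfE : measurable_fun setT (fun x => (f x)%:E).
Proof. exact/measurable_EFinP. Qed.

(** Stated for any measure [m] agreeing with the density on measurable sets, so that it applies to
    measures known only through such an equation. The proof is monotone convergence along simple
    functions. *)
Lemma ge0_integral_density (h : T -> \bar R) : measurable_fun setT h -> (forall x, 0 <= h x) ->
  \int[m]_x h x = \int[mu]_x (h x * (f x)%:E).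
Proof.
move=> mh h0; pose h_ := nnsfun_approx measurableT mh.
have -> : \int[m]_x h x = lim (\int[m]_x (EFin \o h_ n) x @[n --> \oo]).
  have fE x : h x = lim ((EFin \o h_ n) x @[n --> \oo]).
    by apply/esym/cvg_lim => //; exact: cvg_nnsfun_approx.
  under eq_integral => x _ do rewrite fE.
  apply: monotone_convergence => //.
  - by move=> n; apply/measurable_EFinP.
  - by move=> n x _ //=; rewrite lee_fin.
  - by move=> x _ a b ab; rewrite lee_fin; exact/lefP/nd_nnsfun_approx.
have -> : \int[mu]_x (h x * (f x)%:E) = lim (\int[mu]_x ((h_ n x)%:E * (f x)%:E) @[n --> \oo]).
  have fg x : h x * (f x)%:E = lim (((h_ n x)%:E * (f x)%:E) @[n --> \oo]).
    apply/esym/cvg_lim => //; apply: cvgeZr => //.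
    exact: (@cvg_nnsfun_approx _ _ _ _ measurableT _ mh).
  under eq_integral => x _ do rewrite fg.
  apply: monotone_convergence => [//| | |].
  - by move=> n; apply/emeasurable_funM => //; exact/measurable_EFinP.
  - by move=> n x _ /=; rewrite mule_ge0 ?lee_fin.
  - by move=> x _ a b ab/=; rewrite lee_wpmul2r ?lee_fin//; exact/lefP/nd_nnsfun_approx.
suff suf n : \int[m]_x (EFin \o h_ n) x = \int[mu]_x ((h_ n x)%:E * (f x)%:E).
  by under eq_fun do rewrite suf.
transitivity (\int[m]_x (\sum_(y \in range (h_ n)) (y * \1_(h_ n @^-1` [set y]) x)%:E)).
  by apply: eq_integral => t _; rewrite /= fimfunE -fsumEFin.
rewrite ge0_integral_fsum//; last 2 first.
  - by move=> y; apply/measurable_EFinP; apply: measurable_funM => //; exact: measurable_indic.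
  - by move=> r x _; exact: nnfun_muleindic_ge0.
transitivity (\int[mu]_x (\sum_(y \in range (h_ n)) (y * \1_(h_ n @^-1` [set y]) x)%:E * (f x)%:E)); last first.
  apply: eq_integral => x _.
  by rewrite -ge0_mule_fsuml ?fsumEFin -?fimfunE// => y; exact: nnfun_muleindic_ge0.
rewrite ge0_integral_fsum//; last 2 first.
  - move=> y; apply: emeasurable_funM => //; apply/measurable_EFinP.
    by apply: measurable_funM => //; exact: measurable_indic.
  - by move=> r x _; rewrite mule_ge0 ?lee_fin//; exact: nnfun_muleindic_ge0.
apply: eq_fsbigr => r /[!inE] -[x _ <-].
have mA : measurable (h_ n @^-1` [set h_ n x]) by exact: measurable_sfunP.
under eq_integral do rewrite EFinM.
have hx0 : 0 <= (h_ n x)%:E by rewrite lee_fin.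
rewrite ge0_integralZl//; last by apply/measurable_EFinP; exact: measurable_indic.
rewrite integral_indic// setIT mE// /density.
under [RHS]eq_integral do rewrite EFinM -muleA.
rewrite ge0_integralZl//; last 2 first.
  - by apply: emeasurable_funM => //; apply/measurable_EFinP; exact: measurable_indic.
  - by move=> y _; rewrite mule_ge0 ?lee_fin.
congr (_ * _); rewrite [LHS]integral_mkcond; apply: eq_integral => y _.
by rewrite patchE indicE; case: ifP => _; rewrite ?mul1e ?mul0e.
Qed.

Lemma integral_density (h : T -> R) : measurable_fun setT h ->
  \int[m]_x (h x)%:E = \int[mu]_x (h x * f x)%:E.
Proof.
move=> mh; rewrite integralE [RHS]integralE.
have mhE : measurable_fun setT (EFin \o h) by exact/measurable_EFinP.
rewrite !ge0_integral_density//; last 2 first.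
- exact: measurable_funeneg.
- exact: measurable_funepos.
congr (_ - _); apply: eq_integral => x _.
- by rewrite !funeposE -!EFin_max -EFinM maxr_pMl// mul0r.
- by rewrite !funenegE -!EFinN -!EFin_max -EFinM maxr_pMl// mul0r mulNr.
Qed.

Lemma Rintegral_density (h : T -> R) : measurable_fun setT h ->
  (\int[m]_x h x)%R = (\int[mu]_x (h x * f x))%R.
Proof. by move=> mh; rewrite /Rintegral integral_density. Qed.

End Integral.
End Density.

Definition imageM {d1 d2} {X : measurableType d1} {Y : measurableType d2} {R : realType}
    (m : {measure set X -> \bar R}) (phi : X -> Y) (mphi : measurable_fun setT phi) :
    {measure set Y -> \bar R} :=
  measure_function_pushforward__canonical__measure_function_Measure m mphi.

(** * A real law is determined by its cosine transform *)

Section LawUnique.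
Context {R : realType} {d1 d2} {T1 : measurableType d1} {T2 : measurableType d2}
  (P1 : probability T1 R) (P2 : probability T2 R) (W1 : T1 -> R) (W2 : T2 -> R).
Hypothesis mW1 : measurable_fun setT W1.
Hypothesis mW2 : measurable_fun setT W2.
Hypothesis eq_cos : forall u th : R,
  \int[P1]_w cos (u * W1 w + th) = \int[P2]_w cos (u * W2 w + th).

(** A constant sequence of laws satisfies the hypotheses of [levy_continuity]; uniqueness of limits
    turns convergence into equality. *)
Lemma eq_integral_bounded_continuous (h : R -> R) (M : R) : continuous h ->
  (forall x, `|h x| <= M) ->
  (\int[P1]_w (h (W1 w))%:E = \int[P2]_w (h (W2 w))%:E)%E.
Proof.
move=> ch hM.
pose Z1 (w : T1) : 'rV[R]_1 := \row_i W1 w.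
pose Z2 (w : T2) : 'rV[R]_1 := \row_i W2 w.
have mZ1 i : measurable_fun setT (fun w => Z1 w 0 i) by under eq_fun do rewrite mxE.
have mZ2 i : measurable_fun setT (fun w => Z2 w 0 i) by under eq_fun do rewrite mxE.
have dE d (T : measurableType d) (W : T -> R) (u : 'rV[R]_1) th w :
    dot u (\row_i W w) + th = u 0 0 * W w + th.
  by rewrite /dot big_ord1 mxE.
have := @levy_continuity R 1 _ (fun=> T1) (fun=> P1) (fun=> Z1) _ T2 P2 Z2 (fun=> mZ1) mZ2.
move=> /(_ _ _ (fun v => h (v 0 0))) H.
have {}H : ((fun=> \int[P1]_w (h (W1 w))%:E) @ \oo --> \int[P2]_w (h (W2 w))%:E)%E.
  have -> : (\int[P1]_w (h (W1 w))%:E = \int[P1]_w (h (Z1 w 0 0))%:E)%E.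
    by apply: eq_integral => w _; rewrite mxE.
  have -> : (\int[P2]_w (h (W2 w))%:E = \int[P2]_w (h (Z2 w 0 0))%:E)%E.
    by apply: eq_integral => w _; rewrite mxE.
  apply: H.
  - move=> u th; rewrite (_ : \int[P2]_w _ = \int[P1]_w cos (dot u (Z1 w) + th)); last first.
      under eq_Rintegral do rewrite dE.
      by rewrite -eq_cos; apply: eq_Rintegral => w _; rewrite dE.
    exact: cvg_cst.
  - move=> dl dl0; have [K [B hB]] := tight_single P1 mW1 dl0.
    exists K; near=> N => i; exists B; case: hB => mB PB hB; split => // w.
    by rewrite mxE; exact: hB.
  - move=> v; apply: (@continuous_comp _ _ _ (fun v : 'rV[R]_1 => v 0 0) h).
      exact: coord_continuous.
    exact: ch.
  - by exists M => v.
have := cvg_unique _ H (cvg_cst _).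
by move=> /(_ _)->.
Unshelve. all: by end_near. Qed.

Lemma eq_law_cos (B : set R) : measurable B -> P1 (W1 @^-1` B) = P2 (W2 @^-1` B).
Proof.
move=> mB.
have hset (a : R) : P1 (W1 @^-1` `[a, +oo[%classic) = P2 (W2 @^-1` `[a, +oo[%classic).
  (* [(|y| - |y - 1| + 1) / 2] is [y] clamped to [[0, 1]]: for positive [k] the ramp [h k] is 1 from
     [a] on and 0 below [a - 1 / k], so it tends to the indicator of [[a, +oo[]. *)
  pose h (k : nat) (x : R) :=
    (`|1 + k%:R * (x - a)| - `|1 + k%:R * (x - a) - 1| + 1) / 2.
  have ch k : continuous (h k).
    have cy x : 1 + k%:R * (z - a) @[z --> x] --> 1 + k%:R * (x - a).
      apply: cvgD; first exact: cvg_cst.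
      by apply: cvgM; [exact: cvg_cst|apply: cvgB; [exact: cvg_id|exact: cvg_cst]].
    move=> x; apply: cvgM; last exact: cvg_cst.
    apply: cvgD; last exact: cvg_cst.
    apply: cvgB; apply: cvg_norm; first exact: cy.
    by apply: cvgB; [exact: cy|exact: cvg_cst].
  have h01 k x : 0 <= h k x <= 1.
    rewrite /h; set y := 1 + _.
    by case: (ger0P y) => ?; case: (ger0P (y - 1)) => ?; lra.
  have hM k x : `|h k x| <= 1.
    by have /andP[h0 h1] := h01 k x; rewrite ger0_norm.
  have hcvg d (T : measurableType d) (P : probability T R) (W : T -> R) :
     measurable_fun setT W ->
     (\int[P]_w (h k (W w))%:E @[k --> \oo] --> P (W @^-1` `[a, +oo[%classic))%E.
    move=> mW.
    have mA : measurable (W @^-1` `[a, +oo[%classic).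
      by rewrite -[X in measurable X]setTI; exact: mW.
    rewrite -[X in _ --> P X]setIT -integral_indic//.
    apply: (@dominated_cvg _ _ _ P setT measurableT _ _ (cst 1%E)) => //.
    - move=> k; apply/measurable_EFinP.
      by apply: measurableT_comp => //; exact: continuous_measurable_fun.
    - move=> w _; apply: cvg_EFin; first by near=> k.
      rewrite indicE; case: (boolP (w \in _)) => [/set_mem|/negP wA] /=.
        rewrite in_itv/= andbT => aW; apply: cvg_near_cst; near=> k => /=.
        have kW : 0 <= k%:R * (W w - a) by rewrite mulr_ge0// subr_ge0.
        by rewrite /h !ger0_norm; lra.
      have {}wA : W w < a by rewrite ltNge; apply/negP => aW; apply: wA; apply/mem_set; rewrite /= in_itv/= aW.
      apply: cvg_near_cst; near=> k => /=.
      have : (a - W w)^-1 <= k%:R by near: k; exact: nbhs_infty_ger.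
      rewrite -[X in X <= _]mul1r ler_pdivrMr ?subr_gt0// => hk.
      have kW : k%:R * (W w - a) <= -1 by rewrite -(opprB a) mulrN; lra.
      by rewrite /h !ler0_norm; lra.
    - apply: finite_measure_integrable_cst => //.
    - by move=> k w _; rewrite /= lee_fin.
  have := hcvg _ _ P1 W1 mW1.
  under eq_fun do rewrite (eq_integral_bounded_continuous (ch _) (hM _)).
  move=> H; exact: (cvg_unique _ H (hcvg _ _ P2 W2 mW2)).
pose m1 := imageM P1 mW1; pose m2 := imageM P2 mW2.
have mE : (measurable : set (set R)) = <<s @RGenCInfty.G R >>.
  by rewrite -[RHS]/((@RGenCInfty.G R).-sigma.-measurable) -RGenCInfty.measurableE.
apply: (@measure_unique _ _ _ (@RGenCInfty.G R) (fun i => `[- i%:R, +oo[%classic) mE _ _ _ m1 m2) => //.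
- move=> A A' [x ->] [y ->]; exists (Num.max x y); apply/seteqP; split => z /=; rewrite !in_itv/= !andbT ge_max.
    by move=> [-> ->].
  by move=> /andP[-> ->].
- by move=> i; eexists.
- apply/seteqP; split => // x _; exists (Num.trunc (- x)).+1 => //=.
  by rewrite in_itv/= andbT lerNl ltW// truncnS_gt.
- by move=> A [x ->]; exact: hset.
- move=> k; apply: (le_lt_trans (probability_le1 P1 _)); last exact: ltry.
  by rewrite -[X in measurable X]setTI; exact: mW1.
Unshelve. all: by end_near. Qed.

End LawUnique.

(** * Characteristic function of the centered normal law *)

Section NormalCharacteristic.
Variables (R : realType) (s : R).
Hypothesis s0 : 0 < s.
Local Notation mu := (@lebesgue_measure R).
Local Notation p := (normal_pdf 0 s).

Let sn0 : s != 0. Proof. by rewrite gt_eqF. Qed.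

Lemma normal_pdf0E : p = (fun x => normal_peak s * expR (- (2 * s ^+ 2)^-1 * x ^+ 2)).
Proof.
apply/funext => x; rewrite normal_pdfE// /normal_fun subr0; congr (_ * expR _).
by rewrite -mulr_natl; field; rewrite sn0.
Qed.

Lemma is_derive_normal_pdf (x : R) : is_derive x 1 p (- (x / s ^+ 2) * p x).
Proof.
rewrite normal_pdf0E.
pose q (x : R) := - (2 * s ^+ 2)^-1 * x ^+ 2.
have dq : is_derive x 1 q (- (x / s ^+ 2)).
  by apply: is_derive_eq; rewrite /GRing.scale/=; field; rewrite sn0.
have de : is_derive x 1 (expR \o q) (expR (q x) * - (x / s ^+ 2)).
  exact: is_derive1_comp.
by apply: is_derive_eq; rewrite /GRing.scale/= /q; ring.
Qed.

(** Half of the exponent absorbs the square, by [y * exp (- y) <= 1]; the other half is a Gaussian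
    weight of variance [2 * s ^+ 2], hence integrable. *)
Lemma sqr_normal_pdf_le (x : R) :
  x ^+ 2 * p x <= 4 * s ^+ 2 * normal_peak s * expR (- (4 * s ^+ 2)^-1 * x ^+ 2).
Proof.
rewrite normal_pdf0E; set y := (4 * s ^+ 2)^-1 * x ^+ 2.
have -> : - (2 * s ^+ 2)^-1 * x ^+ 2 = - y + - y by rewrite /y; field; rewrite sn0.
have -> : - (4 * s ^+ 2)^-1 * x ^+ 2 = - y by rewrite /y; ring.
have -> : x ^+ 2 = 4 * s ^+ 2 * y by rewrite /y; field; rewrite sn0.
have y0 : 0 <= y by rewrite /y mulr_ge0 ?sqr_ge0// invr_ge0 mulr_ge0// sqr_ge0.
have h : y * expR (- y) <= 1.
  rewrite expRN ler_pdivrMr ?expR_gt0// mul1r.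
  by apply: le_trans (expR_ge1Dx y); rewrite lerDr.
rewrite expRD (_ : 4 * s ^+ 2 * y * (normal_peak s * (expR (- y) * expR (- y))) =
  (4 * s ^+ 2 * normal_peak s * expR (- y)) * (y * expR (- y))); last by ring.
have c0 : 0 <= 4 * s ^+ 2 * normal_peak s.
  by apply: mulr_ge0; [apply: mulr_ge0 => //; exact: sqr_ge0|exact: normal_peak_ge0].
by rewrite ler_piMr// mulr_ge0// expR_ge0.
Qed.

Lemma integrable_normal_growth (h : R -> R) (A : R) : measurable_fun setT h ->
  (forall x, `|h x| <= A * (1 + x ^+ 2)) -> mu.-integrable setT (fun x => (h x * p x)%:E).
Proof.
move=> mh hA.
have A0 : 0 <= A by have := hA 0; rewrite expr0n/= addr0 mulr1; exact: le_trans.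
pose s' := Num.sqrt 2 * s.
have s'0 : s' != 0 by rewrite mulf_neq0// gt_eqF// sqrtr_gt0.
have p'E x : normal_pdf 0 s' x = normal_peak s' * expR (- (4 * s ^+ 2)^-1 * x ^+ 2).
  rewrite normal_pdfE// /normal_fun subr0; congr (_ * expR _).
  by rewrite /s' exprMn sqr_sqrtr// -mulr_natl; field; rewrite sn0.
have pk : 0 < normal_peak s' by exact: normal_peak_gt0.
pose C := 4 * s ^+ 2 * normal_peak s / normal_peak s'.
have ig : mu.-integrable setT (fun x => (A * (p x + C * normal_pdf 0 s' x))%:E).
  have i1 := @integrable_normal_pdf R 0 s.
  have i2 := @integrableZl _ _ _ mu setT measurableT C _ (@integrable_normal_pdf R 0 s').
  have := integrableZl measurableT A (integrableD measurableT i1 i2).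
  by apply: eq_integrable => // x _; rewrite /= -EFinM -EFinD -EFinM.
apply: le_integrable ig => //.
- apply/measurable_EFinP; apply: measurable_funM => //; exact: measurable_normal_pdf.
- move=> x _ /=; rewrite lee_fin normrM (ger0_norm (normal_pdf_ge0 _ _ _)).
  apply: le_trans (ler_norm _).
  apply: (@le_trans _ _ (A * (1 + x ^+ 2) * p x)); first by rewrite ler_wpM2r// normal_pdf_ge0.
  rewrite -mulrA ler_wpM2l// mulrDl mul1r lerD2l; apply: (le_trans (sqr_normal_pdf_le x)).
  rewrite p'E; set E := expR _.
  by rewrite (_ : C * (normal_peak s' * E) = 4 * s ^+ 2 * normal_peak s * E)// /C; field; rewrite gt_eqF.
Qed.

Lemma integrable_normal_bounded (h : R -> R) : measurable_fun setT h ->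
  (forall x, `|h x| <= 1) -> mu.-integrable setT (fun x => (h x * p x)%:E).
Proof.
move=> mh h1; apply: (integrable_normal_growth (A := 1)) => // x.
by rewrite mul1r (le_trans (h1 x))// lerDl sqr_ge0.
Qed.

Variable th : R.

Let mlin (u : R) : measurable_fun setT (fun x : R => u * x + th).
Proof. by apply: measurable_funD => //; apply: measurable_funM. Qed.

Let msin : measurable_fun setT (@sin R).
Proof. by apply: continuous_measurable_fun; exact: continuous_sin. Qed.

Let mcosu (u : R) : measurable_fun setT (fun x : R => cos (u * x + th)).
Proof. exact: (measurableT_comp (@measurable_cosT R)). Qed.

Let mxsinu (u : R) : measurable_fun setT (fun x : R => x * sin (u * x + th)).
Proof. by apply: measurable_funM => //; exact: (measurableT_comp msin). Qed.

Let abs_le_sqr (x : R) : `|x| <= 1 + x ^+ 2.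
Proof.
have : 0 <= (`|x| - 1) ^+ 2 by exact: sqr_ge0.
rewrite sqrrB1 -[x ^+ 2]real_normK ?num_real// => h.
have := normr_ge0 x; have := sqr_ge0 `|x|; lra.
Qed.

Let icos (u : R) : mu.-integrable setT (fun x : R => (cos (u * x + th) * p x)%:E).
Proof.
by apply: integrable_normal_bounded => // x; rewrite ler_norml cos_geN1 cos_le1.
Qed.

Let ixsin (u : R) : mu.-integrable setT (fun x : R => (x * sin (u * x + th) * p x)%:E).
Proof.
apply: (integrable_normal_growth (A := 1)) => // x; rewrite mul1r normrM.
apply: le_trans (abs_le_sqr x); rewrite ler_piMr// ler_norml sin_geN1 sin_le1//.
Qed.

(** With [normal_xsin] this solves a differential equation in [u]: the derivative is
    [- normal_xsin], and integration by parts turns [normal_xsin] into [s ^+ 2 * u * normal_cos]. *)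
Definition normal_cos (u : R) := \int[mu]_x (cos (u * x + th) * p x).
Definition normal_xsin (u : R) := \int[mu]_x (x * sin (u * x + th) * p x).

Lemma cosD_taylor1 (a b : R) : `|cos (a + b) - cos a + b * sin a| <= 2 * b ^+ 2.
Proof.
have := cosD_taylor2 a b ler01; rewrite mul1r => h.
have b2 := sqr_ge0 b.
have -> : cos (a + b) - cos a + b * sin a = cos a * (cos b - 1) - sin a * (sin b - b).
  by rewrite cosD; ring.
apply: (le_trans (ler_normB _ _)); rewrite !normrM.
have ca : `|cos a| <= 1 by rewrite ler_norml cos_geN1 cos_le1.
have sa : `|sin a| <= 1 by rewrite ler_norml sin_geN1 sin_le1.
have c1 : `|cos b - 1| <= b ^+ 2.
  by have := cos_ge_quad b; have := cos_le1 b => ? ?; rewrite ler0_norm; lra.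
have [s1 _] := sin_taylor1 b.
have : `|cos a| * `|cos b - 1| <= `|cos b - 1| by rewrite ler_piMl.
have : `|sin a| * `|sin b - b| <= `|sin b - b| by rewrite ler_piMl.
lra.
Qed.

(** Differentiation under the integral by an explicit bound: the remainder of the difference
    quotient is at most [2 * |h|] times the second moment [V]. *)
Lemma is_derive_normal_cos (u : R) : is_derive u 1 normal_cos (- normal_xsin u).
Proof.
pose V := \int[mu]_x (x ^+ 2 * p x).
have iV : mu.-integrable setT (fun x => (x ^+ 2 * p x)%:E).
  apply: (integrable_normal_growth (A := 1)); first exact: measurable_funX.
  by move=> x; rewrite mul1r ger0_norm ?sqr_ge0// lerDr.
have V0 : 0 <= V.
  by apply: Rintegral_ge0 => x _; rewrite mulr_ge0 ?sqr_ge0 ?normal_pdf_ge0.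
have bd (h : R) : `|normal_cos (h + u) - normal_cos u + h * normal_xsin u| <= 2 * h ^+ 2 * V.
  have -> : h * normal_xsin u = \int[mu]_x (h * (x * sin (u * x + th) * p x)).
    by rewrite /normal_xsin RintegralZl//; exact: ixsin.
  rewrite /normal_cos -RintegralB//; [|exact: icos|exact: icos].
  have i1 : mu.-integrable setT (fun x => (cos ((h + u) * x + th) * p x - cos (u * x + th) * p x)%:E).
    by have := integrableB measurableT (icos (h + u)) (icos u); apply: eq_integrable.
  have i2 : mu.-integrable setT (fun x => (h * (x * sin (u * x + th) * p x))%:E).
    by have := integrableZl measurableT h (ixsin u); apply: eq_integrable.
  rewrite -RintegralD//.
  have i3 : mu.-integrable setT (fun x => (cos ((h + u) * x + th) * p x - cos (u * x + th) * p x + h * (x * sin (u * x + th) * p x))%:E).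
    by have := integrableD measurableT i1 i2; apply: eq_integrable.
  apply: (le_trans (le_normr_Rintegral _ i3)) => //.
  rewrite /V -RintegralZl//; apply: le_Rintegral => //.
  - by have := integrable_abse i3; apply: eq_integrable.
  - by have := integrableZl measurableT (2 * h ^+ 2) iV; apply: eq_integrable.
  - move=> x _.
    have -> : cos ((h + u) * x + th) * p x - cos (u * x + th) * p x + h * (x * sin (u * x + th) * p x) =
      (cos (u * x + th + h * x) - cos (u * x + th) + (h * x) * sin (u * x + th)) * p x.
      by rewrite (_ : (h + u) * x + th = u * x + th + h * x); ring.
    rewrite normrM (ger0_norm (normal_pdf_ge0 _ _ _)).
    have -> : 2 * h ^+ 2 * (x ^+ 2 * p x) = 2 * (h * x) ^+ 2 * p x by ring.
    by rewrite ler_wpM2r ?normal_pdf_ge0// cosD_taylor1.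
have H : h^-1 *: (normal_cos (h *: 1 + u) - normal_cos u) @[h --> 0^'] --> - normal_xsin u.
  apply/cvgrPdist_le => e e0.
  near=> h.
  have h0 : h != 0 by near: h; exact: nbhs_dnbhs_neq.
  rewrite /GRing.scale/= mulr1.
  have -> : - normal_xsin u - h^-1 * (normal_cos (h + u) - normal_cos u) =
    - (h^-1 * (normal_cos (h + u) - normal_cos u + h * normal_xsin u)).
    by field.
  rewrite normrN normrM normfV ler_pdivrMl ?normr_gt0//.
  apply: (le_trans (bd h)).
  rewrite -[h ^+ 2]real_normK ?num_real// mulrAC expr2 mulrA [leRHS]mulrC ler_wpM2r//.
  have : `|h| <= e / (2 * V + 1).
    near: h; apply: dnbhs0_le; rewrite divr_gt0//; lra.
  rewrite ler_pdivlMr; last by lra.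
  by have := normr_ge0 h; nra.
by apply: DeriveDef; [exact: cvgP H|exact: cvg_lim H].
Unshelve. all: by end_near. Qed.

(** Gaussian integration by parts: the derivative of [sin (u * x + th) * p x] has integral zero,
    because the boundary terms vanish at infinity. *)
Lemma normal_xsinE (u : R) : normal_xsin u = s ^+ 2 * u * normal_cos u.
Proof.
pose F (x : R) := sin (u * x + th) * p x.
pose F' (x : R) := u * (cos (u * x + th) * p x) + - (s ^+ 2)^-1 * (x * sin (u * x + th) * p x).
have dF (x : R) : is_derive x 1 F (F' x).
  have d1 := is_derive_normal_pdf x.
  pose l (x : R) := u * x + th.
  have dl : is_derive x 1 l u by apply: is_derive_eq; rewrite /GRing.scale/=; ring.
  have ds : is_derive x 1 (sin \o l) (cos (l x) * u) by exact: is_derive1_comp.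
  rewrite (_ : F = (sin \o l) * p)//; apply: is_derive_eq.
  by rewrite /GRing.scale/= /F' /l/=; field; rewrite sn0.
have cF : continuous F.
  by move=> x; apply: differentiable_continuous; apply/derivable1_diffP; exact: ex_derive.
have i1 : mu.-integrable setT (fun x => (u * (cos (u * x + th) * p x))%:E).
  by have := integrableZl measurableT u (icos u); apply: eq_integrable.
have i2 : mu.-integrable setT (fun x => (- (s ^+ 2)^-1 * (x * sin (u * x + th) * p x))%:E).
  by have := integrableZl measurableT (- (s ^+ 2)^-1) (ixsin u); apply: eq_integrable.
have iF' : mu.-integrable setT (EFin \o F').
  by have := integrableD measurableT i1 i2; apply: eq_integrable.
have cF' : continuous F'.
  have cl x : u * z + th @[z --> x] --> u * x + th.
    apply: cvgD; last exact: cvg_cst.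
    by apply: cvgM; [exact: cvg_cst|exact: cvg_id].
  have ccos x : cos (u * z + th) @[z --> x] --> cos (u * x + th).
    by apply: (@continuous_comp _ _ _ (fun z : R => u * z + th) cos x); [exact: cl|exact: continuous_cos].
  have csin x : sin (u * z + th) @[z --> x] --> sin (u * x + th).
    by apply: (@continuous_comp _ _ _ (fun z : R => u * z + th) sin x); [exact: cl|exact: continuous_sin].
  have cp x : p z @[z --> x] --> p x by exact: continuous_normal_pdf.
  move=> x; apply: cvgD; apply: cvgM; try exact: cvg_cst.
    by apply: cvgM; [exact: ccos|exact: cp].
  apply: cvgM; last exact: cp.
  by apply: cvgM; [exact: cvg_id|exact: csin].
suff F'0 : \int[mu]_x F' x = 0.
  move: F'0; rewrite RintegralD// RintegralZl//; last exact: icos.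
  rewrite RintegralZl//; last exact: ixsin.
  rewrite -/(normal_cos u) -/(normal_xsin u) => h.
  have : s ^+ 2 * (u * normal_cos u + - (s ^+ 2)^-1 * normal_xsin u) = 0 by rewrite h mulr0.
  have -> : s ^+ 2 * (u * normal_cos u + - (s ^+ 2)^-1 * normal_xsin u) =
    s ^+ 2 * u * normal_cos u - normal_xsin u by field; rewrite sn0.
  by move/eqP; rewrite subr_eq0 => /eqP.
have FTC n : (\int[mu]_(x in `[(- n.+1%:R)%R, n.+1%:R]) (F' x)%:E = (F n.+1%:R - F (- n.+1%:R))%R%:E)%E.
  rewrite EFinB; apply: continuous_FTC2 => //.
  - by rewrite (@lt_trans _ _ 0)// oppr_lt0.
  - exact: continuous_subspaceT.
  - split.
    + by move=> x _; exact: ex_derive.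
    + by apply: cvg_at_right_filter; exact: cF.
    + by apply: cvg_at_left_filter; exact: cF.
  - by move=> x _; rewrite derive1E; exact: derive_val.
have c1 : (\int[mu]_(x in `[(- n.+1%:R)%R, n.+1%:R]) (F' x)%:E @[n --> \oo] --> \int[mu]_x (F' x)%:E)%E.
  under eq_fun do rewrite integral_mkcond.
  apply: (@dominated_cvg _ _ _ mu setT measurableT _ _ (fun x => `|(F' x)%:E|%E)) => //.
  - move=> n; apply/measurable_restrict => //; rewrite ?setTI; apply: measurable_funTS.
    exact: measurable_int iF'.
  - move=> x _; apply: cvg_near_cst; near=> n.
    rewrite /= patchE mem_set//= in_itv/= -ler_norml.
    near: n; have := nbhs_infty_ger `|x|; case=> N _ hN; exists N => // k /= kN.
    apply: hN; rewrite /=; exact: leq_trans kN _.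
  - exact: integrable_abse.
  - by move=> n x _; rewrite patchE; case: ifP; rewrite ?abse0.
have pk0 : 0 <= normal_peak s by exact: normal_peak_ge0.
(* For [|x| >= 1], [|F x| <= p x <= x ^+ 2 * p x / |x|] with [x ^+ 2 * p x] bounded, so the boundary
   terms are of order [1 / n]. *)
have Fbd n : `|F n.+1%:R - F (- n.+1%:R)| <= 8 * s ^+ 2 * normal_peak s * n.+1%:R^-1.
  have b1 (x : R) : 1 <= `|x| -> `|F x| <= 4 * s ^+ 2 * normal_peak s * `|x|^-1.
    move=> x1; rewrite normrM (ger0_norm (normal_pdf_ge0 _ _ _)).
    apply: (@le_trans _ _ (p x)); first by rewrite ler_piMl ?normal_pdf_ge0// ler_norml sin_geN1 sin_le1.
    have x0 : 0 < `|x| by exact: lt_le_trans x1.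
    rewrite ler_pdivlMr// mulrC.
    apply: (@le_trans _ _ (x ^+ 2 * p x)).
      by rewrite ler_wpM2r ?normal_pdf_ge0// -[x ^+ 2]real_normK ?num_real// expr2 ler_peMl.
    have c0 : 0 <= 4 * s ^+ 2 * normal_peak s by rewrite !mulr_ge0// ltW.
    apply: (le_trans (sqr_normal_pdf_le x)); rewrite ler_piMr//.
    rewrite -expR0 ler_expR mulNr oppr_le0 mulr_ge0 ?sqr_ge0// invr_ge0 mulr_ge0// sqr_ge0//.
  have n1 : `|n.+1%:R : R| = n.+1%:R by rewrite ger0_norm.
  have h1 := b1 n.+1%:R; have h2 := b1 (- n.+1%:R).
  rewrite normrN n1 in h2; rewrite n1 in h1.
  have n1' : 1 <= n.+1%:R :> R by rewrite ler1n.
  apply: (le_trans (ler_normB _ _)).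
  have -> : 8 * s ^+ 2 * normal_peak s * n.+1%:R^-1 =
    4 * s ^+ 2 * normal_peak s / n.+1%:R + 4 * s ^+ 2 * normal_peak s / n.+1%:R by ring.
  exact: lerD (h1 n1') (h2 n1').
have c2 : (F n.+1%:R - F (- n.+1%:R))%:E @[n --> \oo] --> (0 : R)%:E.
  apply: cvg_EFin; first by near=> n.
  have cz : 8 * s ^+ 2 * normal_peak s * n.+1%:R^-1 @[n --> \oo] --> (0 : R).
    rewrite -[X in _ --> X](mulr0 (8 * s ^+ 2 * normal_peak s)).
    by apply: cvgM; [exact: cvg_cst|exact: cvg_harmonic].
  apply/cvgrPdist_le => e e0; move/cvgrPdist_le : cz => /(_ e e0) [N _ hN].
  exists N => // n nN; rewrite sub0r normrN /=; apply: (le_trans (Fbd n)).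
  by have := hN n nN; rewrite sub0r normrN; exact: le_trans (ler_norm _).
rewrite /Rintegral.
have -> : (\int[mu]_x (F' x)%:E)%E = 0%:E; last by [].
move: c1; under eq_fun do rewrite FTC.
by move=> c1; exact: (cvg_unique _ c1 c2).
Unshelve. all: by end_near. Qed.

(** The product with [exp (s ^+ 2 * u ^+ 2 / 2)] has zero derivative in [u], hence equals its value
    [cos th] at 0. *)
Lemma normal_cosE (u : R) : normal_cos u = expR (- (s ^+ 2 * u ^+ 2 / 2)) * cos th.
Proof.
pose q (u : R) := s ^+ 2 * u ^+ 2 / 2.
pose G (u : R) := normal_cos u * expR (q u).
have dG (v : R) : is_derive v 1 G 0.
  have dh := is_derive_normal_cos v.
  have dq : is_derive v 1 q (s ^+ 2 * v).
    by apply: is_derive_eq; rewrite /GRing.scale/=; field.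
  have de : is_derive v 1 (expR \o q) (expR (q v) * (s ^+ 2 * v)) by exact: is_derive1_comp.
  rewrite (_ : G = normal_cos * (expR \o q))//; apply: is_derive_eq.
  by rewrite /GRing.scale/= normal_xsinE; ring.
have := is_derive_0_is_cst u 0 dG.
rewrite /G {2}/normal_cos {2}/q expr0n/= mulr0 mul0r expR0 mulr1.
under eq_Rintegral do rewrite mul0r add0r.
rewrite RintegralZl//; last exact: integrable_normal_pdf.
rewrite /Rintegral integral_normal_pdf/= mulr1 => h.
by rewrite expRN -/(q u) -h mulrC mulfK// gt_eqF// expR_gt0.
Qed.

Lemma normal_prob_cos (u : R) :
  \int[normal_prob 0 s]_x cos (u * x + th) = expR (- (s ^+ 2 * u ^+ 2 / 2)) * cos th.
Proof.
rewrite (@Rintegral_density R _ _ mu p _ _ (normal_prob 0 s))//.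
- exact: normal_cosE.
- exact: measurable_normal_pdf.
- by move=> x; exact: normal_pdf_ge0.
- exact: mcosu.
Qed.

End NormalCharacteristic.

Section NormalLaw.
Context {R : realType} {d} {T : measurableType d} (P : probability T R).

Lemma centered_normal_law_cos (W : T -> R) (v : R) : measurable_fun setT W -> 0 <= v ->
  (forall a th, \int[P]_w cos (a * W w + th) = expR (- (a ^+ 2 * v / 2)) * cos th) ->
  centered_normal_law P W v.
Proof.
move=> mW v0 hcos; split => //.
have [v_eq0|vneq0] := eqVneq v 0; [right|left]; split => //.
(* A vanishing variance: [W] is compared with the constant 0 on an arbitrarily chosen probability
   space. *)
- have := @eq_law_cos R _ _ T (measurableTypeR R) P (normal_prob 0 1) W (cst 0) mW (@measurable_cst _ _ _ _ _ _).
  move=> /(_ _ [set 0])->.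
  + by rewrite (_ : cst 0 @^-1` [set 0] = setT) ?probability_setT//; apply/seteqP; split.
  + move=> a th; rewrite hcos v_eq0 mulr0 mul0r oppr0 expR0 mul1r.
    by under eq_Rintegral do rewrite /= mulr0 add0r; rewrite Rintegral_prob_cst.
  + exact: measurable_set1.
- by rewrite lt_neqAle eq_sym vneq0.
- have s0 : 0 < Num.sqrt v by rewrite sqrtr_gt0 lt_neqAle eq_sym vneq0.
  move=> B mB; rewrite (@eq_law_cos R _ _ T (measurableTypeR R) P (normal_prob 0 (Num.sqrt v)) W id mW (@measurable_id _ _ _))//.
  move=> a th; rewrite hcos normal_prob_cos// sqr_sqrtr//; congr (expR _ * _).
  by ring.
Qed.

End NormalLaw.

(** * Gaussian vectors with a prescribed covariance *)

Section GaussianVector.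
Variable R : realType.
Implicit Types (n : nat) (S : nat -> nat -> R) (u : nat -> R).

Definition quad n S u := \sum_(i < n) \sum_(j < n) u i * S i j * u j.

Lemma eq_quad n S u u' : (forall i, (i < n)%N -> u i = u' i) -> quad n S u = quad n S u'.
Proof.
by move=> h; apply: eq_bigr => i _; apply: eq_bigr => j _; rewrite !h.
Qed.

Lemma quad_recr n S u : (forall i j, S i j = S j i) ->
  quad n.+1 S u = quad n S u + 2 * u n * (\sum_(i < n) S i n * u i) + S n n * u n ^+ 2.
Proof.
move=> symS; rewrite /quad big_ord_recr/= big_ord_recr/=.
under eq_bigr do rewrite big_ord_recr/=.
rewrite big_split/= -!addrA; congr (_ + _).
have -> : \sum_(i < n) u i * S i n * u n = u n * \sum_(i < n) S i n * u i.
  by rewrite mulr_sumr; apply: eq_bigr => i _; ring.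
have -> : \sum_(i < n) u n * S n i * u i = u n * \sum_(i < n) S i n * u i.
  by rewrite mulr_sumr; apply: eq_bigr => i _; rewrite (symS n); ring.
by ring.
Qed.

(** Induction on the dimension by Schur complement. Let [xi] be standard normal and independent of a
    family with covariance [S i j - S i n * S j n / S n n]; the last variable is [r * xi] with
    [r ^+ 2 = S n n], and [S i n / r * xi] is added to the others. *)
Lemma gaussian_family_exists n S : (forall i j, S i j = S j i) -> (forall u, 0 <= quad n S u) ->
  exists (d : measure_display) (T : measurableType d) (P : probability T R) (Z : nat -> T -> R),
    (forall i, measurable_fun setT (Z i)) /\
    forall u th, \int[P]_w cos (\sum_(i < n) u i * Z i w + th) = expR (- (quad n S u / 2)) * cos th.
Proof.
elim: n S => [|n IH] S symS psdS.
  exists _, _, (normal_prob (0:R) 1), (fun _ => cst 0); split => // u th.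
  rewrite /quad big_ord0 mul0r oppr0 expR0 mul1r.
  by under eq_Rintegral do rewrite big_ord0 add0r; rewrite Rintegral_prob_cst.
pose b u := \sum_(i < n) S i n * u i.
pose upd u (c : R) : nat -> R := fun i => if i == n then c else u i.
have bupd u c : b (upd u c) = b u.
  by apply: eq_bigr => i _; rewrite /upd ltn_eqF.
have qupd u c : quad n.+1 S (upd u c) = quad n S u + 2 * c * b u + S n n * c ^+ 2.
  rewrite quad_recr// -/(b _) bupd {2 3}/upd eqxx; congr (_ + _ + _).
  by apply: eq_quad => i i_n; rewrite /upd ltn_eqF.
have s_ge0 : 0 <= S n n.
  have := psdS (upd (fun=> 0) 1); rewrite qupd expr1n mulr1.
  have -> : quad n S (fun=> 0) = 0.
    by rewrite /quad big1// => i _; rewrite big1// => j _; rewrite mulr0.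
  have -> : b (fun=> 0) = 0 by rewrite /b big1// => i _; rewrite mulr0.
  by rewrite mulr0 mulr1 !add0r.
have [s_eq0|sneq0] := eqVneq (S n n) 0.
  (* A zero last diagonal entry forces a zero last column: otherwise the form is affine and not
     constant in the last coordinate, and the value tested here makes it [-1]. *)
  have b0 u : b u = 0.
    apply/eqP; apply: contraT => bn0.
    have := psdS (upd u (- (quad n S u + 1) / (2 * b u))).
    rewrite qupd s_eq0 mul0r addr0.
    have -> : 2 * (- (quad n S u + 1) / (2 * b u)) * b u = - (quad n S u + 1) by field.
    lra.
  have qS u : quad n.+1 S u = quad n S u.
    by rewrite quad_recr// -/(b u) b0 s_eq0 mulr0 mul0r !addr0.
  have [|d [T [P [Z [mZ hZ]]]]] := IH S symS; first by move=> u; rewrite -qS.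
  exists d, T, P, (fun i => if i == n then cst 0 else Z i); split.
    by move=> i; case: ifP.
  move=> u th; rewrite qS -hZ; apply: eq_Rintegral => w _; congr (cos (_ + _)).
  rewrite big_ord_recr/= eqxx mulr0 addr0; apply: eq_bigr => i _.
  by rewrite ltn_eqF.
have s0 : 0 < S n n by rewrite lt_neqAle eq_sym sneq0.
pose S' i j := S i j - S i n * S j n / S n n.
have qS' u : quad n S' u = quad n S u - b u ^+ 2 / S n n.
  rewrite /quad /b expr2 big_distrlr/= mulr_suml -sumrB; apply: eq_bigr => i _.
  rewrite mulr_suml -sumrB; apply: eq_bigr => j _.
  by rewrite /S'; field.
have [||d [T [P [Z [mZ hZ]]]]] := IH S'.
- by move=> i j; rewrite /S' symS (mulrC (S i n)).
(* The tested value minimises the form over the last coordinate; the minimum is the form of the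
   Schur complement. *)
- move=> u; rewrite qS'; have := psdS (upd u (- b u / S n n)); rewrite qupd.
  by rewrite (_ : _ + _ + _ = quad n S u - b u ^+ 2 / S n n)//; field.
pose r := Num.sqrt (S n n).
have r0 : 0 < r by rewrite sqrtr_gt0.
have r2 : r ^+ 2 = S n n by rewrite sqr_sqrtr// ltW.
pose Z' (i : nat) (z : T * measurableTypeR R) : R := if i == n then r * z.2 else Z i z.1 + S i n / r * z.2.
exists _, _, (P \x normal_prob (0:R) 1)%E, Z'.
have mZ' i : measurable_fun setT (Z' i).
  rewrite /Z'; case: (i == n); first by apply: measurable_funM.
  apply: measurable_funD; first exact: measurableT_comp.
  by apply: measurable_funM.
split => // u th.
(* Coefficient of the new normal variable; its square completes the form of [S'] to that of [S]. *)
pose c := b u / r + u n * r.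
have ZE z : \sum_(i < n.+1) u i * Z' i z + th = c * z.2 + (\sum_(i < n) u i * Z i z.1 + th).
  rewrite big_ord_recr/= {2}/Z' eqxx.
  have -> : \sum_(i < n) u i * Z' i z = \sum_(i < n) u i * Z i z.1 + b u / r * z.2.
    rewrite /b !mulr_suml -big_split/=; apply: eq_bigr => i _.
    by rewrite /Z' ltn_eqF//; ring.
  by rewrite /c; ring.
have mF : measurable_fun setT (fun z : T * measurableTypeR R => cos (c * z.2 + (\sum_(i < n) u i * Z i z.1 + th))).
  apply: (measurableT_comp (@measurable_cosT R)); apply: measurable_funD.
    by apply: measurable_funM.
  apply: measurable_funD => //; apply: measurable_sum => i.
  by apply: measurable_funM => //; exact: measurableT_comp.
have cos1 (x : R) : `|cos x| <= 1 by rewrite ler_norml cos_geN1 cos_le1.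
under eq_Rintegral do rewrite ZE.
have iF := bounded_integrable (P \x normal_prob (0:R) 1)%E mF (fun z => cos1 _).
rewrite /Rintegral -integral12_prod_meas1// /fubini_F/=.
have mG : measurable_fun setT (fun w => cos (\sum_(i < n) u i * Z i w + th)).
  apply: (measurableT_comp (@measurable_cosT R)); apply: measurable_funD => //.
  by apply: measurable_sum => i; apply: measurable_funM.
transitivity (\int[P]_w (expR (- (c ^+ 2 / 2)) * cos (\sum_(i < n) u i * Z i w + th))).
  congr (fine _); apply: eq_integral => w _.
  rewrite (@integral_EFin_bounded _ _ _ (normal_prob (0:R) 1) _ 1)//.
    by rewrite normal_prob_cos// expr1n mul1r.
  by apply: (measurableT_comp (@measurable_cosT R)); apply: measurable_funD.
rewrite RintegralZl//; last exact: (bounded_integrable P mG (fun z => cos1 _)).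
rewrite hZ mulrA -expRD; congr (expR _ * _).
rewrite quad_recr// -/(b u) qS' -r2 /c.
by field; rewrite gt_eqF.
Qed.

Lemma gaussian_vector_exists m (S : 'M[R]_m.+1) : (forall i j, S i j = S j i) ->
  (forall u : 'rV[R]_m.+1, 0 <= \sum_i \sum_j u 0 i * S i j * u 0 j) ->
  exists (d : measure_display) (T : measurableType d) (P : probability T R) (Z : T -> 'rV[R]_m.+1),
  [/\ (forall i, measurable_fun setT (fun w => Z w 0 i)), gaussian_vector P Z S &
    forall (u : 'rV[R]_m.+1) th, \int[P]_w cos (dot u (Z w) + th) =
      expR (- ((\sum_i \sum_j u 0 i * S i j * u 0 j) / 2)) * cos th].
Proof.
move=> symS psdS.
pose S' (i j : nat) := S (inord i) (inord j).
have qE (u : 'rV[R]_m.+1) : quad m.+1 S' (fun i => u 0 (inord i)) = \sum_i \sum_j u 0 i * S i j * u 0 j.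
  by apply: eq_bigr => i _; apply: eq_bigr => j _; rewrite /S' !inord_val.
have [||d [T [P [Z [mZ hZ]]]]] := @gaussian_family_exists m.+1 S'.
- by move=> i j; exact: symS.
- move=> u; have := psdS (\row_i u i); rewrite -qE.
  by rewrite (@eq_quad m.+1 S' _ u)// => i im; rewrite mxE inordK.
pose ZZ (w : T) : 'rV[R]_m.+1 := \row_(i < m.+1) Z i w.
have dE (u : 'rV[R]_m.+1) w : dot u (ZZ w) = \sum_(i < m.+1) u 0 (inord i) * Z i w.
  by apply: eq_bigr => i _; rewrite mxE inord_val.
have mZZ i : measurable_fun setT (fun w => ZZ w 0 i).
  by under eq_fun do rewrite mxE; exact: mZ.
have hcos (u : 'rV[R]_m.+1) th : \int[P]_w cos (dot u (ZZ w) + th) =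
      expR (- ((\sum_i \sum_j u 0 i * S i j * u 0 j) / 2)) * cos th.
  by rewrite -qE -hZ; apply: eq_Rintegral => w _; rewrite dE.
exists d, T, P, ZZ; split => // u.
apply: centered_normal_law_cos => //; first exact: measurable_dot.
move=> a th; under eq_Rintegral do rewrite -/(dot u _) -dotZl.
rewrite hcos; congr (expR (- (_ / 2)) * _).
rewrite mulr_sumr; apply: eq_bigr => i _; rewrite mulr_sumr; apply: eq_bigr => j _.
by rewrite !mxE; ring.
Qed.

End GaussianVector.

(** * The filter and its asymptotic variance *)

Section Normalization.
Context {R : realType} {d} {T : measurableType d} (mu : {measure set T -> \bar R}).

(** A product with zero integral would vanish almost everywhere, and [f] with it since [h > 0]. This
    keeps the normalising constants positive. *)
Lemma integral_gt0_mul (f h : T -> R) : measurable_fun setT f -> measurable_fun setT h ->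
  (forall x, 0 <= f x) -> (forall x, 0 < h x) -> (\int[mu]_x (f x)%:E != 0)%E ->
  (0 < \int[mu]_x (f x * h x)%:E)%E.
Proof.
move=> mf mh f0 h0 nf; rewrite lt0e; apply/andP; split; last first.
  by apply: integral_ge0 => x _; rewrite lee_fin mulr_ge0// ltW.
apply: contra nf => /eqP fh0.
have mfh : measurable_fun setT (fun x => (f x * h x)%:E).
  by apply/measurable_EFinP; exact: measurable_funM.
have /(ae_eq_integral_abs mu measurableT mfh) aefh : (\int[mu]_x `|(f x * h x)%:E| = 0)%E.
  rewrite -fh0; apply: eq_integral => x _.
  by rewrite gee0_abs// lee_fin mulr_ge0// ltW.
have -> : (\int[mu]_x (f x)%:E = \int[mu]_x `|(f x)%:E|)%E.
  by apply: eq_integral => x _; rewrite gee0_abs// lee_fin.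
apply/eqP/(ae_eq_integral_abs mu measurableT); first exact/measurable_EFinP.
apply: filterS aefh => x /(_ I) /eqP/=; rewrite eqe mulf_eq0 => /orP[/eqP->//|].
by rewrite gt_eqF.
Qed.

Lemma normalized_density (u : T -> R) : measurable_fun setT u -> (forall x, 0 <= u x) ->
  (0 < \int[mu]_x (u x)%:E)%E -> (\int[mu]_x (u x)%:E < +oo)%E ->
  [/\ 0 < Rint mu u, measurable_fun setT (fun x => u x / Rint mu u),
   forall x, 0 <= u x / Rint mu u & (\int[mu]_x (u x / Rint mu u)%:E = 1)%E].
Proof.
move=> mu_ u0 Iu0 Iuy.
have fI : (\int[mu]_x (u x)%:E)%E \is a fin_num by rewrite ge0_fin_numE// ltW.
have R0 : 0 < Rint mu u by rewrite /Rint -lte_fin fineK.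
split => //.
- exact: measurable_funM.
- by move=> x; rewrite divr_ge0// ltW.
under eq_integral do rewrite EFinM.
rewrite ge0_integralZr ?lee_fin ?invr_ge0 ?ltW//; last 2 first.
- exact/measurable_EFinP.
- by move=> x _; rewrite lee_fin.
by rewrite -(fineK fI) -EFinM mulfV// gt_eqF.
Qed.

End Normalization.

(** The data of the theorem with the observations inserted into the likelihoods. Indexing by [t.+1]
    removes the side condition [0 < t], and sigma-finiteness is bundled for Tonelli's theorem. *)
Record fmodel (R : realType) (dE : measure_display) (E : measurableType dE) := FModel {
  fm_mu : {sigma_finite_measure set E -> \bar R};
  fm_a0 : E -> R;
  fm_a : nat -> E -> E -> R;
  fm_g : nat -> E -> R;
  fm_C : nat -> R;
  fm_a0m : measurable_fun setT fm_a0;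
  fm_a0p : forall x, 0 <= fm_a0 x;
  fm_a01 : (\int[fm_mu]_x (fm_a0 x)%:E = 1)%E;
  fm_am : forall t, measurable_fun setT (fun p : E * E => fm_a t.+1 p.1 p.2);
  fm_ap : forall t x z, 0 <= fm_a t.+1 x z;
  fm_a1 : forall t x, (\int[fm_mu]_z (fm_a t.+1 x z)%:E = 1)%E;
  fm_gm : forall t, measurable_fun setT (fm_g t.+1);
  fm_g0 : forall t x, 0 < fm_g t.+1 x;
  fm_gC : forall t x, fm_g t.+1 x <= fm_C t.+1 }.

(** * Filter densities and transition kernels *)

Section Model.
Context {R : realType} {dE} {E : measurableType dE} (M : fmodel R E).
Local Notation mu := (fm_mu M).
Local Notation a0 := (fm_a0 M).
Local Notation a := (fm_a M).
Local Notation g := (fm_g M).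
Local Notation C := (fm_C M).
Let ha0m : measurable_fun setT a0 := fm_a0m M.
Let ha0p : forall x, 0 <= a0 x := fm_a0p M.
Let ha01 : (\int[mu]_x (a0 x)%:E = 1)%E := fm_a01 M.
Let ham : forall t, measurable_fun setT (fun p : E * E => a t.+1 p.1 p.2) := fm_am M.
Let hap : forall t x z, 0 <= a t.+1 x z := fm_ap M.
Let ha1 : forall t x, (\int[mu]_z (a t.+1 x z)%:E = 1)%E := fm_a1 M.
Let hgm : forall t, measurable_fun setT (g t.+1) := fm_gm M.
Let hg0 : forall t x, 0 < g t.+1 x := fm_g0 M.
Let hgC : forall t x, g t.+1 x <= C t.+1 := fm_gC M.

Local Notation filt := (filt mu a0 a g).
Local Notation pY := (pY mu a0 a g).
Local Notation Lop := (Lop mu a g).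

Lemma a_measurable2 t x : measurable_fun setT (a t.+1 x).
Proof. exact: (measurable_fun_pair2 x (ham t)). Qed.

Lemma a_measurable1 t z : measurable_fun setT (a t.+1 ^~ z).
Proof. exact: (measurable_fun_pair1 z (ham t)). Qed.

(** Predictive density with extended values: it may be infinite on a null set, where the [fine]
    inside [filt] returns 0. By [pred_spec] the two versions agree almost everywhere. *)
Definition pred_ext (t : nat) (x : E) : \bar R := (\int[mu]_x' (filt t x' * a t.+1 x' x)%:E)%E.

Definition uf (t : nat) (x : E) : R := g t.+1 x * Rint mu (fun x' => filt t x' * a t.+1 x' x).

Let density_spec (f : E -> R) := [/\ measurable_fun setT f, (forall x, 0 <= f x) &
  (\int[mu]_x (f x)%:E = 1)%E].

Lemma pred_spec t : density_spec (filt t) ->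
  [/\ measurable_fun setT (pred_ext t), (\int[mu]_x pred_ext t x = 1)%E &
   ae_eq mu setT (pred_ext t) (EFin \o (fun x => fine (pred_ext t x)))].
Proof.
move=> [mf f0 f1].
pose h (z : E * E) := (filt t z.1 * a t.+1 z.1 z.2)%:E.
have mh : measurable_fun setT h.
  by apply/measurable_EFinP; apply: measurable_funM => //; exact: measurableT_comp.
have h0 z : (0 <= h z)%E by rewrite lee_fin mulr_ge0.
have mp : measurable_fun setT (pred_ext t) by exact: (@measurable_fun_fubini_tonelli_G _ _ _ _ _ mu _ mh h0).
have p0 x : (0 <= pred_ext t x)%E by apply: integral_ge0 => z _; exact: (h0 (z, x)).
have p1 : (\int[mu]_x pred_ext t x = 1)%E.
  rewrite -(@fubini_tonelli _ _ _ _ _ mu mu _ mh h0) -f1; apply: eq_integral => x _; rewrite /h/=.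
  under eq_integral do rewrite EFinM.
  rewrite ge0_integralZl ?lee_fin// ?ha1 ?mule1//.
  - by apply/measurable_EFinP; exact: a_measurable2.
  - by move=> z _; rewrite lee_fin.
split => //.
have ip : mu.-integrable setT (pred_ext t).
  apply/integrableP; split => //; under eq_integral do rewrite gee0_abs//.
  by rewrite p1 ltry.
by apply: filterS (integrable_ae measurableT ip) => x /= h' xT; rewrite fineK// h'.
Qed.

Lemma uf_spec t : density_spec (filt t) ->
  [/\ measurable_fun setT (uf t), (forall x, 0 <= uf t x),
   (0 < \int[mu]_x (uf t x)%:E)%E & (\int[mu]_x (uf t x)%:E < +oo)%E].
Proof.
move=> hf; have [mp p1 aep] := pred_spec hf; have [mf f0 f1] := hf.
have mfp : measurable_fun setT (fun x => fine (pred_ext t x)).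
  by apply: measurableT_comp => //; exact: fine_measurable.
have fp0 x : 0 <= fine (pred_ext t x).
  by apply: fine_ge0; apply: integral_ge0 => z _; rewrite lee_fin mulr_ge0.
have fp1 : (\int[mu]_x (fine (pred_ext t x))%:E = 1)%E.
  rewrite -p1; apply/esym/ae_eq_integral => //; exact/measurable_EFinP.
have mu_ : measurable_fun setT (uf t) by exact: measurable_funM.
have u0 x : 0 <= uf t x by apply: mulr_ge0; [exact: ltW|exact: fp0].
split => //.
  under eq_integral do rewrite /uf mulrC.
  by apply: integral_gt0_mul => //; rewrite [X in X != _]fp1 onee_eq0.
apply: (@le_lt_trans _ _ (\int[mu]_x ((C t.+1)%:E * (fine (pred_ext t x))%:E))%E).
  apply: ge0_le_integral => //.
  - by move=> x _; rewrite lee_fin.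
  - exact/measurable_EFinP.
  - by apply: emeasurable_funM => //; exact/measurable_EFinP.
  - by move=> x _; rewrite -EFinM lee_fin; exact: (ler_wpM2r (fp0 x) (hgC t x)).
rewrite ge0_integralZl ?fp1 ?mule1 ?ltry//.
- exact/measurable_EFinP.
- by move=> x _; rewrite lee_fin.
- by rewrite lee_fin; apply: le_trans (hgC t point); rewrite ltW.
Qed.

Lemma filt_spec t : density_spec (filt t).
Proof.
elim: t => [|t IH]; first by split.
have [mu_ u0 Iu0 Iuy] := uf_spec IH.
by have [_ ? ? ?] := normalized_density mu_ u0 Iu0 Iuy.
Qed.

Lemma filt_measurable t : measurable_fun setT (filt t). Proof. by case: (filt_spec t). Qed.
Lemma filt_ge0 t x : 0 <= filt t x. Proof. by case: (filt_spec t). Qed.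
Lemma filt_int1 t : (\int[mu]_x (filt t x)%:E = 1)%E. Proof. by case: (filt_spec t). Qed.

Lemma pY_gt0 t : 0 < pY t.+1.
Proof.
have [mu_ u0 Iu0 Iuy] := uf_spec (filt_spec t).
by have [? _ _ _] := normalized_density mu_ u0 Iu0 Iuy.
Qed.

Lemma uf_pY t x : uf t x = pY t.+1 * filt t.+1 x.
Proof. by rewrite /= mulrCA mulfV ?mulr1// gt_eqF// (pY_gt0 t). Qed.

(* Sealing keeps unification from unfolding the recursively defined densities. *)
Fact piM_sig : {p : nat -> probability E R | forall t A, p t A = density mu (filt t) A}.
Proof. by exists (fun t => densP (filt_measurable t) (@filt_ge0 t) (filt_int1 t)). Qed.

Definition piM := sval piM_sig.

Lemma piME t A : piM t A = density mu (filt t) A.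
Proof. exact: (svalP piM_sig). Qed.

Let kapden t x (x' : E) := a t.+1 x x' * g t.+1 x'.

Let kapden_m t x : measurable_fun setT (kapden t x).
Proof. by apply: measurable_funM => //; exact: a_measurable2. Qed.

Let kapden_ge0 t x x' : 0 <= kapden t x x'.
Proof. by rewrite mulr_ge0// ltW. Qed.

(** The unnormalised kernel [a * g], introduced because [Lop] is integration against it; its mass is
    positive and at most [C t.+1]. *)
Fact kap_sig : {p : nat -> E -> {measure set E -> \bar R} |
  forall t x A, p t x A = density mu (kapden t x) A}.
Proof. by exists (fun t x => densM mu (@kapden_m t x) (@kapden_ge0 t x)). Qed.

Definition kap := sval kap_sig.

Lemma kapE t x A : kap t x A = density mu (kapden t x) A.
Proof. exact: (svalP kap_sig). Qed.

Lemma ge0_integral_piM t (h : E -> \bar R) : measurable_fun setT h -> (forall x, 0 <= h x)%E ->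
  (\int[piM t]_x h x = \int[mu]_x (h x * (filt t x)%:E))%E.
Proof.
move=> mh h0; apply: ge0_integral_density => //; [exact: filt_measurable|exact: filt_ge0|].
by move=> A _; exact: piME.
Qed.

Lemma mf_piM t (psi : E -> R) : measurable_fun setT psi ->
  mf mu a0 a g t psi = \int[piM t]_x psi x.
Proof.
by move=> mpsi; rewrite (@Rintegral_density _ _ _ mu (filt t) _ _ (piM t))//;
  [exact: filt_measurable|exact: filt_ge0|move=> A _; exact: piME].
Qed.

Lemma sigma2_piM t (psi : E -> R) : measurable_fun setT psi ->
  sigma2 mu a0 a g t psi = (\int[piM t]_x ((psi x - mf mu a0 a g t psi) ^+ 2)%:E)%E.
Proof.
move=> mpsi; rewrite (@integral_density _ _ _ mu (filt t) _ _ (piM t))//.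
- exact: filt_measurable.
- exact: filt_ge0.
- by move=> A _; exact: piME.
- by apply: measurable_funX; exact: measurable_funB.
Qed.

Lemma ge0_integral_kap t x (h : E -> \bar R) : measurable_fun setT h -> (forall x, 0 <= h x)%E ->
  (\int[kap t x]_x' h x' = \int[mu]_x' (h x' * (a t.+1 x x' * g t.+1 x')%:E))%E.
Proof.
move=> mh h0.
exact: (@ge0_integral_density _ _ _ mu (kapden t x) (kapden_m t x) (kapden_ge0 t x) (kap t x) (fun A _ => kapE t x A)).
Qed.

Lemma Lop_kap t (psi : E -> R) x : measurable_fun setT psi ->
  Lop t.+1 psi x = \int[kap t x]_x' psi x'.
Proof.
move=> mpsi; rewrite (@Rintegral_density _ _ _ mu (kapden t x) _ _ (kap t x))//; last by move=> A _; exact: kapE.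
by apply: eq_Rintegral => z _; rewrite mulrC.
Qed.

Lemma kap_gt0 t x : (0 < kap t x setT)%E.
Proof.
rewrite kapE /density; apply: integral_gt0_mul => //; first exact: a_measurable2.
by rewrite ha1 onee_eq0.
Qed.

Lemma C_gt0 t : 0 < C t.+1.
Proof. exact: lt_le_trans (hg0 t point) (hgC _ _). Qed.

Lemma kap_le t x : (kap t x setT <= (C t.+1)%:E)%E.
Proof.
rewrite kapE /density.
apply: (@le_trans _ _ (\int[mu]_x' ((a t.+1 x x')%:E * (C t.+1)%:E))%E).
  apply: ge0_le_integral => //.
  - by move=> z _; rewrite lee_fin.
  - exact/measurable_EFinP.
  - by apply: emeasurable_funM => //; apply/measurable_EFinP; exact: a_measurable2.
  - by move=> z _; rewrite -EFinM lee_fin ler_wpM2l.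
rewrite ge0_integralZr ?ha1 ?mul1e//.
- by apply/measurable_EFinP; exact: a_measurable2.
- by move=> z _; rewrite lee_fin.
- by rewrite lee_fin ltW// C_gt0.
Qed.

Let jointh t (h : E -> \bar R) (z : E * E) := (h z.2 * (a t.+1 z.1 z.2 * g t.+1 z.2)%:E)%E.

Let jointh_m t h : measurable_fun setT h -> measurable_fun setT (jointh t h).
Proof.
move=> mh; apply: emeasurable_funM; first exact: measurableT_comp.
apply/measurable_EFinP; apply: measurable_funM; first exact: ham.
exact: measurableT_comp.
Qed.

Lemma measurable_kap t (h : E -> \bar R) : measurable_fun setT h -> (forall x, 0 <= h x)%E ->
  measurable_fun setT (fun x => \int[kap t x]_x' h x')%E.
Proof.
move=> mh h0; under eq_fun do rewrite ge0_integral_kap//.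
apply: (@measurable_fun_fubini_tonelli_F _ _ _ _ _ mu _ (jointh_m t mh)) => z.
by rewrite /jointh mule_ge0// lee_fin mulr_ge0// ltW.
Qed.

(** Bayes' formula in integrated form: the filter transported by the kernel is [pY] times the next
    filter. The almost everywhere statements about [Lop] rest on this identity. *)
Lemma tonelli_kap t (h : E -> \bar R) : measurable_fun setT h -> (forall x, 0 <= h x)%E ->
  (\int[piM t]_x \int[kap t x]_x' h x' = (pY t.+1)%:E * \int[piM t.+1]_x h x)%E.
Proof.
move=> mh h0.
have [mp p1 aep] := pred_spec (filt_spec t).
rewrite ge0_integral_piM//; last 2 first.
- exact: measurable_kap.
- by move=> x; exact: integral_ge0.
pose H (z : E * E) := (h z.2 * (a t.+1 z.1 z.2 * g t.+1 z.2)%:E * (filt t z.1)%:E)%E.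
have mH : measurable_fun setT H.
  apply: emeasurable_funM; first exact: jointh_m.
  by apply/measurable_EFinP; apply: measurableT_comp => //; exact: filt_measurable.
have H0 z : (0 <= H z)%E.
  by rewrite /H !mule_ge0// lee_fin ?mulr_ge0 ?filt_ge0// ltW.
transitivity (\int[mu]_x \int[mu]_y H (x, y))%E.
  apply: eq_integral => x _; rewrite ge0_integral_kap// -ge0_integralZr// ?lee_fin ?filt_ge0//.
  - exact: (measurable_fun_pair2 x (jointh_m t mh)).
  - by move=> z _; rewrite mule_ge0// lee_fin mulr_ge0// ltW.
rewrite (@fubini_tonelli _ _ _ _ _ mu mu _ mH H0).
transitivity (\int[mu]_y (h y * (g t.+1 y)%:E * pred_ext t y))%E.
  apply: eq_integral => y _; rewrite /pred_ext -ge0_integralZl//.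
  - apply: eq_integral => x _; rewrite /H/= -!muleA -!EFinM; congr (_ * _%:E)%E; ring.
  - apply/measurable_EFinP; apply: measurable_funM; first exact: filt_measurable.
    exact: a_measurable1.
  - by move=> x _; rewrite lee_fin mulr_ge0// filt_ge0.
  - by rewrite mule_ge0// lee_fin ltW.
have mhg : measurable_fun setT (fun y => h y * (g t.+1 y)%:E)%E.
  by apply: emeasurable_funM => //; exact/measurable_EFinP.
have mfp : measurable_fun setT (EFin \o (fun x => fine (pred_ext t x))).
  by apply/measurable_EFinP; apply: measurableT_comp => //; exact: fine_measurable.
transitivity (\int[mu]_y (h y * (g t.+1 y)%:E * (fine (pred_ext t y))%:E))%E.
  apply: ae_eq_integral => //; try exact: emeasurable_funM.
  by apply: filterS aep => y /= e /e ->.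
rewrite (ge0_integral_piM t.+1 mh h0).
have mf1 := filt_measurable t.+1; have f10 := @filt_ge0 t.+1; have p0 := pY_gt0 t.
have eU y : g t.+1 y * fine (pred_ext t y) = pY t.+1 * filt t.+1 y := uf_pY t y.
move: mf1 f10 p0 eU; set f := filt t.+1; set p := pY t.+1; clearbody f p => mf1 f10 p0 eU.
rewrite -ge0_integralZl//.
- by apply: eq_integral => y _; rewrite -muleA -EFinM eU EFinM muleCA.
- by apply: emeasurable_funM => //; exact/measurable_EFinP.
- by move=> x _; rewrite mule_ge0// lee_fin.
- by rewrite lee_fin ltW.
Qed.

End Model.

Section RealIntegrable.
Context {R : realType} {d} {T : measurableType d} (m : {measure set T -> \bar R}).
Implicit Types f h : T -> R.

Lemma real_integrableD f h : m.-integrable setT (EFin \o f) -> m.-integrable setT (EFin \o h) ->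
  m.-integrable setT (EFin \o (fun x => f x + h x)).
Proof. by move=> i1 i2; have := integrableD measurableT i1 i2; apply: eq_integrable. Qed.

Lemma real_integrableZl c f : m.-integrable setT (EFin \o f) ->
  m.-integrable setT (EFin \o (fun x => c * f x)).
Proof. by move=> i1; have := integrableZl measurableT c i1; apply: eq_integrable. Qed.

Lemma real_integrable_le f h : measurable_fun setT f -> m.-integrable setT (EFin \o h) ->
  (forall x, `|f x| <= h x) -> m.-integrable setT (EFin \o f).
Proof.
move=> mf ih fh; apply: le_integrable ih => //; first exact/measurable_EFinP.
by move=> x _ /=; rewrite lee_fin (le_trans (fh x))// ler_norm.
Qed.

Lemma ge0_real_integrable f : measurable_fun setT f -> (forall x, 0 <= f x) ->
  (\int[m]_x (f x)%:E < +oo)%E -> m.-integrable setT (EFin \o f).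
Proof.
move=> mf f0 fy; apply/integrableP; split; first exact/measurable_EFinP.
by under eq_integral do rewrite gee0_abs ?lee_fin//.
Qed.

Lemma integral_ltyE f : m.-integrable setT (EFin \o f) ->
  (\int[m]_x (f x)%:E)%E = (\int[m]_x f x)%:E.
Proof. by move=> fi; rewrite /Rintegral fineK//; exact: integrable_fin_num. Qed.

Lemma ae_eq_Rintegral f h : measurable_fun setT f -> measurable_fun setT h ->
  {ae m, forall x, f x = h x} -> \int[m]_x f x = \int[m]_x h x.
Proof.
move=> mf mh fh; rewrite /Rintegral; congr fine.
apply: ae_eq_integral => //; try exact/measurable_EFinP.
by apply: filterS fh => x e _; rewrite e.
Qed.

(** Cauchy-Schwarz for a measure of mass at most [c], from the integral of [(f - l) ^+ 2] being
    nonnegative. *)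
Lemma sqr_Rintegral_le f (c : R) : measurable_fun setT f -> 0 < c -> (m setT <= c%:E)%E ->
  (((\int[m]_x f x) ^+ 2)%:E <= c%:E * \int[m]_x (f x ^+ 2)%:E)%E.
Proof.
move=> mf c0 mc.
have mf2 : measurable_fun setT (fun x => f x ^+ 2) by exact: measurable_funX.
have f20 x : 0 <= f x ^+ 2 by exact: sqr_ge0.
have I0 : (0 <= \int[m]_x (f x ^+ 2)%:E)%E by apply: integral_ge0 => x _; rewrite lee_fin.
have [Iy|] := ltP (\int[m]_x (f x ^+ 2)%:E)%E +oo%E; last first.
  by rewrite leye_eq => /eqP->; rewrite gt0_muley ?lte_fin// leey.
have i2 := ge0_real_integrable mf2 f20 Iy.
have ic : m.-integrable setT (EFin \o (cst 1 : T -> R)).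
  apply: ge0_real_integrable => //.
  have -> : (\int[m]_x (cst 1 x : R)%:E = m setT)%E by rewrite -[RHS]mul1e -integral_cst.
  by rewrite (le_lt_trans mc)// ltry.
have i1 : m.-integrable setT (EFin \o f).
  apply: (real_integrable_le (h := fun x => 1 + f x ^+ 2)) => //; first exact: real_integrableD.
  move=> x; have : 0 <= (`|f x| - 1) ^+ 2 by exact: sqr_ge0.
  rewrite sqrrB1 -[f x ^+ 2]real_normK ?num_real// => h.
  have := normr_ge0 (f x); have := sqr_ge0 `|f x|; lra.
rewrite integral_ltyE// -EFinM lee_fin.
set A := \int[m]_x _ ^+ 2; set B := \int[m]_x f x.
have fm : m setT \is a fin_num by rewrite ge0_fin_numE// (le_lt_trans mc)// ltry.
pose mm := fine (m setT).
have mm_c : mm <= c by rewrite -lee_fin fineK.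
(* Dividing by the bound [c] and not by the mass avoids a separate case of mass zero; the
   discrepancy [(B / c) ^+ 2 * (c - mm)] has the right sign. *)
pose l := B / c.
have : 0 <= \int[m]_x ((f x - l) ^+ 2) by apply: Rintegral_ge0 => x _; exact: sqr_ge0.
have -> : \int[m]_x ((f x - l) ^+ 2) = A - 2 * l * B + l ^+ 2 * mm.
  have -> : \int[m]_x ((f x - l) ^+ 2) = \int[m]_x ((f x ^+ 2 + (- (2 * l)) * f x) + l ^+ 2 * 1).
    by apply: eq_Rintegral => x _; ring.
  rewrite RintegralD//; last 2 first.
  - by apply: real_integrableD => //; exact: real_integrableZl.
  - exact: real_integrableZl.
  rewrite RintegralD//; last exact: real_integrableZl.
  rewrite RintegralZl// RintegralZl// Rintegral_cst// mul1r -/A -/B -/mm; ring.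
have -> : A - 2 * l * B + l ^+ 2 * mm = A - B ^+ 2 / c - (B / c) ^+ 2 * (c - mm).
  by rewrite /l; field; rewrite gt_eqF.
have : 0 <= (B / c) ^+ 2 * (c - mm) by rewrite mulr_ge0 ?sqr_ge0// subr_ge0.
move=> h1 h2; have : B ^+ 2 / c <= A by lra.
by rewrite ler_pdivrMr// mulrC.
Qed.

End RealIntegrable.

(** * Square integrable functions and covariances *)

Section L2.
Context {R : realType} {d} {T : measurableType d} (P : probability T R).
Implicit Types f h k : T -> R.

Definition L2 f := measurable_fun setT f /\ (\int[P]_x (f x ^+ 2)%:E < +oo)%E.

Lemma L2_measurable f : L2 f -> measurable_fun setT f. Proof. by case. Qed.

Lemma L2_sqr_integrable f : L2 f -> P.-integrable setT (EFin \o (fun x => f x ^+ 2)).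
Proof.
move=> [mf fy]; apply: ge0_real_integrable => //; first exact: measurable_funX.
by move=> x; exact: sqr_ge0.
Qed.

Lemma L2_dom f h : measurable_fun setT f -> P.-integrable setT (EFin \o h) ->
  (forall x, f x ^+ 2 <= h x) -> L2 f.
Proof.
move=> mf ih fh; split => //.
have /integrableP[_] : P.-integrable setT (EFin \o (fun x => f x ^+ 2)).
  apply: (real_integrable_le _ ih); first exact: measurable_funX.
  by move=> x; rewrite ger0_norm ?sqr_ge0.
by under eq_integral do rewrite gee0_abs ?lee_fin ?sqr_ge0//.
Qed.

Lemma L2_mul_integrable f h : L2 f -> L2 h -> P.-integrable setT (EFin \o (fun x => f x * h x)).
Proof.
move=> Lf Lh; apply: (real_integrable_le (h := fun x => f x ^+ 2 + h x ^+ 2)).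
- by apply: measurable_funM; exact: L2_measurable.
- by apply: real_integrableD; exact: L2_sqr_integrable.
- move=> x; rewrite normrM -[f x ^+ 2]real_normK ?num_real// -[h x ^+ 2]real_normK ?num_real//.
  have := normr_ge0 (f x); have := normr_ge0 (h x).
  have := sqr_ge0 (`|f x| - `|h x|); nra.
Qed.

Lemma L2_cst c : L2 (cst c).
Proof.
split => //; rewrite (_ : (\int[P]_x _ = (c ^+ 2)%:E)%E) ?ltry//.
by rewrite -[RHS]mule1 -(@probability_setT _ _ _ P) -integral_cst.
Qed.

Lemma L2_integrable f : L2 f -> P.-integrable setT (EFin \o f).
Proof.
move=> Lf; have := L2_mul_integrable Lf (L2_cst 1).
by apply: eq_integrable => // x _; rewrite /= mulr1.
Qed.

Lemma L2_lin c f h : L2 f -> L2 h -> L2 (fun x => c * f x + h x).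
Proof.
move=> Lf Lh; apply: (L2_dom (h := fun x => (2 * c ^+ 2) * f x ^+ 2 + 2 * h x ^+ 2)).
- apply: measurable_funD; last exact: L2_measurable.
  by apply: measurable_funM => //; exact: L2_measurable.
- by apply: real_integrableD; apply: real_integrableZl; exact: L2_sqr_integrable.
- move=> x; rewrite (_ : 2 * c ^+ 2 * f x ^+ 2 = 2 * (c * f x) ^+ 2); last by ring.
  have := sqr_ge0 (c * f x - h x); rewrite !expr2; nra.
Qed.

Lemma L2D f h : L2 f -> L2 h -> L2 (fun x => f x + h x).
Proof.
by move=> Lf Lh; have := L2_lin 1 Lf Lh; under eq_fun do rewrite mul1r.
Qed.

Lemma L2Z c f : L2 f -> L2 (fun x => c * f x).
Proof.
by move=> Lf; have := L2_lin c Lf (L2_cst 0); under eq_fun do rewrite addr0.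
Qed.

Lemma L2B_cst f c : L2 f -> L2 (fun x => f x - c).
Proof. by move=> Lf; exact: (L2D Lf (L2_cst (- c))). Qed.

Lemma L2_of_centered f c : measurable_fun setT f ->
  (\int[P]_x ((f x - c) ^+ 2)%:E < +oo)%E -> L2 f.
Proof.
move=> mf fy; have Lc : L2 (fun x => f x - c) by split => //; exact: measurable_funB.
by have := L2D Lc (L2_cst c); under eq_fun do rewrite /= subrK.
Qed.

Definition cov f h := \int[P]_x (f x * h x) - (\int[P]_x f x) * (\int[P]_x h x).

Lemma covC f h : cov f h = cov h f.
Proof. by rewrite /cov mulrC; congr (_ - _); apply: eq_Rintegral => x _; rewrite mulrC. Qed.

Lemma cov_linl c f h k : L2 f -> L2 h -> L2 k ->
  cov (fun x => c * f x + h x) k = c * cov f k + cov h k.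
Proof.
move=> Lf Lh Lk; rewrite /cov.
have -> : \int[P]_x ((c * f x + h x) * k x) = \int[P]_x (c * (f x * k x) + h x * k x).
  by apply: eq_Rintegral => x _; ring.
rewrite RintegralD//; last 2 first.
- by apply: real_integrableZl; exact: L2_mul_integrable.
- exact: L2_mul_integrable.
rewrite RintegralZl//; last exact: L2_mul_integrable.
rewrite RintegralD//; last 2 first.
- by apply: real_integrableZl; exact: L2_integrable.
- exact: L2_integrable.
rewrite RintegralZl//; last exact: L2_integrable.
by ring.
Qed.

Lemma cov_ael f h k : L2 f -> L2 h -> L2 k -> {ae P, forall x, f x = h x} -> cov f k = cov h k.
Proof.
move=> Lf Lh Lk fh; rewrite /cov; congr (_ - _ * _).
- apply: ae_eq_Rintegral; try by apply: measurable_funM; exact: L2_measurable.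
  by apply: filterS fh => x ->.
- by apply: ae_eq_Rintegral => //; exact: L2_measurable.
Qed.

Lemma integral_sqr_centered f : L2 f ->
  (\int[P]_x ((f x - \int[P]_z f z) ^+ 2)%:E)%E = (cov f f)%:E.
Proof.
move=> Lf; set c := (\int[P]_z f z)%R.
rewrite integral_ltyE; last exact: L2_sqr_integrable (L2B_cst c Lf).
congr (_%:E); rewrite /cov -/c.
have -> : \int[P]_x ((f x - c) ^+ 2) = \int[P]_x ((f x * f x + (- (2 * c)) * f x) + c ^+ 2).
  by apply: eq_Rintegral => x _; ring.
have i1 := L2_mul_integrable Lf Lf; have i2 := L2_integrable Lf.
rewrite RintegralD//; last 2 first.
- by apply: real_integrableD => //; exact: real_integrableZl.
- exact: L2_integrable (L2_cst _).
rewrite RintegralD//; last exact: real_integrableZl.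
by rewrite RintegralZl// Rintegral_prob_cst -/c; ring.
Qed.

Lemma cov_ge0 f : L2 f -> 0 <= cov f f.
Proof.
move=> Lf; rewrite -lee_fin -integral_sqr_centered//.
by apply: integral_ge0 => x _; rewrite lee_fin sqr_ge0.
Qed.

End L2.

(** * The operators [Lop] and [Dop] on square integrable functions *)

Section Operators.
Context {R : realType} {dE} {E : measurableType dE} (M : fmodel R E).
Local Notation mu := (fm_mu M).
Local Notation a0 := (fm_a0 M).
Local Notation a := (fm_a M).
Local Notation g := (fm_g M).
Local Notation filt := (filt mu a0 a g).
Local Notation pY := (pY mu a0 a g).
Local Notation Lop := (Lop mu a g).
Local Notation mf := (mf mu a0 a g).
Implicit Types psi phi : E -> R.

Lemma kap_ae_finite t (h : E -> \bar R) : measurable_fun setT h -> (forall x, 0 <= h x)%E ->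
  (\int[piM M t.+1]_x h x < +oo)%E ->
  {ae piM M t, forall x, (\int[kap M t x]_z h z < +oo)%E}.
Proof.
move=> mh h0 hy.
have k0 x : (0 <= \int[kap M t x]_z h z)%E by exact: integral_ge0.
have ik : (piM M t).-integrable setT (fun x => \int[kap M t x]_z h z)%E.
  apply/integrableP; split; first exact: measurable_kap.
  under eq_integral do rewrite gee0_abs//.
  have pY0 : (0 <= (pY t.+1)%:E)%E by rewrite lee_fin ltW// pY_gt0.
  rewrite tonelli_kap// -ge0_fin_numE; last by rewrite mule_ge0// integral_ge0.
  by rewrite fin_numM// ge0_fin_numE// integral_ge0.
by apply: filterS (integrable_ae measurableT ik) => x /(_ I); rewrite ge0_fin_numE.
Qed.

Lemma kap_ae_integrable t psi : measurable_fun setT psi ->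
  (piM M t.+1).-integrable setT (EFin \o psi) ->
  {ae piM M t, forall x, (kap M t x).-integrable setT (EFin \o psi)}.
Proof.
move=> mpsi /integrableP[mpE psiy].
have mabs : measurable_fun setT (fun x => `|(EFin \o psi) x|)%E by exact: measurableT_comp.
apply: filterS (kap_ae_finite mabs _ psiy) => // x hx.
exact/integrableP.
Qed.

Lemma LopE t psi x : measurable_fun setT psi ->
  Lop t.+1 psi x = fine (\int[kap M t x]_z (EFin \o psi)^\+ z - \int[kap M t x]_z (EFin \o psi)^\- z)%E.
Proof. by move=> mpsi; rewrite Lop_kap// /Rintegral integralE. Qed.

Lemma Lop_measurable t psi : measurable_fun setT psi -> measurable_fun setT (Lop t.+1 psi).
Proof.
move=> mpsi; rewrite (_ : Lop t.+1 psi = fun x => fine (\int[kap M t x]_z (EFin \o psi)^\+ z - \int[kap M t x]_z (EFin \o psi)^\- z)%E); last first.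
  by apply/funext => x; exact: LopE.
have mE : measurable_fun setT (EFin \o psi) by exact/measurable_EFinP.
apply: measurableT_comp => //.
apply: emeasurable_funB; apply: measurable_kap => //.
- exact: measurable_funepos.
- exact: measurable_funeneg.
Qed.

(** [Lop] is the [fine] of a difference of two integrals, meaningful where both are finite.
    [tonelli_kap] on the positive and negative parts shows that this happens almost everywhere and
    evaluates the integral. *)
Lemma Lop_integral t psi : measurable_fun setT psi ->
  (piM M t.+1).-integrable setT (EFin \o psi) ->
  (piM M t).-integrable setT (EFin \o Lop t.+1 psi) /\
  \int[piM M t]_x Lop t.+1 psi x = pY t.+1 * \int[piM M t.+1]_x psi x.
Proof.
move=> mpsi ipsi.
have mE : measurable_fun setT (EFin \o psi) by exact/measurable_EFinP.
have mp := measurable_funepos mE; have mn := measurable_funeneg mE.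
pose Fp x := (\int[kap M t x]_z (EFin \o psi)^\+ z)%E.
pose Fn x := (\int[kap M t x]_z (EFin \o psi)^\- z)%E.
have mFp : measurable_fun setT Fp by exact: measurable_kap.
have mFn : measurable_fun setT Fn by exact: measurable_kap.
have Fp0 x : (0 <= Fp x)%E by exact: integral_ge0.
have Fn0 x : (0 <= Fn x)%E by exact: integral_ge0.
have ip := integrable_funepos measurableT ipsi.
have in_ := integrable_funeneg measurableT ipsi.
have pY0 : (0 <= (pY t.+1)%:E)%E by rewrite lee_fin ltW// pY_gt0.
have fp : (\int[piM M t.+1]_x (EFin \o psi)^\+ x)%E \is a fin_num by exact: integrable_fin_num.
have fn : (\int[piM M t.+1]_x (EFin \o psi)^\- x)%E \is a fin_num by exact: integrable_fin_num.
have iFp : (piM M t).-integrable setT Fp.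
  apply/integrableP; split => //; under eq_integral do rewrite gee0_abs//.
  by rewrite tonelli_kap// -ge0_fin_numE ?fin_numM// mule_ge0// integral_ge0.
have iFn : (piM M t).-integrable setT Fn.
  apply/integrableP; split => //; under eq_integral do rewrite gee0_abs//.
  by rewrite tonelli_kap// -ge0_fin_numE ?fin_numM// mule_ge0// integral_ge0.
have aeL : {ae piM M t, forall x, (Lop t.+1 psi x)%:E = (Fp x - Fn x)%E}.
  have h1 := integrable_ae measurableT iFp; have h2 := integrable_ae measurableT iFn.
  apply: filterS2 h1 h2 => x /(_ I) f1 /(_ I) f2.
  by rewrite LopE// fineK// fin_numB f1 f2.
have mL : measurable_fun setT (EFin \o Lop t.+1 psi).
  by apply/measurable_EFinP; exact: Lop_measurable.
have iB := integrableB measurableT iFp iFn.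
have iL : (piM M t).-integrable setT (EFin \o Lop t.+1 psi).
  apply/integrableP; split => //; case/integrableP : iB => mB; apply: le_lt_trans.
  rewrite le_eqVlt; apply/orP; left; apply/eqP; apply: ae_eq_integral => //.
  - exact: measurableT_comp.
  - exact: measurableT_comp.
  - by apply: filterS aeL => x e _; exact: (congr1 abse e).
split => //.
rewrite /Rintegral (ae_eq_integral (fun x => Fp x - Fn x)%E)//; last 2 first.
- by case/integrableP : iB.
- by apply: filterS aeL => x e _; exact: e.
rewrite integralB// !tonelli_kap//.
have -> : (\int[piM M t.+1]_x (psi x)%:E = \int[piM M t.+1]_x (EFin \o psi)^\+ x -
    \int[piM M t.+1]_x (EFin \o psi)^\- x)%E by rewrite integralE.
by rewrite -(fineK fp) -(fineK fn) -!EFinM -!EFinB/= mulrBr.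
Qed.

(** Cauchy-Schwarz under the kernel, whose mass is at most [C t.+1], then [tonelli_kap]. Hence every
    step of the variance recursion stays among square integrable functions. *)
Lemma Lop_L2 t psi : L2 (piM M t.+1) psi -> L2 (piM M t) (Lop t.+1 psi).
Proof.
move=> Lpsi; have mpsi := L2_measurable Lpsi; split; first exact: Lop_measurable.
have m2 : measurable_fun setT (fun x => (psi x ^+ 2)%:E) by apply/measurable_EFinP; exact: measurable_funX.
have p2 x : (0 <= (psi x ^+ 2)%:E)%E by rewrite lee_fin sqr_ge0.
have C0 := C_gt0 M t.
apply: (@le_lt_trans _ _ (\int[piM M t]_x ((fm_C M t.+1)%:E * \int[kap M t x]_z (psi z ^+ 2)%:E))%E).
  apply: ge0_le_integral => //.
  - by move=> x _; rewrite lee_fin sqr_ge0.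
  - by apply/measurable_EFinP; apply: measurable_funX; exact: Lop_measurable.
  - by apply: emeasurable_funM => //; exact: measurable_kap.
  - by move=> x _; rewrite Lop_kap//; apply: sqr_Rintegral_le => //; exact: kap_le.
rewrite ge0_integralZl ?lee_fin ?ltW//; last 2 first.
- exact: measurable_kap.
- by move=> x _; exact: integral_ge0.
rewrite tonelli_kap//; have := L2_sqr_integrable Lpsi => /(integrable_fin_num measurableT) f2.
have := pY_gt0 M t => pY0.
have I0 : (0 <= \int[piM M t.+1]_x (psi x ^+ 2)%:E)%E by exact: integral_ge0.
rewrite -ge0_fin_numE ?fin_numM//.
by apply: mule_ge0; [rewrite lee_fin ltW|apply: mule_ge0 => //; rewrite lee_fin ltW].
Qed.

Lemma Lop_lin_ae t c psi phi : measurable_fun setT psi -> measurable_fun setT phi ->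
  (piM M t.+1).-integrable setT (EFin \o psi) -> (piM M t.+1).-integrable setT (EFin \o phi) ->
  {ae piM M t, forall x, Lop t.+1 (fun z => c * psi z + phi z) x = c * Lop t.+1 psi x + Lop t.+1 phi x}.
Proof.
move=> mpsi mphi ipsi iphi.
apply: filterS2 (kap_ae_integrable mpsi ipsi) (kap_ae_integrable mphi iphi) => x i1 i2.
rewrite !Lop_kap//; last by apply: measurable_funD => //; exact: measurable_funM.
by rewrite RintegralD// ?RintegralZl//; exact: real_integrableZl.
Qed.

(** The set [N] of disagreement is null for the filter at [t.+1], so by [tonelli_kap] almost every
    kernel at time [t] gives it mass zero. *)
Lemma Lop_ae t psi phi : measurable_fun setT psi -> measurable_fun setT phi ->
  {ae piM M t.+1, forall x, psi x = phi x} -> {ae piM M t, forall x, Lop t.+1 psi x = Lop t.+1 phi x}.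
Proof.
move=> mpsi mphi e.
pose N := [set x | psi x != phi x].
have mN : measurable N.
  rewrite (_ : N = ~` ((fun x => psi x - phi x) @^-1` [set 0])).
    apply: measurableC; rewrite -[X in measurable X]setTI.
    by apply: (measurable_funB mpsi mphi) => //; exact: measurable_set1.
  apply/seteqP; split => x /=.
    by move=> /negP h /eqP; rewrite subr_eq0 => /h.
  by move=> h; apply/negP => /eqP e'; apply: h; rewrite e' subrr.
have N0 : piM M t.+1 N = 0%E.
  case: e => A [mA A0 sA]; apply/eqP; rewrite eq_le measure_ge0 andbT -A0.
  by apply: le_measure; rewrite ?inE// => x /= xN; apply: sA => /= xe; move: xN; rewrite /N/= xe eqxx.
have mI : measurable_fun setT (fun x => (\1_N x : R)%:E) by apply/measurable_EFinP; exact: measurable_indic.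
have kE x : (\int[kap M t x]_z (\1_N z)%:E)%E = kap M t x N by rewrite integral_indic// setIT.
have H : (\int[piM M t]_x `|kap M t x N| = 0)%E.
  transitivity (\int[piM M t]_x \int[kap M t x]_z (\1_N z)%:E)%E.
    by apply: eq_integral => x _; rewrite kE gee0_abs.
  rewrite tonelli_kap//.
  have -> : (\int[piM M t.+1]_x (\1_N x)%:E = 0)%E.
    by rewrite integral_indic// setIT; exact: N0.
  by rewrite mule0.
have mk : measurable_fun setT (fun x => kap M t x N).
  under eq_fun do rewrite -kE; apply: measurable_kap => // x; by rewrite lee_fin.
move/(ae_eq_integral_abs _ measurableT mk) : H; apply: filterS => x /(_ I) /= kN.
rewrite !Lop_kap//; apply: ae_eq_Rintegral => //.
by exists N; split => // z /= zN; rewrite /N/=; apply/eqP.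
Qed.

(** Linearised effect of one step: the next filter is a ratio of integrals of the current one, and
    to first order a deviation of the latter reaches [phi] through this operator. *)
Fact Dop_sig : {D : nat -> (E -> R) -> E -> R |
  forall t phi, D t phi = (fun x => Lop t (fun z => phi z - mf t phi) x / pY t)}.
Proof. by exists (fun t phi x => Lop t (fun z => phi z - mf t phi) x / pY t). Qed.

Definition Dop := sval Dop_sig.

Lemma DopE t phi : Dop t phi = (fun x => Lop t (fun z => phi z - mf t phi) x / pY t).
Proof. exact: (svalP Dop_sig). Qed.

Lemma Dop_L2 t phi : L2 (piM M t.+1) phi -> L2 (piM M t) (Dop t.+1 phi).
Proof.
move=> Lphi; rewrite DopE; have := L2Z (pY t.+1)^-1 (Lop_L2 (L2B_cst (mf t.+1 phi) Lphi)).
by under eq_fun do rewrite mulrC.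
Qed.

Lemma mf_lin t c psi phi : L2 (piM M t) psi -> L2 (piM M t) phi ->
  mf t (fun z => c * psi z + phi z) = c * mf t psi + mf t phi.
Proof.
move=> Lpsi Lphi.
rewrite (mf_piM M t (L2_measurable Lpsi)) (mf_piM M t (L2_measurable Lphi)).
rewrite (mf_piM M t (L2_measurable (L2_lin c Lpsi Lphi))).
have i1 := L2_integrable Lpsi; have i2 := L2_integrable Lphi.
by rewrite RintegralD// ?RintegralZl//; exact: real_integrableZl.
Qed.

Lemma Dop_lin_ae t c psi phi : L2 (piM M t.+1) psi -> L2 (piM M t.+1) phi ->
  {ae piM M t, forall x, Dop t.+1 (fun z => c * psi z + phi z) x = c * Dop t.+1 psi x + Dop t.+1 phi x}.
Proof.
move=> Lpsi Lphi; rewrite !DopE mf_lin//.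
have L1 := L2B_cst (mf t.+1 psi) Lpsi; have L2' := L2B_cst (mf t.+1 phi) Lphi.
have := @Lop_lin_ae t c _ _ (L2_measurable L1) (L2_measurable L2') (L2_integrable L1) (L2_integrable L2').
apply: filterS => x e.
have -> : (fun z => c * psi z + phi z - (c * mf t.+1 psi + mf t.+1 phi)) =
  (fun z => c * (psi z - mf t.+1 psi) + (phi z - mf t.+1 phi)).
  by apply/funext => z; ring.
by rewrite e mulrDl mulrA.
Qed.

Lemma Dop_ae t psi phi : L2 (piM M t.+1) psi -> L2 (piM M t.+1) phi ->
  {ae piM M t.+1, forall x, psi x = phi x} -> {ae piM M t, forall x, Dop t.+1 psi x = Dop t.+1 phi x}.
Proof.
move=> Lpsi Lphi e.
have em : mf t.+1 psi = mf t.+1 phi.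
  rewrite (mf_piM M _ (L2_measurable Lpsi)) (mf_piM M _ (L2_measurable Lphi)).
  by apply: ae_eq_Rintegral; [exact: L2_measurable Lpsi|exact: L2_measurable Lphi|].
have := @Lop_ae t (fun z => psi z - mf t.+1 psi) (fun z => phi z - mf t.+1 phi).
move=> /(_ (L2_measurable (L2B_cst _ Lpsi)) (L2_measurable (L2B_cst _ Lphi))) h.
apply: filterS (h _) => [x ex|]; first by rewrite !DopE ex.
by apply: filterS e => x ->; rewrite em.
Qed.

End Operators.

(** * The asymptotic variance as a bilinear form *)

Section Variance.
Context {R : realType} {dE} {E : measurableType dE} (M : fmodel R E).
Local Notation mu := (fm_mu M).
Local Notation a0 := (fm_a0 M).
Local Notation a := (fm_a M).
Local Notation g := (fm_g M).
Local Notation pY := (pY mu a0 a g).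
Local Notation Lop := (Lop mu a g).
Local Notation mf := (mf mu a0 a g).
Local Notation sigma2 := (sigma2 mu a0 a g).
Local Notation Vvar := (Vvar mu a0 a g).
Local Notation Vcov := (Vcov mu a0 a g).
Local Notation pi := (piM M).
Local Notation D := (Dop M).
Implicit Types psi phi : E -> R.

Lemma sigma2_L2 t psi : measurable_fun setT psi -> (sigma2 t psi < +oo)%E -> L2 (pi t) psi.
Proof. by move=> mpsi; rewrite sigma2_piM//; exact: L2_of_centered. Qed.

Lemma sigma2_cov t psi : L2 (pi t) psi -> sigma2 t psi = (cov (pi t) psi psi)%:E.
Proof.
move=> Lpsi; have mpsi := L2_measurable Lpsi.
by rewrite sigma2_piM// mf_piM// integral_sqr_centered.
Qed.

Fact Vc_sig : {V : nat -> nat -> (E -> R) -> (E -> R) -> R |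
  forall r k psi phi, V r k psi phi = Vcov r k psi phi}.
Proof. by exists Vcov. Qed.

Definition Vc := sval Vc_sig.

Lemma VcE r k psi phi : Vc r k psi phi = Vcov r k psi phi.
Proof. exact: (svalP Vc_sig). Qed.

Lemma VcS r k psi phi : Vc r k.+1 psi phi = Vc r k psi (D (r + k.+1) phi).
Proof. by rewrite !VcE DopE. Qed.

(** Polarised form of the variance recursion; the factor [pY ^- 2] is distributed over the two
    arguments through [D]. *)
Fixpoint Bf_rec (t : nat) psi phi : R :=
  match t with
  | 0 => cov (pi 0) psi phi
  | s.+1 => cov (pi s.+1) psi phi + Bf_rec s (D s.+1 psi) (D s.+1 phi)
  end.

Fact Bf_sig : {B : nat -> (E -> R) -> (E -> R) -> R |
  (forall psi phi, B 0%N psi phi = cov (pi 0) psi phi) /\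
  (forall t psi phi, B t.+1 psi phi = cov (pi t.+1) psi phi + B t (D t.+1 psi) (D t.+1 phi))}.
Proof. by exists Bf_rec. Qed.

Definition Bf := sval Bf_sig.

Lemma Bf0 psi phi : Bf 0 psi phi = cov (pi 0) psi phi.
Proof. exact: (svalP Bf_sig).1. Qed.

Lemma BfS t psi phi :
  Bf t.+1 psi phi = cov (pi t.+1) psi phi + Bf t (D t.+1 psi) (D t.+1 phi).
Proof. exact: (svalP Bf_sig).2. Qed.

Lemma BfC t psi phi : Bf t psi phi = Bf t phi psi.
Proof.
elim: t psi phi => [|t IH] psi phi; first by rewrite !Bf0 covC.
by rewrite !BfS covC IH.
Qed.

(** Invariance modulo null sets has to precede bilinearity, because [D] is linear only almost
    everywhere. *)
Lemma Bf_ael t psi psi' phi : L2 (pi t) psi -> L2 (pi t) psi' -> L2 (pi t) phi ->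
  {ae pi t, forall x, psi x = psi' x} -> Bf t psi phi = Bf t psi' phi.
Proof.
elim: t psi psi' phi => [|t IH] psi psi' phi L1 L2' L3 e.
  by rewrite !Bf0; exact: cov_ael.
by rewrite !BfS (cov_ael L1 L2' L3 e) (IH (D t.+1 psi) (D t.+1 psi') (D t.+1 phi))//;
  [exact: Dop_L2|exact: Dop_L2|exact: Dop_L2|exact: Dop_ae].
Qed.

Lemma Bf_linl t c psi psi' phi : L2 (pi t) psi -> L2 (pi t) psi' -> L2 (pi t) phi ->
  Bf t (fun x => c * psi x + psi' x) phi = c * Bf t psi phi + Bf t psi' phi.
Proof.
elim: t psi psi' phi => [|t IH] psi psi' phi L1 L2' L3.
  by rewrite !Bf0; exact: cov_linl.
have D1 := Dop_L2 L1; have D2 := Dop_L2 L2'; have D3 := Dop_L2 L3.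
have e := Bf_ael (Dop_L2 (L2_lin c L1 L2')) (L2_lin c D1 D2) D3 (Dop_lin_ae c L1 L2').
by rewrite !BfS (cov_linl c L1 L2' L3) e (IH _ _ _ D1 D2 D3); ring.
Qed.

Lemma Bf_linr t c psi phi phi' : L2 (pi t) psi -> L2 (pi t) phi -> L2 (pi t) phi' ->
  Bf t psi (fun x => c * phi x + phi' x) = c * Bf t psi phi + Bf t psi phi'.
Proof. by move=> L1 L2' L3; rewrite BfC Bf_linl// ![Bf t _ psi]BfC. Qed.

Lemma Bf_scalel t c psi phi : L2 (pi t) psi -> L2 (pi t) phi ->
  Bf t (fun x => c * psi x) phi = c * Bf t psi phi.
Proof.
move=> L1 L2'; have L0 := L2_cst (pi t) 0.
have B0 : Bf t (cst 0) phi = 0.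
  have := Bf_linl (-1) L0 L0 L2'.
  rewrite (_ : (fun x : E => -1 * cst 0 x + cst 0 x) = cst 0); last first.
    by apply/funext => x; rewrite /= mulr0 addr0.
  by rewrite mulN1r addNr.
have := Bf_linl c L1 L0 L2'; rewrite B0 addr0 => <-.
by congr (Bf t _ phi); apply/funext => x; rewrite /= addr0.
Qed.

Lemma Bf_scale2 t c psi : L2 (pi t) psi ->
  Bf t (fun x => c * psi x) (fun x => c * psi x) = c ^+ 2 * Bf t psi psi.
Proof.
move=> L; rewrite Bf_scalel//; last exact: L2Z.
by rewrite BfC Bf_scalel// mulrA expr2.
Qed.

(** The left side is extended-valued and the form is real, so the identity contains the finiteness
    of the variance. *)
Lemma Vvar_Bf t psi : L2 (pi t) psi -> Vvar t psi = (Bf t psi psi)%:E.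
Proof.
elim: t psi => [|t IH] psi L; first by rewrite Bf0; exact: sigma2_cov.
rewrite BfS /=.
have Lc := Lop_L2 (L2B_cst (mf t.+1 psi) L).
rewrite sigma2_cov// IH// -EFinM -EFinD; congr (_ + _)%:E.
rewrite -exprVn -Bf_scale2// !DopE; congr (Bf t _ _); apply/funext => x; by rewrite mulrC.
Qed.

Lemma Vc0 t psi phi : L2 (pi t) psi -> L2 (pi t) phi -> Vc t 0 psi phi = Bf t psi phi.
Proof.
move=> L1 L2'; rewrite VcE /= !Vvar_Bf//; last exact: L2D.
have e : (fun x => psi x + phi x) = (fun x => 1 * psi x + phi x).
  by apply/funext => x; rewrite mul1r.
have L3 : L2 (pi t) (fun x => 1 * psi x + phi x) by exact: L2_lin.
rewrite e Bf_linl// !Bf_linr// !mul1r (BfC t phi psi) /=.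
by field.
Qed.

Lemma Dop_L2_add r k phi : L2 (pi (r + k.+1)) phi -> L2 (pi (r + k)) (D (r + k.+1) phi).
Proof. by rewrite addnS; exact: Dop_L2. Qed.

Lemma Vc_aer r k psi phi phi' : L2 (pi r) psi -> L2 (pi (r + k)) phi -> L2 (pi (r + k)) phi' ->
  {ae pi (r + k), forall x, phi x = phi' x} -> Vc r k psi phi = Vc r k psi phi'.
Proof.
elim: k phi phi' => [|k IH] phi phi' L1.
  rewrite addn0 => L2' L3 e; rewrite !Vc0// ![Bf r psi _]BfC; exact: Bf_ael.
move=> L2' L3 e; rewrite !VcS; apply: IH => //; try exact: Dop_L2_add.
by move: L2' L3 e; rewrite addnS; exact: Dop_ae.
Qed.

Lemma Vc_linr r k c psi phi phi' :
  L2 (pi r) psi -> L2 (pi (r + k)) phi -> L2 (pi (r + k)) phi' ->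
  Vc r k psi (fun x => c * phi x + phi' x) = c * Vc r k psi phi + Vc r k psi phi'.
Proof.
elim: k phi phi' => [|k IH] phi phi' L1 L2' L3.
  rewrite addn0 in L2' L3.
  by rewrite !Vc0// ?Bf_linr//; exact: L2_lin.
rewrite !VcS -IH//; try exact: Dop_L2_add.
apply: Vc_aer => //.
- by apply: Dop_L2_add; exact: L2_lin.
- by apply: L2_lin; exact: Dop_L2_add.
- by move: L2' L3; rewrite addnS; exact: Dop_lin_ae.
Qed.

Lemma Vc_scalel r k c psi phi : L2 (pi r) psi -> L2 (pi (r + k)) phi ->
  Vc r k (fun x => c * psi x) phi = c * Vc r k psi phi.
Proof.
elim: k phi => [|k IH] phi L1 L2'.
  rewrite addn0 in L2'; rewrite !Vc0// ?Bf_scalel//; exact: L2Z.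
by rewrite !VcS IH//; exact: Dop_L2_add.
Qed.

Lemma Vc_scaler r k c psi phi : L2 (pi r) psi -> L2 (pi (r + k)) phi ->
  Vc r k psi (fun x => c * phi x) = c * Vc r k psi phi.
Proof.
elim: k phi => [|k IH] phi L1 L2'.
  rewrite addn0 in L2'; rewrite !Vc0//; last exact: L2Z.
  by rewrite BfC Bf_scalel// BfC.
have L0 := L2_cst (pi (r + k.+1)) 0.
have h0 : Vc r k.+1 psi (cst 0) = 0.
  have := Vc_linr (-1) L1 L0 L0.
  rewrite (_ : (fun x : E => -1 * cst 0 x + cst 0 x) = cst 0); last first.
    by apply/funext => x; rewrite /= mulr0 addr0.
  by rewrite mulN1r addNr.
have := Vc_linr c L1 L2' L0; rewrite h0 addr0 => <-.
by congr (Vc r k.+1 psi _); apply/funext => x; rewrite /= addr0.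
Qed.

(* Limiting variance of [\sum_(s <= t) W_s (phi s)]: conditionally on the past the last
   coordinate contributes its own variance, and its bias is folded into coordinate [t - 1]. *)
Definition fold_last (s : nat) (phi : nat -> E -> R) : nat -> E -> R :=
  fun i => if i == s then (fun x => phi s x + D s.+1 (phi s.+1) x) else phi i.

Fixpoint vq_rec (t : nat) (phi : nat -> E -> R) : R :=
  match t with
  | 0 => cov (pi 0) (phi 0%N) (phi 0%N)
  | s.+1 => cov (pi s.+1) (phi s.+1) (phi s.+1) + vq_rec s (fold_last s phi)
  end.

Fact vq_sig : {v : nat -> (nat -> E -> R) -> R |
  (forall phi : nat -> E -> R, v 0%N phi = cov (pi 0) (phi 0%N) (phi 0%N)) /\
  (forall t (phi : nat -> E -> R), v t.+1 phi = cov (pi t.+1) (phi t.+1) (phi t.+1) + v t (fold_last t phi))}.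
Proof. by exists vq_rec. Qed.

Definition vq := sval vq_sig.

Lemma vq0 (phi : nat -> E -> R) : vq 0 phi = cov (pi 0) (phi 0%N) (phi 0%N).
Proof. exact: (svalP vq_sig).1. Qed.

Lemma vqS t (phi : nat -> E -> R) :
  vq t.+1 phi = cov (pi t.+1) (phi t.+1) (phi t.+1) + vq t (fold_last t phi).
Proof. exact: (svalP vq_sig).2. Qed.

Lemma fold_last_L2 t (phi : nat -> E -> R) :
  (forall s, (s <= t.+1)%N -> L2 (pi s) (phi s)) ->
  forall s, (s <= t)%N -> L2 (pi s) (fold_last t phi s).
Proof.
move=> L s st; rewrite /fold_last; case: eqP => [->|_]; last by apply: L; exact: leqW.
by apply: L2D; [apply: L|apply/Dop_L2/L].
Qed.

(** [vq] is a sum of variances under the filters; with [Sigma_quad] this gives the positive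
    semidefiniteness of [Sigma]. *)
Lemma vq_ge0 t (phi : nat -> E -> R) : (forall s, (s <= t)%N -> L2 (pi s) (phi s)) -> 0 <= vq t phi.
Proof.
elim: t phi => [|t IH] phi L; first by rewrite vq0; apply: cov_ge0; exact: L.
by rewrite vqS; apply: addr_ge0; [apply: cov_ge0; exact: L|apply: IH; exact: fold_last_L2].
Qed.

(** Both recursions go one step back in time: the covariance with [phi t.+1] is by definition the
    covariance at time [t] with [D t.+1 (phi t.+1)], exactly the function that [fold_last] adds to
    coordinate [t]. *)
Lemma vq_sum t (phi : nat -> E -> R) : (forall s, (s <= t)%N -> L2 (pi s) (phi s)) ->
  vq t phi = \sum_(j < t.+1) (Vc j 0 (phi j) (phi j) +
    2 * \sum_(i < j) Vc i (j - i) (phi i) (phi j)).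
Proof.
elim: t phi => [|t IH] phi L.
  by rewrite big_ord1 big_ord0 mulr0 addr0 vq0 Vc0 ?Bf0//; exact: L.
have Lt := L t (leqnSn t); have LtS := L t.+1 (leqnn _); have LD := Dop_L2 LtS.
rewrite vqS IH; last exact: fold_last_L2.
rewrite [in RHS]big_ord_recr [in LHS]big_ord_recr [in RHS]big_ord_recr /=.
have -> : \sum_(j < t) (Vc j 0 (fold_last t phi j) (fold_last t phi j) +
    2 * \sum_(i < j) Vc i (j - i) (fold_last t phi i) (fold_last t phi j)) =
  \sum_(j < t) (Vc j 0 (phi j) (phi j) + 2 * \sum_(i < j) Vc i (j - i) (phi i) (phi j)).
  apply: eq_bigr => j _; rewrite {1 2 4}/fold_last ltn_eqF//; congr (_ + 2 * _).
  by apply: eq_bigr => i _; rewrite /fold_last ltn_eqF// (ltn_trans (ltn_ord i)).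
set A := \sum_(j < t) (_ + _).
have ft : fold_last t phi t = (fun x => 1 * D t.+1 (phi t.+1) x + phi t x).
  by rewrite /fold_last eqxx; apply/funext => x; rewrite mul1r addrC.
rewrite ft; set x := D t.+1 (phi t.+1) in LD *.
have -> : \sum_(i < t) Vc i (t - i) (fold_last t phi i) (fun z => 1 * x z + phi t z) =
  \sum_(i < t) Vc i (t - i) (phi i) x + \sum_(i < t) Vc i (t - i) (phi i) (phi t).
  rewrite -big_split/=; apply: eq_bigr => i _; rewrite /fold_last ltn_eqF//.
  rewrite Vc_linr ?mul1r// ?subnKC//; try exact: ltnW.
  by apply: L; apply: ltnW; apply: ltnW; rewrite ltnS.
(* The covariances with the last coordinate: those with [i < t] unroll once, and the one with
   [i = t] becomes the form [Bf t] at equal times. *)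
have -> : \sum_(i < t.+1) Vc i (t.+1 - i) (phi i) (phi t.+1) =
  \sum_(i < t) Vc i (t - i) (phi i) x + Bf t (phi t) x.
  rewrite big_ord_recr/= subSnn VcS -Vc0// addn1; congr (_ + _).
  apply: eq_bigr => i _; rewrite subSn ?(ltnW (ltn_ord i))// VcS.
  by rewrite addnS subnKC// ltnW.
have Lfx : L2 (pi t) (fun z => 1 * x z + phi t z) by exact: L2_lin.
rewrite !Vc0// Bf_linl// !Bf_linr// !mul1r (BfC t x (phi t)) BfS -/x.
ring.
Qed.

Lemma Sigma_sym t (psi : nat -> E -> R) i j : Sigma mu a0 a g t psi i j = Sigma mu a0 a g t psi j i.
Proof.
by rewrite !mxE; case: (ltngtP i j) => // /ord_inj ->.
Qed.

Lemma sym_double_sum n (S : nat -> nat -> R) : (forall i j, S i j = S j i) ->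
  \sum_(i < n) \sum_(j < n) S i j = \sum_(j < n) (S j j + 2 * \sum_(i < j) S i j).
Proof.
move=> sym; elim: n => [|n IH]; first by rewrite !big_ord0.
rewrite big_ord_recr/= [in RHS]big_ord_recr/= -IH.
under eq_bigr do rewrite big_ord_recr/=.
rewrite big_split/= big_ord_recr/=.
have -> : \sum_(i < n) S n i = \sum_(i < n) S i n by apply: eq_bigr => i _.
by ring.
Qed.

Lemma Sigma_quad t (psi : nat -> E -> R) (u : 'rV[R]_t.+1) :
  (forall s, (s <= t)%N -> L2 (pi s) (psi s)) ->
  \sum_i \sum_j u 0 i * Sigma mu a0 a g t psi i j * u 0 j =
  vq t (fun s x => u 0 (inord s) * psi s x).
Proof.
move=> L.
pose w (i : nat) : R := u 0 (inord i : 'I_t.+1).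
pose V i j := if (i <= j)%N then Vc i (j - i) (psi i) (psi j) else Vc j (i - j) (psi j) (psi i).
transitivity (\sum_(i < t.+1) \sum_(j < t.+1) w i * V i j * w j).
  apply: eq_bigr => i _; apply: eq_bigr => j _.
  by rewrite mxE /w /V !inord_val !VcE.
rewrite (@sym_double_sum t.+1 (fun i j => w i * V i j * w j)); last first.
  move=> i j; have -> : V i j = V j i by rewrite /V; case: (ltngtP i j) => // ->.
  by ring.
rewrite vq_sum; last by move=> s st; apply: L2Z; exact: L.
apply: eq_bigr => j _; have jt : (j <= t)%N by rewrite -ltnS.
congr (_ + 2 * _).
  rewrite /V leqnn subnn; rewrite Vc_scalel ?Vc_scaler ?addn0//; try exact: L.
    by rewrite mulrC mulrA.
  by apply: L2Z; exact: L.
apply: eq_bigr => i _; have ij := ltn_ord i.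
have it : (i <= t)%N by apply: leq_trans (ltnW ij) jt.
rewrite /V (ltnW ij) Vc_scalel ?Vc_scaler ?(subnKC (ltnW ij))//; try exact: L.
  by rewrite mulrAC mulrA.
by apply: L2Z; exact: L.
Qed.

End Variance.

(** * Conditionally i.i.d. variables *)

Section SubSigmaAlgebra.
Context {R : realType} {d} {Om : measurableType d} (P : probability Om R)
  (G : set (set Om)).
Hypothesis Gm : G `<=` measurable.

Lemma id_sub_measurable : measurable_fun setT (id : Om -> g_sigma_algebraType G).
Proof.
move=> _ Y mY; rewrite setTI preimage_id.
by apply: (smallest_sub _ Gm) mY; exact: sigma_algebra_measurable.
Qed.

Lemma sub_measurable_fun {d'} {T : measurableType d'} (f : Om -> T) :
  measurable_fun setT (f : g_sigma_algebraType G -> T) -> measurable_fun setT f.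
Proof. by move=> mf; exact: (measurableT_comp mf id_sub_measurable). Qed.

Hypothesis GI : setI_closed G.
Hypothesis GT : G setT.

(** Conditional expectations are determined on a generating pi-system: the measures with densities
    [r1] and [r2], seen on the sigma-algebra of [G], are finite and agree on [G], hence everywhere,
    and [Phi] is measurable for that sigma-algebra. *)
Lemma integral_pi_system (r1 r2 : Om -> R) (Phi : g_sigma_algebraType G -> \bar R) :
  measurable_fun setT r1 -> measurable_fun setT r2 ->
  (forall w, 0 <= r1 w) -> (forall w, 0 <= r2 w) ->
  (\int[P]_w (r1 w)%:E < +oo)%E ->
  (forall A, G A -> (\int[P]_(w in A) (r1 w)%:E = \int[P]_(w in A) (r2 w)%:E)%E) ->
  measurable_fun setT Phi -> (forall w, 0 <= Phi w)%E ->
  (\int[P]_w (Phi w * (r1 w)%:E) = \int[P]_w (Phi w * (r2 w)%:E))%E.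
Proof.
move=> m1 m2 r10 r20 r1y eqG mPhi Phi0.
pose n1 := imageM (densM P m1 r10) id_sub_measurable.
pose n2 := imageM (densM P m2 r20) id_sub_measurable.
have eqn A : measurable A -> n1 A = n2 A.
  apply: (@measure_unique _ _ (g_sigma_algebraType G) G (fun=> setT)) => //.
  by rewrite bigcup_const.
have IE (r : Om -> R) (mr : measurable_fun setT r) (r0 : forall w, 0 <= r w) :
    (\int[imageM (densM P mr r0) id_sub_measurable]_w Phi w = \int[P]_w (Phi w * (r w)%:E))%E.
  rewrite (ge0_integral_pushforward id_sub_measurable)//= preimage_setT.
  have mPhi' : measurable_fun setT (Phi : Om -> \bar R) := sub_measurable_fun mPhi.
  exact: (@ge0_integral_density _ _ _ P r mr r0 (densM P mr r0) (fun _ _ => erefl) Phi mPhi' Phi0).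
rewrite -(IE r1 m1 r10) -(IE r2 m2 r20).
by apply: eq_measure_integral => A mA _; exact: eqn.
Qed.

End SubSigmaAlgebra.

Section Conditional.
Context {R : realType} {d} {Om : measurableType d} (P : probability Om R)
  (G : set (set Om)) {dE} {E : measurableType dE}
  (mu : {sigma_finite_measure set E -> \bar R}) (xi : Om -> E) (q : Om -> E -> R).
Hypothesis Gm : G `<=` measurable.
Hypothesis GI : setI_closed G.
Hypothesis GT : G setT.
Hypothesis mxi : measurable_fun setT xi.
Hypothesis mq : measurable_fun setT (fun z : g_sigma_algebraType G * E => q z.1 z.2).
Hypothesis q0 : forall w x, 0 <= q w x.
Hypothesis q1 : forall w, (\int[mu]_x (q w x)%:E = 1)%E.
Hypothesis condG : forall A B, G A -> measurable B ->
  P (A `&` xi @^-1` B) = (\int[P]_(w in A) \int[mu]_(x in B) (q w x)%:E)%E.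

Let mqE : measurable_fun setT (fun z : g_sigma_algebraType G * E => (q z.1 z.2)%:E).
Proof. exact/measurable_EFinP. Qed.

Let mqx w : measurable_fun setT (q w).
Proof. exact: (measurable_fun_pair2 (w : g_sigma_algebraType G) mq). Qed.

Let KB (B : set E) (w : Om) : R := fine (\int[mu]_(x in B) (q w x)%:E).

Let KB_fin B w : measurable B -> (\int[mu]_(x in B) (q w x)%:E = (KB B w)%:E)%E.
Proof.
move=> mB; rewrite /KB fineK// ge0_fin_numE; last by apply: integral_ge0 => x _; rewrite lee_fin.
apply: (@le_lt_trans _ _ (\int[mu]_x (q w x)%:E)%E); last by rewrite q1 ltry.
apply: ge0_subset_integral => //; first exact/measurable_EFinP.
by move=> x _; rewrite lee_fin.
Qed.

Let KB_ge0 B w : 0 <= KB B w.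
Proof. by apply: fine_ge0; apply: integral_ge0 => x _; rewrite lee_fin. Qed.

Let KB_m B : measurable B -> measurable_fun setT (KB B : g_sigma_algebraType G -> R).
Proof.
move=> mB; apply: measurableT_comp => //.
under eq_fun do rewrite integral_mkcond.
pose f (z : g_sigma_algebraType G * E) := ((q z.1 z.2)%:E * (\1_B z.2)%:E)%E.
have mf : measurable_fun setT f.
  by apply: emeasurable_funM => //; apply/measurable_EFinP; apply: measurableT_comp.
have f0 z : (0 <= f z)%E by rewrite mule_ge0// lee_fin.
have := @measurable_fun_fubini_tonelli_F _ _ _ _ _ mu f mf f0.
apply: eq_measurable_fun => w _; rewrite /fubini_F; apply: eq_integral => x _.
by rewrite /f patchE indicE/=; case: ifP => _; rewrite ?mule1 ?mule0.
Qed.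

(** Disintegration: on the product of the sub-sigma-algebra with [E], the law of [(w, xi w)] has
    density [q] with respect to [P] times [mu]. The hypothesis gives this for [A] in [G]; two
    uniqueness arguments extend it. *)
Lemma integral_cond (Psi : g_sigma_algebraType G * E -> \bar R) :
  measurable_fun setT Psi -> (forall z, 0 <= Psi z)%E ->
  (\int[P]_w Psi (w, xi w) = \int[P]_w \int[mu]_x (Psi (w, x) * (q w x)%:E))%E.
Proof.
move=> mPsi Psi0.
pose PG := imageM P (id_sub_measurable Gm).
have PG1 : (\int[PG]_x (cst 1 x : R)%:E = 1)%E.
  rewrite [LHS](integral_cst PG measurableT 1%E).
  by rewrite mul1e /PG/= /pushforward preimage_setT probability_setT.
(* The constant density 1 only equips the restriction of [P] with a probability structure, for the
   product with [mu]. *)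
pose PGp := densP (@measurable_cst _ _ _ _ setT (1 : R)) (fun=> ler01) PG1.
have intPG (h : g_sigma_algebraType G -> \bar R) : measurable_fun setT h -> (forall w, 0 <= h w)%E ->
    (\int[PGp]_w h w = \int[P]_w h w)%E.
  move=> mh h0.
  rewrite (@ge0_integral_density _ _ _ PG (cst 1) (@measurable_cst _ _ _ _ setT (1 : R)) (fun=> ler01) PGp (fun _ _ => erefl))//.
  under eq_integral do rewrite mule1.
  by rewrite (ge0_integral_pushforward (id_sub_measurable Gm)).
pose pr (w : Om) : g_sigma_algebraType G * E := (w, xi w).
have mpr : measurable_fun setT pr.
  apply/measurable_fun_pairP; split; [exact: id_sub_measurable|exact: mxi].
pose nu1 := imageM P mpr.
pose q' (z : g_sigma_algebraType G * E) := q z.1 z.2.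
have q'0 z : 0 <= q' z by exact: q0.
pose nu2 := densM (PGp \x mu)%E mq q'0.
have I2 (h : g_sigma_algebraType G * E -> \bar R) : measurable_fun setT h -> (forall w, 0 <= h w)%E ->
    (\int[nu2]_z h z = \int[P]_w \int[mu]_x (h (w, x) * (q w x)%:E))%E.
  move=> mh h0; rewrite (@ge0_integral_density _ _ _ (PGp \x mu)%E q' mq q'0 nu2 (fun _ _ => erefl))//.
  have mhq : measurable_fun setT (fun z => h z * (q' z)%:E)%E by exact: emeasurable_funM.
  have hq0 z : (0 <= h z * (q' z)%:E)%E by rewrite mule_ge0// lee_fin.
  rewrite fubini_tonelli1//= intPG//.
    exact: measurable_fun_fubini_tonelli_F.
  by move=> w; apply: integral_ge0 => x _; exact: (hq0 (w, x)).
(* First extension, at fixed [B]: from the pi-system to its sigma-algebra. The second one, from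
   rectangles to all measurable sets, ends the proof. *)
have eqrect A B : measurable (A : set (g_sigma_algebraType G)) -> measurable B -> nu1 (A `*` B) = nu2 (A `*` B).
  move=> mA mB.
  have mA' : measurable (A : set Om) by have := id_sub_measurable Gm measurableT mA; rewrite setTI.
  have mxB : measurable (xi @^-1` B) by rewrite -[X in measurable X]setTI; exact: mxi.
  have -> : nu2 (A `*` B) = (\int[P]_w ((\1_A w)%:E * (KB B w)%:E))%E.
    have mAB : measurable (A `*` B) by exact: measurableX.
    rewrite -[A `*` B]setIT -(integral_indic nu2 measurableT mAB) I2//; last first.
      by apply/measurable_EFinP; exact: measurable_indic.
    apply: eq_integral => w _; rewrite -KB_fin//.
    have e x : \1_(A `*` B) (w, x) = \1_A w * \1_B x :> R.
      by rewrite !indicE in_setX -natrM mulnb.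
    under eq_integral => x _ do rewrite e EFinM -muleA.
    rewrite ge0_integralZl//=; last 2 first.
    - apply: emeasurable_funM; last exact/measurable_EFinP.
      by apply/measurable_EFinP; exact: measurable_indic.
    - by move=> x _; rewrite mule_ge0 ?lee_fin.
    congr (_ * _)%E; rewrite [RHS]integral_mkcond; apply: eq_integral => x _.
    by rewrite patchE indicE/=; case: ifP => _; rewrite ?mul1e ?mul0e.
  transitivity (\int[P]_w ((\1_A w)%:E * (\1_(xi @^-1` B) w)%:E))%E.
    have -> : nu1 (A `*` B) = P (A `&` xi @^-1` B) by [].
    rewrite -[A `&` _]setIT -integral_indic//; last exact: measurableI.
    by apply: eq_integral => w _; rewrite indicI EFinM.
  apply: (integral_pi_system Gm GI GT (Phi := fun w => (\1_A w)%:E)) => //.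
  - exact: (sub_measurable_fun Gm (KB_m mB)).
  - rewrite integral_indic// (le_lt_trans (probability_le1 P _)) ?ltry// setIT//.
  - move=> A' GA'; have mA'' := Gm GA'.
    transitivity (P (A' `&` xi @^-1` B)); first by rewrite integral_indic// setIC.
    rewrite (condG GA' mB).
    by apply: eq_integral => w _; rewrite KB_fin.
  - by apply/measurable_EFinP; exact: measurable_indic.
transitivity (\int[nu1]_z Psi z)%E.
  by rewrite (ge0_integral_pushforward mpr)//= preimage_setT.
rewrite -I2//; apply: eq_measure_integral => A mA _.
apply: (@measure_unique _ _ _ [set A `*` B | A in measurable & B in measurable] (fun=> setT)) => //.
- exact: measurable_prod_measurableType.
- move=> X Y [A1 mA1 [B1 mB1 <-]] [A2 mA2 [B2 mB2 <-]].
  exists (A1 `&` A2); first exact: measurableI.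
  by exists (B1 `&` B2); [exact: measurableI|rewrite setXI].
- by move=> _; exists setT => //; exists setT => //; rewrite setXTT.
- by rewrite bigcup_const.
- by move=> X [A1 mA1 [B1 mB1 <-]]; exact: eqrect.
- by move=> _; rewrite /nu1/= /pushforward preimage_setT probability_setT ltry.
Qed.

End Conditional.

(** * Moment and cosine estimates given the past *)

Section CondIid.
Context {R : realType} {d} {Om : measurableType d} (P : probability Om R) (N : nat)
  {dE} {E : measurableType dE} (xi : nat -> Om -> E) (G : nat -> set (set Om))
  (K : Om -> probability E R).
Local Notation Om_ k := (g_sigma_algebraType (G k)).

(* Conditionally on the sigma-algebra of [G 0], the variables [xi k] with [k < N]
   are i.i.d. with law [K w]; [G k] additionally records [xi 0, ..., xi k.-1]. *)
Record cond_iid : Prop := CondIid {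
  ci_sub : forall k, G k `<=` measurable;
  ci_mono : forall k, measurable_fun setT (id : Om_ k -> Om_ 0);
  ci_xi : forall k j, (j < k)%N -> measurable_fun setT (xi j : Om_ k -> E);
  ci_K : forall k (Psi : Om_ k * E -> \bar R), measurable_fun setT Psi ->
    (forall z, 0 <= Psi z)%E ->
    measurable_fun setT (fun w : Om_ k => \int[K w]_x Psi (w, x))%E;
  ci_cond : forall k, (k < N)%N -> forall Psi : Om_ k * E -> \bar R, measurable_fun setT Psi ->
    (forall z, 0 <= Psi z)%E ->
    (\int[P]_w Psi (w, xi k w) = \int[P]_w \int[K w]_x Psi (w, x))%E }.

Hypothesis H : cond_iid.

Lemma ci_xiT j : measurable_fun setT (xi j).
Proof. exact: (sub_measurable_fun (ci_sub H (k := j.+1)) (ci_xi H (leqnn j.+1))). Qed.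

Lemma ci_meas0 {d'} {T : measurableType d'} (f : Om -> T) :
  measurable_fun setT (f : Om_ 0 -> T) -> measurable_fun setT f.
Proof. exact: (sub_measurable_fun (ci_sub H (k := 0%N))). Qed.

Lemma ci_meas0k k {d'} {T : measurableType d'} (f : Om -> T) :
  measurable_fun setT (f : Om_ 0 -> T) -> measurable_fun setT (f : Om_ k -> T).
Proof. by move=> mf; have := @measurableT_comp _ _ _ (Om_ k) (Om_ 0) T f setT id mf (ci_mono H (k := k)). Qed.

Lemma ci_measS (S : set Om) : measurable (S : set (Om_ 0)) -> measurable S.
Proof. by move=> mS; have := id_sub_measurable (ci_sub H (k := 0%N)) measurableT mS; rewrite setTI. Qed.

Lemma ci_indic (S : set Om) : measurable (S : set (Om_ 0)) -> measurable_fun setT (\1_S : Om_ 0 -> R).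
Proof. by move=> mS; exact: measurable_indic. Qed.

Lemma ci_K0 (h : E -> \bar R) : measurable_fun setT h -> (forall x, 0 <= h x)%E ->
  measurable_fun setT (fun w : Om_ 0 => \int[K w]_x h x)%E.
Proof.
move=> mh h0; apply: (ci_K H (Psi := fun z : Om_ 0 * E => h z.2)) => //.
exact: measurableT_comp.
Qed.

Lemma ci_KR (h : E -> R) : measurable_fun setT h ->
  measurable_fun setT (fun w : Om_ 0 => \int[K w]_x h x).
Proof.
move=> mh; apply: measurableT_comp => //.
under eq_fun do rewrite integralE.
have mhE : measurable_fun setT (fun x => (h x)%:E) by exact/measurable_EFinP.
apply: emeasurable_funB; apply: ci_K0 => //; [exact: measurable_funepos|exact: measurable_funeneg].
Qed.

Lemma ci_KR_bounded k (Psi : Om_ k * E -> R) (c : R) : measurable_fun setT Psi ->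
  (forall z, `|Psi z| <= c) ->
  measurable_fun setT (fun w : Om_ k => \int[K w]_x Psi (w, x)).
Proof.
move=> mPsi Psic; apply: measurableT_comp => //.
under eq_fun do rewrite integralE.
have mhE : measurable_fun setT (fun z => (Psi z)%:E) by exact/measurable_EFinP.
apply: emeasurable_funB.
- have := ci_K H (measurable_funepos mhE) (fun z => funepos_ge0 _ z).
  by apply: eq_measurable_fun => w _; apply: eq_integral => x _; rewrite !funeposE.
- have := ci_K H (measurable_funeneg mhE) (fun z => funeneg_ge0 _ z).
  by apply: eq_measurable_fun => w _; apply: eq_integral => x _; rewrite !funenegE.
Qed.

Lemma cond_bounded k (Psi : Om_ k * E -> R) (c : R) : (k < N)%N -> measurable_fun setT Psi ->
  (forall z, `|Psi z| <= c) ->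
  \int[P]_w Psi (w, xi k w) = \int[P]_w \int[K w]_x Psi (w, x).
Proof.
move=> kN mPsi Psic.
have mpr : measurable_fun setT (fun w : Om => (w, xi k w) : Om_ k * E).
  by apply/measurable_fun_pairP; split; [exact: (id_sub_measurable (ci_sub H (k := k)))|exact: ci_xiT].
have m1 : measurable_fun setT (fun w : Om => Psi (w, xi k w)) by exact: measurableT_comp mPsi mpr.
have mw w : measurable_fun setT (fun x => Psi (w, x)) by exact: (measurable_fun_pair2 (w : Om_ k) mPsi).
have m2 : measurable_fun setT (fun w => \int[K w]_x Psi (w, x)).
  exact: (sub_measurable_fun (ci_sub H (k := k)) (ci_KR_bounded mPsi Psic)).
have b2 w : `|\int[K w]_x Psi (w, x)| <= c by exact: Rintegral_bounded_le (mw w) (fun x => Psic (w, x)).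
have b1 w : `|Psi (w, xi k w)| <= c by exact: Psic.
have shift d' (T : measurableType d') (Q : probability T R) (f : T -> R) : measurable_fun setT f ->
    (forall x, `|f x| <= c) -> (\int[Q]_x (f x + c)%:E = (\int[Q]_x f x + c)%:E)%E.
  move=> mf fc; rewrite (@integral_EFin_bounded _ _ _ Q _ (c + `|c|)); last 2 first.
  - exact: measurable_funD.
  - by move=> x; apply: (le_trans (ler_normD _ _)); rewrite lerD.
  congr (_%:E); rewrite RintegralD ?Rintegral_prob_cst//.
  - exact: bounded_integrable mf fc.
  - by apply: (@bounded_integrable _ _ _ Q (cst c) `|c|).
have P0 z : (0 <= (Psi z + c)%:E)%E by rewrite lee_fin; have := Psic z; rewrite ler_norml; lra.
have mPc : measurable_fun setT (fun z => (Psi z + c)%:E).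
  by apply/measurable_EFinP; exact: measurable_funD.
have := ci_cond H kN mPc P0; rewrite (shift _ _ P _ m1 b1).
under eq_integral => w _ do rewrite (shift _ _ (K w) _ (mw w) (fun x => Psic (w, x))).
by rewrite (shift _ _ P _ m2 b2) => -[] /addIr.
Qed.

Lemma ci_partial_sum k (f : Om_ 0 * E -> R) : measurable_fun setT f ->
  measurable_fun setT (fun w : Om_ k => \sum_(j < k) f (w, xi j w)).
Proof.
move=> mf; apply: measurable_sum => j; apply: (measurableT_comp mf).
apply/measurable_fun_pairP; split; first exact: ci_mono.
exact: ci_xi.
Qed.

(** Conditional variance of a sum, adding one variable at a time: given [G n] the new centered term
    has mean zero, which removes the cross term. The past event [S] selects the kernels with finite
    second moment. *)
Lemma cond_second_moment (psi : E -> R) (S : set Om) n : measurable_fun setT psi ->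
  measurable (S : set (Om_ 0)) -> (forall w, S w -> L2 (K w) psi) -> (n <= N)%N ->
  (\int[P]_w ((\1_S w)%:E * ((\sum_(k < n) (psi (xi k w) - \int[K w]_x psi x)) ^+ 2)%:E) =
   n%:R%:E * \int[P]_w ((\1_S w)%:E * \int[K w]_x ((psi x - \int[K w]_z psi z) ^+ 2)%:E))%E.
Proof.
move=> mpsi mS SL.
pose b (w : Om) := \int[K w]_x psi x.
have mb : measurable_fun setT (b : Om_ 0 -> R) by exact: ci_KR.
pose f (z : Om_ 0 * E) := psi z.2 - b z.1.
have mf : measurable_fun setT f by apply: measurable_funB; exact: measurableT_comp.
pose V (w : Om) := (\int[K w]_x ((psi x - b w) ^+ 2)%:E)%E.
have V0 w : (0 <= V w)%E by apply: integral_ge0 => x _; rewrite lee_fin sqr_ge0.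
have mV : measurable_fun setT (V : Om_ 0 -> \bar R).
  apply: (ci_K H (Psi := fun z : Om_ 0 * E => (f z ^+ 2)%:E)).
  - by apply/measurable_EFinP; exact: measurable_funX.
  - by move=> z; rewrite lee_fin sqr_ge0.
have mI := ci_indic mS.
have mIV : measurable_fun setT (fun w : Om => (\1_S w)%:E * V w)%E.
  apply: ci_meas0; apply: emeasurable_funM => //; exact/measurable_EFinP.
have IV0 w : (0 <= (\1_S w)%:E * V w)%E by rewrite mule_ge0// lee_fin.
elim: n => [|n IH] nN.
  rewrite mul0e; apply: integral0_eq => w _; by rewrite big_ord0 expr0n/= mule0.
pose T w := \sum_(k < n) f (w, xi k w).
have mT : measurable_fun setT (T : Om_ n -> R) by exact: ci_partial_sum.
pose Psi (z : Om_ n * E) := ((\1_S z.1)%:E * ((T z.1 + f z) ^+ 2)%:E)%E.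
have mPsi : measurable_fun setT Psi.
  apply: emeasurable_funM; apply/measurable_EFinP.
    by apply: measurableT_comp => //; exact: ci_meas0k mI.
  apply: measurable_funX; apply: measurable_funD; first exact: measurableT_comp.
  apply: measurable_funB; first exact: measurableT_comp.
  have mbn : measurable_fun setT (b : Om_ n -> R) := ci_meas0k (k := n) mb.
  exact: (measurableT_comp mbn (@measurable_fst _ _ (Om_ n) E)).
have Psi0 z : (0 <= Psi z)%E by rewrite mule_ge0// lee_fin ?sqr_ge0.
transitivity (\int[P]_w Psi (w, xi n w))%E.
  by apply: eq_integral => w _; rewrite /Psi/= big_ord_recr.
rewrite (ci_cond H nN mPsi Psi0).
transitivity (\int[P]_w ((\1_S w)%:E * (T w ^+ 2)%:E + (\1_S w)%:E * V w))%E.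
  apply: eq_integral => w _; rewrite /Psi/=.
  rewrite ge0_integralZl//; last 2 first.
  - apply/measurable_EFinP; apply: measurable_funX; apply: measurable_funD => //.
    exact: (measurable_fun_pair2 (w : Om_ 0) mf).
  - by move=> x _; rewrite lee_fin sqr_ge0.
  have [Sw|nSw] := pselect (S w); last first.
    by rewrite indicE memNset// !mul0e adde0.
  rewrite indicE mem_set// !mul1e; have Lw := SL _ Sw.
  have Lc := L2B_cst (b w) Lw.
  have iC := L2_integrable Lc.
  have I0 : \int[K w]_x (psi x - b w) = 0.
    rewrite RintegralB//; first by rewrite Rintegral_prob_cst subrr.
    - exact: L2_integrable.
    - exact: L2_integrable (L2_cst _ _).
  have LT := L2D (L2_cst (K w) (T w)) Lc.
  rewrite /V (integral_ltyE (L2_sqr_integrable Lc)) (integral_ltyE (L2_sqr_integrable LT)).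
  rewrite -EFinD; congr (_%:E).
  transitivity (\int[K w]_x ((psi x - b w) ^+ 2 + (2 * T w * (psi x - b w) + T w ^+ 2))).
    by apply: eq_Rintegral => x _; rewrite /=; ring.
  rewrite RintegralD//; last 2 first.
  - exact: L2_sqr_integrable.
  - apply: real_integrableD; first exact: real_integrableZl.
    exact: L2_integrable (L2_cst _ _).
  rewrite RintegralD//; last 2 first.
  - exact: real_integrableZl.
  - exact: L2_integrable (L2_cst _ _).
  by rewrite RintegralZl// I0 mulr0 add0r Rintegral_prob_cst addrC.
have mT2 : measurable_fun setT (fun w => (\1_S w)%:E * (T w ^+ 2)%:E)%E.
  apply: emeasurable_funM; apply/measurable_EFinP; first exact: ci_meas0 mI.
  by apply: measurable_funX; exact: (sub_measurable_fun (ci_sub H (k := n)) mT).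
rewrite ge0_integralD//; last by move=> w _; rewrite mule_ge0// lee_fin ?sqr_ge0.
rewrite (IH (ltnW nN)) -natr1 EFinD ge0_muleDl ?mul1e ?lee_fin//.
Qed.

(** The moment bound is asked of the random kernel at [w]. It defines an event of the past that
    contains the exceptional set [B], so the probability of [B] is bounded unconditionally. *)
Lemma cond_chebyshev (psi : E -> R) (c r : R) : measurable_fun setT psi -> 0 < r -> 0 <= c ->
  exists B, [/\ measurable B, (P B <= (N%:R * c / r ^+ 2)%:E)%E &
    forall w, ~ B w -> (\int[K w]_x (psi x ^+ 2)%:E <= c%:E)%E ->
      `|\sum_(k < N) psi (xi k w) - N%:R * \int[K w]_x psi x| <= r].
Proof.
move=> mpsi r0 c0.
pose b (w : Om) := \int[K w]_x psi x.
have mb : measurable_fun setT (b : Om_ 0 -> R) by exact: ci_KR.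
have msq : measurable_fun setT (fun x => (psi x ^+ 2)%:E) by apply/measurable_EFinP; exact: measurable_funX.
have sq0 x : (0 <= (psi x ^+ 2)%:E)%E by rewrite lee_fin sqr_ge0.
pose S := [set w | (\int[K w]_x (psi x ^+ 2)%:E <= c%:E)%E].
have mS : measurable (S : set (Om_ 0)).
  have := emeasurable_fun_infty_c measurableT (ci_K0 msq sq0) c%:E.
  by rewrite setTI.
have SL w : S w -> L2 (K w) psi by move=> Sw; split => //; apply: le_lt_trans Sw (ltry _).
pose T w := \sum_(k < N) (psi (xi k w) - b w).
have mT : measurable_fun setT T.
  apply: measurable_sum => k; apply: measurable_funB; last exact: ci_meas0 mb.
  by apply: measurableT_comp => //; exact: ci_xiT.
have TE w : T w = \sum_(k < N) psi (xi k w) - N%:R * b w.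
  by rewrite /T sumrB sumr_const card_ord mulr_natl.
have mT2 : measurable_fun setT (fun w => (\1_S w)%:E * (T w ^+ 2)%:E)%E.
  apply: emeasurable_funM; apply/measurable_EFinP; first exact: ci_meas0 (ci_indic mS).
  exact: measurable_funX.
have T20 w : (0 <= (\1_S w)%:E * (T w ^+ 2)%:E)%E by rewrite mule_ge0// lee_fin ?sqr_ge0.
pose B := S `&` [set w | r < `|T w|].
have mB : measurable B.
  apply: measurableI; first exact: ci_measS.
  rewrite (_ : [set w | _] = (Num.norm \o T) @^-1` `]r, +oo[%classic).
    by rewrite -[X in measurable X]setTI; apply: measurableT_comp.
  by apply/seteqP; split => w /=; rewrite in_itv/= andbT.
exists B; split => //; last first.
  by move=> w nB Sw; rewrite -TE leNgt; apply/negP => h; apply: nB; split.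
rewrite EFinM lee_pdivlMr ?exprn_gt0// muleC.
apply: (@le_trans _ _ (\int[P]_w ((\1_S w)%:E * (T w ^+ 2)%:E))%E).
  rewrite -[B]setIT -integral_indic// -ge0_integralZl//; last 2 first.
  - by apply/measurable_EFinP; exact: measurable_indic.
  - by rewrite lee_fin sqr_ge0.
  apply: ge0_le_integral => //.
  - by move=> w _; rewrite mule_ge0// lee_fin ?sqr_ge0.
  - by apply: emeasurable_funM => //; apply/measurable_EFinP; exact: measurable_indic.
  move=> w _; have [[Sw Tw]|nB] := pselect (B w); last first.
    by rewrite [\1_B w]indicE memNset// mule0.
  rewrite !indicE !mem_set// mule1 mul1e lee_fin -[T w ^+ 2]real_normK ?num_real//.
  by rewrite lerXn2r ?nnegrE ?(ltW r0) ?normr_ge0//; exact: ltW Tw.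
rewrite (cond_second_moment mpsi mS SL (leqnn N)) EFinM lee_wpmul2l//.
apply: (@le_trans _ _ (\int[P]_w (cst c w)%:E)%E); last first.
  by rewrite [leLHS](integral_cst P measurableT c%:E) -[X in (_ <= X)%E]mule1 lee_wpmul2l ?probability_le1.
apply: ge0_le_integral => //.
- by move=> w _; rewrite mule_ge0// ?lee_fin// integral_ge0// => x _; rewrite lee_fin sqr_ge0.
- apply: emeasurable_funM; first by apply/measurable_EFinP; exact: ci_meas0 (ci_indic mS).
  apply: ci_meas0.
  apply: (ci_K H (Psi := fun z : Om_ 0 * E => ((psi z.2 - b z.1) ^+ 2)%:E)).
  + by apply/measurable_EFinP; apply: measurable_funX; apply: measurable_funB; exact: measurableT_comp.
  + by move=> z; rewrite lee_fin sqr_ge0.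
- by apply/measurable_EFinP.
- move=> w _; have [Sw|nSw] := pselect (S w); last first.
    by rewrite indicE memNset// mul0e lee_fin.
  rewrite indicE mem_set// mul1e; have Lw := SL _ Sw.
  apply: (le_trans _ Sw); rewrite (integral_sqr_centered Lw) (integral_ltyE (L2_sqr_integrable Lw)).
  by rewrite lee_fin /cov -expr2 lerBlDr; rewrite lerDl sqr_ge0.
Qed.

Lemma cond_markov (h : E -> R) (c r : R) : measurable_fun setT h -> (forall x, 0 <= h x) ->
  0 < r -> 0 <= c ->
  exists B, [/\ measurable B, (P B <= (N%:R * c / r)%:E)%E &
    forall w, ~ B w -> (\int[K w]_x (h x)%:E <= c%:E)%E -> \sum_(k < N) h (xi k w) <= r].
Proof.
move=> mh h0 r0 c0.
have mhE : measurable_fun setT (fun x => (h x)%:E) by exact/measurable_EFinP.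
have hE0 x : (0 <= (h x)%:E)%E by rewrite lee_fin.
pose S := [set w | (\int[K w]_x (h x)%:E <= c%:E)%E].
have mS : measurable (S : set (Om_ 0)).
  have := emeasurable_fun_infty_c measurableT (ci_K0 mhE hE0) c%:E.
  by rewrite setTI.
have mI := ci_indic mS.
pose T w := \sum_(k < N) h (xi k w).
have T0 w : 0 <= T w by exact: sumr_ge0.
have mT : measurable_fun setT T.
  by apply: measurable_sum => k; apply: measurableT_comp => //; exact: ci_xiT.
pose B := S `&` [set w | r < T w].
have mB : measurable B.
  apply: measurableI; first exact: ci_measS.
  rewrite (_ : [set w | _] = T @^-1` `]r, +oo[%classic).
    by rewrite -[X in measurable X]setTI; apply: mT.
  by apply/seteqP; split => w /=; rewrite in_itv/= andbT.
exists B; split => //; last first.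
  by move=> w nB Sw; rewrite leNgt; apply/negP => Tw; apply: nB; split.
rewrite EFinM lee_pdivlMr// muleC.
apply: (@le_trans _ _ (\int[P]_w ((\1_S w)%:E * (T w)%:E))%E).
  rewrite -[B]setIT -integral_indic// -ge0_integralZl//; last 2 first.
  - by apply/measurable_EFinP; exact: measurable_indic.
  - by rewrite lee_fin ltW.
  apply: ge0_le_integral => //.
  - by move=> w _; rewrite mule_ge0// lee_fin ?ltW.
  - by apply: emeasurable_funM => //; apply/measurable_EFinP; exact: measurable_indic.
  - by apply: emeasurable_funM; apply/measurable_EFinP => //; exact: ci_meas0 mI.
  move=> w _; have [[Sw Tw]|nB] := pselect (B w); last first.
    by rewrite [\1_B w]indicE memNset// mule0 mule_ge0// lee_fin.
  by rewrite !indicE !mem_set// mule1 mul1e lee_fin ltW.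
have -> : (\int[P]_w ((\1_S w)%:E * (T w)%:E) =
           \int[P]_w \sum_(k < N) ((\1_S w)%:E * (h (xi k w))%:E))%E.
  apply: eq_integral => w _; by rewrite /T -sumEFin ge0_sume_distrr.
rewrite ge0_integral_sum//; last 2 first.
- move=> k; apply: emeasurable_funM; apply/measurable_EFinP; first exact: ci_meas0 mI.
  by apply: measurableT_comp => //; exact: ci_xiT.
- by move=> k w _; rewrite mule_ge0// lee_fin.
apply: (@le_trans _ _ (\sum_(k < N) c%:E)%E); last first.
  by rewrite sumEFin sumr_const card_ord mulr_natl.
apply: lee_sum => k _.
pose Psi (z : Om_ k * E) := ((\1_S z.1)%:E * (h z.2)%:E)%E.
have mPsi : measurable_fun setT Psi.
  apply: emeasurable_funM; apply/measurable_EFinP; last exact: measurableT_comp.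
  by apply: measurableT_comp => //; exact: ci_meas0k mI.
have Psi0 z : (0 <= Psi z)%E by rewrite mule_ge0// lee_fin.
rewrite [leLHS](ci_cond H (ltn_ord k) mPsi Psi0).
apply: (@le_trans _ _ (\int[P]_w (cst c w)%:E)%E); last first.
  by rewrite [leLHS](integral_cst P measurableT c%:E) -[X in (_ <= X)%E]mule1 lee_wpmul2l ?probability_le1.
apply: ge0_le_integral => //.
- by move=> w _; exact: integral_ge0.
- exact: (sub_measurable_fun (ci_sub H (k := k)) (ci_K H mPsi Psi0)).
- by apply/measurable_EFinP.
- move=> w _; rewrite /Psi/= ge0_integralZl//.
  have [Sw|nSw] := pselect (S w); last by rewrite indicE memNset// mul0e lee_fin.
  by rewrite indicE mem_set// mul1e.
Qed.

(** The variables are replaced one at a time: given the past and the previous ones, integrating out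
    the last variable costs [e] and yields one factor [exp (- v w)]. *)
Lemma cond_cos (A v : Om -> R) (beta : Om_ 0 * E -> R) (S : set Om) (e : R) : 0 <= e ->
  measurable_fun setT (A : Om_ 0 -> R) -> measurable_fun setT (v : Om_ 0 -> R) ->
  (forall w, 0 <= v w) -> measurable_fun setT beta -> measurable (S : set (Om_ 0)) ->
  (forall w, S w -> forall al, `|\int[K w]_x cos (al + beta (w, x)) - expR (- v w) * cos al| <= e) ->
  `|\int[P]_w (\1_S w * cos (A w + \sum_(k < N) beta (w, xi k w))) -
    \int[P]_w (\1_S w * (expR (- (N%:R * v w)) * cos (A w)))| <= N%:R * e.
Proof.
move=> e0 mA mv v0 mbeta mS bnd.
have mI := ci_indic mS.
have mcos d' (T : measurableType d') (f : T -> R) : measurable_fun setT f -> measurable_fun setT (cos \o f).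
  by move=> mf; exact: measurableT_comp (@measurable_cosT R) mf.
have cb x : `|cos x| <= 1 :> R by rewrite ler_norml cos_geN1 cos_le1.
have eb j w : 0 <= expR (- (j%:R * v w)) <= 1.
  by rewrite expR_ge0/= -[leRHS](@expR0 R) ler_expR oppr_le0 mulr_ge0.
have prod1 (x y z : R) : `|x| <= 1 -> 0 <= y <= 1 -> `|z| <= 1 -> `|x * (y * z)| <= 1.
  move=> hx /andP[y0 y1] hz; rewrite !normrM (ger0_norm y0).
  by apply: mulr_ile1 => //; [exact: mulr_ge0|exact: mulr_ile1].
have Ib w : `|\1_S w : R| <= 1 by rewrite ger0_norm// indicE; case: (_ \in _) => /=.
pose T k w := \sum_(j < k) beta (w, xi j w).
(* Hybrid in which the first [k] variables are kept and the other [N - k] are replaced by their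
   factors; the two sides are [Q N] and [Q 0], and the difference of integrals telescopes. *)
pose Q k w := \1_S w * (expR (- ((N - k)%:R * v w)) * cos (A w + T k w)).
have mT k : measurable_fun setT (T k : Om_ k -> R) by exact: ci_partial_sum.
have mE k j : measurable_fun setT ((fun w => expR (- (j%:R * v w))) : Om_ k -> R).
  apply: measurableT_comp => //; apply: measurableT_comp => //; apply: measurable_funM => //.
  exact: ci_meas0k.
have mQ k : measurable_fun setT (Q k).
  apply: (sub_measurable_fun (ci_sub H (k := k))).
  apply: measurable_funM; first exact: ci_meas0k.
  apply: measurable_funM; first exact: mE.
  by apply: mcos; apply: measurable_funD => //; exact: ci_meas0k.
have Qb k w : `|Q k w| <= 1 by exact: prod1.
have step k : (k < N)%N -> `|\int[P]_w Q k.+1 w - \int[P]_w Q k w| <= e.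
  move=> kN.
  pose Psi (z : Om_ k * E) := \1_S z.1 * (expR (- ((N - k.+1)%:R * v z.1)) *
    cos (A z.1 + T k z.1 + beta z)).
  have mPsi : measurable_fun setT Psi.
    apply: measurable_funM; first by apply: measurableT_comp => //; exact: ci_meas0k mI.
    apply: measurable_funM; first exact: (measurableT_comp (mE k (N - k.+1)%N)).
    apply: mcos; apply: measurable_funD; last first.
      apply: (measurableT_comp mbeta); apply/measurable_fun_pairP; split; last exact: measurable_snd.
      exact: (@measurableT_comp _ _ _ (Om_ k * E)%type (Om_ k) (Om_ 0) id setT fst (ci_mono H (k := k)) measurable_fst).
    apply: measurable_funD; last exact: (measurableT_comp (mT k)).
    exact: (measurableT_comp (ci_meas0k (k := k) mA)).
  have Psib z : `|Psi z| <= 1 by exact: prod1.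
  have -> : \int[P]_w Q k.+1 w = \int[P]_w \int[K w]_x Psi (w, x).
    rewrite -(cond_bounded kN mPsi Psib); apply: eq_Rintegral => w _.
    by rewrite /Q /T /Psi/= big_ord_recr/= addrA.
  have mw w : measurable_fun setT (fun x => Psi (w, x)) by exact: (measurable_fun_pair2 (w : Om_ k) mPsi).
  have := @Rintegral_dist_le _ _ _ P (fun w => \int[K w]_x Psi (w, x)) (Q k) 1 e 0 set0.
  rewrite mulr0 addr0; apply => //.
  - exact: (sub_measurable_fun (ci_sub H (k := k)) (ci_KR_bounded mPsi Psib)).
  - by move=> w; exact: Rintegral_bounded_le (mw w) (fun x => Psib (w, x)).
  - by rewrite measure0.
  move=> w _; have [Sw|nSw] := pselect (S w); last first.
    rewrite /Psi /Q/= indicE memNset// mul0r; under eq_Rintegral do rewrite mul0r.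
    by rewrite Rintegral_prob_cst subrr normr0.
  rewrite /Psi /Q/= indicE mem_set// mul1r; under eq_Rintegral do rewrite mul1r.
  have mb : measurable_fun setT (fun x => cos (A w + T k w + beta (w, x))).
    by apply: mcos; apply: measurable_funD => //; exact: (measurable_fun_pair2 (w : Om_ 0) mbeta).
  rewrite RintegralZl//; last exact: (bounded_integrable _ mb (fun x => cb _)).
  have -> : expR (- ((N - k)%:R * v w)) = expR (- ((N - k.+1)%:R * v w)) * expR (- v w).
    rewrite -expRD; congr expR; rewrite (_ : (N - k)%N = (N - k.+1).+1); last by rewrite -subSn// subSS.
    by rewrite -natr1; ring.
  rewrite -mulrA -mulrBr normrM ger0_norm ?expR_ge0//.
  apply: (@le_trans _ _ (1 * e)); last by rewrite mul1r.
  apply: ler_pM => //; first by case/andP: (eb (N - k.+1)%N w).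
  exact: bnd.
have := telescope_sumr (fun k => \int[P]_w Q k w) (leq0n N).
rewrite big_mkord => tel.
have -> : \int[P]_w (\1_S w * cos (A w + \sum_(k < N) beta (w, xi k w))) = \int[P]_w Q N w.
  by apply: eq_Rintegral => w _; rewrite /Q subnn mul0r oppr0 expR0 mul1r.
have -> : \int[P]_w (\1_S w * (expR (- (N%:R * v w)) * cos (A w))) = \int[P]_w Q 0%N w.
  by apply: eq_Rintegral => w _; rewrite /Q /T big_ord0 addr0 subn0.
rewrite -tel; apply: (le_trans (ler_norm_sum _ _ _)).
rewrite mulr_natl -[X in _ *+ X](card_ord N) -sumr_const.
by apply: ler_sum => k _; exact: step.
Qed.

End CondIid.

(** * The particle system *)

Section ParticleKernel.
Context {R : realType} {dE} {E : measurableType dE} (M : fmodel R E).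
Local Notation mu := (fm_mu M).
Local Notation a := (fm_a M).
Local Notation g := (fm_g M).
Local Notation Lop := (Lop mu a g).

Lemma Lop1E t x : (kap M t x setT = (Lop t.+1 (cst 1) x)%:E)%E.
Proof.
rewrite Lop_kap// /Rintegral.
rewrite [X in fine X](_ : _ = kap M t x setT); last first.
  by rewrite [LHS](integral_cst (kap M t x) measurableT 1%E) mul1e.
by rewrite fineK// ge0_fin_numE// (le_lt_trans (kap_le M t x))// ltry.
Qed.

Lemma Lop1_gt0 t x : 0 < Lop t.+1 (cst 1) x.
Proof. by rewrite -lte_fin -Lop1E kap_gt0. Qed.

Definition qN (N t : nat) (xs : nat -> E) : E -> R :=
  if t is s.+1 then fN mu a g s.+1 N xs else fm_a0 M.

Let uN (N t : nat) (xs : nat -> E) (z : E) : R :=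
  g t.+1 z * ((\sum_(j < N) a t.+1 (xs j) z) / N%:R).

Let uN_m N t xs : measurable_fun setT (uN N t xs).
Proof.
apply: measurable_funM; first exact: fm_gm.
by apply: measurable_funM => //; apply: measurable_sum => j; exact: a_measurable2.
Qed.

Let uN_ge0 N t xs z : 0 <= uN N t xs z.
Proof.
apply: mulr_ge0; first exact: ltW (fm_g0 _ _ _).
by rewrite divr_ge0// sumr_ge0// => j _; exact: fm_ap.
Qed.

Lemma integral_uN N t xs (h : E -> \bar R) : measurable_fun setT h -> (forall x, 0 <= h x)%E ->
  (\int[mu]_z (h z * (uN N t xs z)%:E) = (\sum_(j < N) \int[kap M t (xs j)]_z h z) * (N%:R^-1)%:E)%E.
Proof.
move=> mh h0.
have m1 j : measurable_fun setT (fun z => h z * (a t.+1 (xs j) z * g t.+1 z)%:E)%E.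
  apply: emeasurable_funM => //; apply/measurable_EFinP; apply: measurable_funM; last exact: fm_gm.
  exact: a_measurable2.
have p1 j z : (0 <= h z * (a t.+1 (xs j) z * g t.+1 z)%:E)%E.
  by rewrite mule_ge0// lee_fin mulr_ge0 ?fm_ap// ltW// fm_g0.
transitivity (\int[mu]_z ((\sum_(j < N) h z * (a t.+1 (xs j) z * g t.+1 z)%:E) * (N%:R^-1)%:E))%E.
  apply: eq_integral => z _; rewrite -ge0_sume_distrr; last first.
    by move=> j _; rewrite lee_fin mulr_ge0 ?fm_ap// ltW// fm_g0.
  rewrite sumEFin -muleA -EFinM; congr (_ * _%:E)%E; rewrite /uN -mulr_suml; ring.
rewrite ge0_integralZr//.
- rewrite ge0_integral_sum//; congr (_ * _)%E; apply: eq_bigr => j _.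
  by rewrite ge0_integral_kap.
- by apply: emeasurable_sum => j.
- by move=> z _; apply: sume_ge0 => j _.
Qed.

Lemma integral_uN1 N t xs :
  (\int[mu]_z (uN N t xs z)%:E = ((\sum_(j < N) Lop t.+1 (cst 1) (xs j)) / N%:R)%:E)%E.
Proof.
transitivity (\int[mu]_z (1%E * (uN N t xs z)%:E))%E.
  by apply: eq_integral => z _; rewrite mul1e.
rewrite (@integral_uN N t xs (fun=> 1%E) (@measurable_cst _ _ _ _ _ _) (fun=> lee01)).
rewrite EFinM -sumEFin; congr (_ * _)%E; apply: eq_bigr => j _.
by rewrite [LHS](integral_cst (kap M t (xs j)) measurableT 1%E) mul1e Lop1E.
Qed.

Lemma Rint_uN N t xs : Rint mu (uN N t xs) = (\sum_(j < N) Lop t.+1 (cst 1) (xs j)) / N%:R.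
Proof. by rewrite /Rint integral_uN1. Qed.

Lemma fN_uN N t xs z : fN mu a g t.+1 N xs z =
  uN N t xs z / ((\sum_(j < N) Lop t.+1 (cst 1) (xs j)) / N%:R).
Proof. by rewrite -Rint_uN. Qed.

Lemma sum_Lop1_gt0 N t (xs : nat -> E) : (0 < N)%N -> 0 < \sum_(j < N) Lop t.+1 (cst 1) (xs j).
Proof.
case: N => // N _; rewrite big_ord_recl ltr_wpDr ?Lop1_gt0// sumr_ge0// => j _.
exact: ltW (Lop1_gt0 _ _).
Qed.

Lemma qN_spec N t xs : (0 < N)%N ->
  [/\ measurable_fun setT (qN N t xs), forall x, 0 <= qN N t xs x &
   (\int[mu]_x (qN N t xs x)%:E = 1)%E].
Proof.
move=> N0; case: t => [|t] /=.
  by split; [exact: fm_a0m|exact: fm_a0p|exact: fm_a01].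
have IE := integral_uN1 N t xs.
have [_ ? ? ?] := @normalized_density _ _ _ mu _ (uN_m N t xs) (uN_ge0 N t xs)
  ltac:(by rewrite IE lte_fin divr_gt0 ?sum_Lop1_gt0 ?ltr0n) ltac:(by rewrite IE ltry).
by split.
Qed.

(** An empty mixture cannot be normalised; for [N = 0] the default [piM M 0] keeps the kernel a
    probability. *)
Fact PK_sig : {K : nat -> nat -> (nat -> E) -> probability E R |
  forall N t xs, (0 < N)%N -> forall A, K N t xs A = density mu (qN N t xs) A}.
Proof.
exists (fun N t xs => match ltnP 0 N with
  | LtnNotGeq h => densP (let: And3 m _ _ := qN_spec t xs h in m)
     (let: And3 _ m _ := qN_spec t xs h in m) (let: And3 _ _ m := qN_spec t xs h in m)
  | GeqNotLtn _ => piM M 0 end).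
by move=> N t xs N0 A; case: ltnP => //; rewrite leqNgt N0.
Qed.

Definition PK := sval PK_sig.

Lemma PKE N t xs A : (0 < N)%N -> PK N t xs A = density mu (qN N t xs) A.
Proof. by move=> N0; exact: (svalP PK_sig). Qed.

Lemma ge0_integral_PK_mu N t xs (h : E -> \bar R) : (0 < N)%N -> measurable_fun setT h ->
  (forall x, 0 <= h x)%E ->
  (\int[PK N t xs]_x h x = \int[mu]_x (h x * (qN N t xs x)%:E))%E.
Proof.
move=> N0 mh h0; have [m p _] := qN_spec t xs N0.
by apply: ge0_integral_density => // A _; exact: PKE.
Qed.

(** The law is a mixture of the kernels [kap] at the particles, normalised by the sum of their
    masses; the factors [1 / N] cancel. *)
Lemma ge0_integral_PKS N t xs (h : E -> \bar R) : (0 < N)%N -> measurable_fun setT h ->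
  (forall x, 0 <= h x)%E ->
  (\int[PK N t.+1 xs]_x h x = (\sum_(j < N) \int[kap M t (xs j)]_x h x) *
    ((\sum_(j < N) Lop t.+1 (cst 1) (xs j))^-1)%:E)%E.
Proof.
move=> N0 mh h0; rewrite ge0_integral_PK_mu//=.
have s0 := sum_Lop1_gt0 t xs N0; set s := (\sum_(j < N) Lop t.+1 (cst 1) (xs j)) in s0 *.
transitivity (\int[mu]_z (h z * (uN N t xs z)%:E * ((s / N%:R)^-1)%:E))%E.
  by apply: eq_integral => z _; rewrite fN_uN EFinM muleA.
have Nn : (N%:R : R) != 0 by rewrite pnatr_eq0 -lt0n.
rewrite ge0_integralZr//.
- rewrite integral_uN// -muleA -EFinM; congr (_ * _%:E)%E.
  by rewrite invf_div mulrA mulVf// mul1r.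
- by apply: emeasurable_funM => //; apply/measurable_EFinP.
- by move=> z _; rewrite mule_ge0// lee_fin uN_ge0.
- by rewrite lee_fin invr_ge0 divr_ge0// ltW.
Qed.

Lemma qN_joint {d} {T : measurableType d} N t (f : nat -> T -> E) : (0 < N)%N ->
  (forall j, (j < N)%N -> measurable_fun setT (f j)) ->
  measurable_fun setT (fun z : T * E => qN N t (f ^~ z.1) z.2).
Proof.
move=> N0 mf; case: t => [|t]; first exact: (measurableT_comp (fm_a0m M)).
rewrite /qN; under eq_fun do rewrite fN_uN.
apply: measurable_funM.
  apply: measurable_funM; first exact: (measurableT_comp (fm_gm M t)).
  apply: measurable_funM => //; apply: measurable_sum => j.
  have mp : measurable_fun setT (fun z : T * E => (f j z.1, z.2)).
    apply/measurable_fun_pairP; split; last exact: measurable_snd.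
    exact: (measurableT_comp (mf j (ltn_ord j)) measurable_fst).
  exact: (measurableT_comp (fm_am M t) mp).
(* [x^-1 = exp (- ln x)] for [x > 0], and both functions are measurable *)
have e (z : T * E) : ((\sum_(j < N) Lop t.+1 (cst 1) (f j z.1)) / N%:R)^-1 =
    expR (- ln ((\sum_(j < N) Lop t.+1 (cst 1) (f j z.1)) / N%:R)).
  by rewrite expRN lnK// posrE divr_gt0 ?ltr0n//; exact: (sum_Lop1_gt0 t (f ^~ z.1)).
under eq_fun do rewrite e.
apply: measurableT_comp => //; apply: measurableT_comp => //; apply: measurableT_comp.
  exact: measurable_ln.
apply: measurable_funM => //; apply: measurable_sum => j.
apply: measurableT_comp; first exact: Lop_measurable.
exact: (measurableT_comp (mf j (ltn_ord j)) measurable_fst).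
Qed.

End ParticleKernel.

(** * Conditional law of each particle given the previous ones *)

Section Cylinders.
Context {R : realType} {dE} {E : measurableType dE} (M : fmodel R E)
  {d} {Om : measurableType d} (P : probability Om R) (N : nat) (X : nat -> nat -> Om -> E).
Local Notation mu := (fm_mu M).
Hypothesis HX : is_particle_filter mu (fm_a0 M) (fm_a M) (fm_g M) P N X.
Hypothesis N0 : (0 < N)%N.

Definition hist t (C : nat -> nat -> set E) : set Om :=
  \bigcap_(j in `I_N) \bigcap_(r in `I_t) (X j r @^-1` C j r).

Definition cyl t k (C : nat -> nat -> set E) (B : nat -> set E) : set Om :=
  hist t C `&` \bigcap_(j in `I_k) (X j t @^-1` B j).

(** A pi-system for the particles before time [t] and the first [k] particles at time [t]; the index
    [k] allows conditioning on one particle at a time. *)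
Definition cylG t k : set (set Om) := [set S | exists C B,
  [/\ forall j r, measurable (C j r), forall j, measurable (B j) & S = cyl t k C B]].

Let mX j s : measurable_fun setT (X j s). Proof. by case: HX. Qed.

Let mXB j s (B : set E) : measurable B -> measurable (X j s @^-1` B).
Proof. by move=> mB; rewrite -[X in measurable X]setTI; exact: mX. Qed.

Lemma hist_measurable t C : (forall j r, measurable (C j r)) -> measurable (hist t C).
Proof.
by move=> mC; apply: bigcap_measurableType => // j _; apply: bigcap_measurableType => // r _; exact: mXB.
Qed.

Lemma cyl_measurable t k C B : (forall j r, measurable (C j r)) -> (forall j, measurable (B j)) ->
  measurable (cyl t k C B).
Proof.
move=> mC mB; apply: measurableI; first exact: hist_measurable.
by apply: bigcap_measurableType => // j _; exact: mXB.
Qed.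

Lemma cylG_sub t k : cylG t k `<=` measurable.
Proof. by move=> _ [C [B [mC mB ->]]]; exact: cyl_measurable. Qed.

Lemma cylGI t k : setI_closed (cylG t k).
Proof.
move=> _ _ [C [B [mC mB ->]]] [C' [B' [mC' mB' ->]]].
exists (fun j r => C j r `&` C' j r), (fun j => B j `&` B' j); split.
- by move=> j r; exact: measurableI.
- by move=> j; exact: measurableI.
- apply/seteqP; split => w.
    move=> [[h1 h2] [h3 h4]]; split => [j jN r rt|j jk]; split;
      [exact: h1|exact: h3|exact: h2|exact: h4].
  move=> [h1 h2]; split; (split => [j jN r rt|j jk]; first by case: (h1 j jN r rt)).
    by case: (h2 j jk).
  by case: (h2 j jk).
Qed.

Lemma cylGT t k : cylG t k setT.
Proof.
by exists (fun _ _ => setT), (fun _ => setT); split => //; apply/seteqP; split.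
Qed.

Lemma hist_cylG t k C : (forall j r, measurable (C j r)) -> cylG t k (hist t C).
Proof.
move=> mC; exists C, (fun=> setT); split => //.
by apply/seteqP; split => w; [move=> h; split|case].
Qed.

Lemma cyl0 t C B : cyl t 0 C B = hist t C.
Proof. by apply/seteqP; split => w; [case|move=> h; split]. Qed.

Lemma past_measurable t j r : (j < N)%N -> (r < t)%N ->
  measurable_fun setT (X j r : g_sigma_algebraType (cylG t 0) -> E).
Proof.
move=> jN rt _ B mB; rewrite setTI; apply: sub_sigma_algebra.
pose C j' r' := if (j' == j) && (r' == r) then B else setT.
rewrite (_ : X j r @^-1` B = hist t C).
  by apply: hist_cylG => j' r'; rewrite /C; case: ifP.
apply/seteqP; split => w; first by move=> h j' _ r' _; rewrite /C; case: ifP => // /andP[/eqP-> /eqP->].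
by move=> /(_ j jN r rt); rewrite /C !eqxx.
Qed.

Lemma present_measurable t k j : (j < k)%N ->
  measurable_fun setT (X j t : g_sigma_algebraType (cylG t k) -> E).
Proof.
move=> jk _ B mB; rewrite setTI; apply: sub_sigma_algebra.
exists (fun _ _ => setT), (fun i => if i == j then B else setT); split => //.
  by move=> i; case: ifP.
apply/seteqP; split => w; first by move=> h; split => // i _; case: ifP => // /eqP ->.
by move=> [_ /(_ j jk)]; rewrite /= eqxx.
Qed.

(** At time 0 the index [t.-1] is 0, harmlessly: [qN] is then [a0] whatever the particles. *)
Definition KX t (w : Om) : probability E R := PK M N t (fun i => X i t.-1 w).

Lemma KXE t w B : KX t w B = density mu (qN M N t (fun i => X i t.-1 w)) B.
Proof. exact: PKE. Qed.

Lemma qX_joint t k : measurable_fun setT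
  (fun z : g_sigma_algebraType (cylG t k) * E => qN M N t (fun i => X i t.-1 z.1) z.2).
Proof.
case: t => [|t]; first exact: (measurableT_comp (fm_a0m M)).
apply: (@qN_joint _ _ _ M _ (g_sigma_algebraType (cylG t.+1 k)) N t.+1 (fun j => X j t) N0) => j jN.
have idm : measurable_fun setT (id : g_sigma_algebraType (cylG t.+1 k) -> g_sigma_algebraType (cylG t.+1 0)).
  apply: id_sub_measurable => _ [C [B [mC mB ->]]]; apply: sub_sigma_algebra.
  by rewrite cyl0; exact: hist_cylG.
exact: (measurableT_comp (past_measurable jN (ltnSn t)) idm).
Qed.

Lemma particle_step t C B : (forall j r, measurable (C j r)) -> (forall j, measurable (B j)) ->
  (P (hist t C `&` \bigcap_(j in `I_N) (X j t @^-1` B j)) =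
   \int[P]_(w in hist t C) \prod_(j < N) KX t w (B j))%E.
Proof.
move=> mC mB; have [_ H0 HS] := HX; case: t => [|t].
  have -> : hist 0 C = setT by apply/seteqP; split.
  rewrite setTI H0//; set c := (\prod_(j < N) _)%E.
  transitivity (\int[P]_w cst c w)%E.
    by rewrite [RHS](integral_cst P measurableT c) [X in (_ * X)%E](@probability_setT _ _ _ P) mule1.
  by apply: eq_integral => w _; apply: eq_bigr => j _; rewrite KXE.
rewrite /hist HS//; apply: eq_integral => w _; apply: eq_bigr => j _.
by rewrite KXE.
Qed.

Lemma measurable_KX t k (Psi : g_sigma_algebraType (cylG t k) * E -> \bar R) :
  measurable_fun setT Psi -> (forall z, 0 <= Psi z)%E ->
  measurable_fun setT (fun w : g_sigma_algebraType (cylG t k) => \int[KX t w]_x Psi (w, x))%E.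
Proof.
move=> mPsi Psi0.
have mw (w : g_sigma_algebraType (cylG t k)) : measurable_fun setT (fun x => Psi (w, x)).
  exact: (measurable_fun_pair2 w mPsi).
under eq_fun => w do rewrite /KX ge0_integral_PK_mu//.
apply: (@measurable_fun_fubini_tonelli_F _ _ _ _ _ mu
  (fun z => Psi z * (qN M N t (fun i => X i t.-1 z.1) z.2)%:E)%E).
- by apply: emeasurable_funM => //; apply/measurable_EFinP; exact: qX_joint.
- move=> z; rewrite mule_ge0// lee_fin.
  by have [_ + _] := qN_spec M t (fun i => X i t.-1 z.1) N0; apply.
Qed.

(** The particle filter is specified by the joint law of a whole generation given the past; the law
    of particle [k] given the previous ones follows by leaving the later ones free. *)
Lemma cyl_cond t k (A : set Om) (B : set E) : (k < N)%N -> cylG t k A -> measurable B ->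
  (P (A `&` X k t @^-1` B) = \int[P]_(w in A) KX t w B)%E.
Proof.
move=> kN [C [D [mC mD ->]]] mB.
pose KB (D' : set E) w : R := fine (KX t w D').
have KBE D' w : measurable D' -> (KX t w D' = (KB D' w)%:E)%E.
  by move=> mD'; rewrite /KB fineK// fin_num_measure.
have KB0 D' w : 0 <= KB D' w by exact: fine_ge0.
have mKB D' : measurable D' -> measurable_fun setT (KB D' : g_sigma_algebraType (cylG t 0) -> R).
  move=> mD'; apply: measurableT_comp => //.
  have := @measurable_KX t 0 (fun z => (\1_D' z.2)%:E).
  have e w : (\int[KX t w]_x (\1_D' x)%:E = KX t w D')%E by rewrite integral_indic// setIT.
  move=> h; apply: eq_measurable_fun (h _ _) => //.
  - by apply/measurable_EFinP; apply: measurableT_comp.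
(* Particles from [k] on are unconstrained. Below, [r1] is the indicator of the constraints on the
   first [k], and [r2] their conditional probability given the past. *)
pose D1 j := if (j < k)%N then D j else setT.
have mD1 j : measurable (D1 j) by rewrite /D1; case: ifP.
pose r1 : Om -> R := \1_(\bigcap_(j in `I_k) (X j t @^-1` D j)).
pose r2 w : R := \prod_(j < N) KB (D1 j) w.
have mpast : measurable (\bigcap_(j in `I_k) (X j t @^-1` D j)).
  by apply: bigcap_measurableType => // j _; exact: mXB.
have mr1 : measurable_fun setT r1 by exact: measurable_indic.
have mr2 : measurable_fun setT r2.
  apply: measurable_prod => j _; exact: (sub_measurable_fun (@cylG_sub t 0) (mKB _ (mD1 j))).
have r20 w : 0 <= r2 w by exact: prodr_ge0.
have r10 w : 0 <= r1 w by [].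
have prodE w (F : nat -> set E) : (forall j, measurable (F j)) ->
    (\prod_(j < N) KX t w (F j) = (\prod_(j < N) KB (F j) w)%:E)%E.
  move=> mF; rewrite -prodEFin; apply: eq_bigr => j _; exact: KBE.
have eqr S : cylG t 0 S -> (\int[P]_(w in S) (r1 w)%:E = \int[P]_(w in S) (r2 w)%:E)%E.
  move=> [C' [D' [mC' _ ->]]]; rewrite cyl0; have mh := hist_measurable t mC'.
  transitivity (P (hist t C' `&` \bigcap_(j in `I_k) (X j t @^-1` D j))).
    by rewrite integral_indic// setIC.
  transitivity (P (hist t C' `&` \bigcap_(j in `I_N) (X j t @^-1` D1 j))).
    congr (P (_ `&` _)); apply/seteqP; split => w h j /= jk.
      by rewrite /D1; case: ifP => // /h.
    by have := h j (ltn_trans jk kN); rewrite /D1 jk.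
  by rewrite particle_step//; apply: eq_integral => w _; rewrite prodE.
have mh := hist_measurable t mC.
have mIh : measurable_fun setT (\1_(hist t C) : g_sigma_algebraType (cylG t 0) -> R).
  by apply: measurable_indic; apply: sub_sigma_algebra; exact: hist_cylG.
pose Phi w := (\1_(hist t C) w * KB B w)%:E.
have := @integral_pi_system _ _ _ P _ (@cylG_sub t 0) (@cylGI t 0) (cylGT t 0) r1 r2 Phi mr1 mr2 r10 r20.
move=> /(_ _ eqr); have -> : (\int[P]_w (r1 w)%:E < +oo)%E.
  by rewrite integral_indic// setIT (le_lt_trans (probability_le1 P _)) ?ltry.
move=> /(_ isT) eqI.
have {eqI} eqI : (\int[P]_w (Phi w * (r1 w)%:E) = \int[P]_w (Phi w * (r2 w)%:E))%E.
  apply: eqI; last by move=> w; rewrite lee_fin mulr_ge0.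
  by apply/measurable_EFinP; apply: measurable_funM => //; exact: mKB.
transitivity (\int[P]_w (Phi w * (r2 w)%:E))%E; last first.
  rewrite -eqI [RHS]integral_mkcond; apply: eq_integral => w _; rewrite patchE KBE//.
  rewrite /Phi /r1 /cyl in_setI !indicE -EFinM.
  by case: (_ \in _); case: (_ \in _); rewrite /= ?mul1r ?mul0r ?mulr1 ?mulr0.
(* The same constraints with [B] at place [k], where [D1] has mass one: the product gains exactly
   the factor [KB B]. *)
pose D2 j := if (j == k)%N then B else D1 j.
have mD2 j : measurable (D2 j) by rewrite /D2; case: ifP.
transitivity (P (hist t C `&` \bigcap_(j in `I_N) (X j t @^-1` D2 j))).
  congr (P _); apply/seteqP; split => w.
    move=> [[h1 h2] h3]; split => // j /= jN; rewrite /D2; case: eqVneq => [->//|_].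
    by rewrite /D1; case: ifP => // /h2.
  move=> [h1 h2]; split; last by have := h2 k kN; rewrite /D2 eqxx.
  split => // j /= jk; have := h2 j (ltn_trans jk kN); rewrite /D2 /D1 jk.
  by rewrite (ltn_eqF jk).
rewrite particle_step// [LHS]integral_mkcond; apply: eq_integral => w _; rewrite patchE prodE// /Phi indicE.
have -> : \prod_(j < N) KB (D2 j) w = KB B w * r2 w.
  rewrite /r2 (bigD1 (Ordinal kN))//= [X in _ = _ * X](bigD1 (Ordinal kN))//=.
  have -> : D2 k = B by rewrite /D2 eqxx.
  have -> : D1 k = setT by rewrite /D1 ltnn.
  have -> : KB setT w = 1 by rewrite /KB (@probability_setT _ _ _ (KX t w)).
  rewrite mul1r /D2; congr (_ * _).
  by apply: eq_bigr => j jk; rewrite ifF//; apply: contraNF jk => /eqP e; apply/eqP/val_inj.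
by case: ifP => _; rewrite -?EFinM ?mul1r ?mul0r ?mul0e.
Qed.

Lemma particle_cond_iid t : cond_iid P N (fun j => X j t) (cylG t) (KX t).
Proof.
split.
- by move=> k; exact: cylG_sub.
- move=> k; apply: id_sub_measurable => _ [C [B [mC mB ->]]]; apply: sub_sigma_algebra.
  by rewrite cyl0; exact: hist_cylG.
- by move=> k j; exact: present_measurable.
- by move=> k Psi; exact: measurable_KX.
- move=> k kN Psi mPsi Psi0.
  rewrite (@integral_cond _ _ _ P _ _ _ mu (X k t) (fun w => qN M N t (fun i => X i t.-1 w))
    (@cylG_sub t k) (@cylGI t k) (cylGT t k) (mX k t) (@qX_joint t k))//.
  + apply: eq_integral => w _; rewrite /KX ge0_integral_PK_mu//.
    exact: (measurable_fun_pair2 (w : g_sigma_algebraType (cylG t k)) mPsi).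
  + by move=> w; have [_ + _] := qN_spec M t (fun i => X i t.-1 w) N0.
  + by move=> w; have [_ _] := qN_spec M t (fun i => X i t.-1 w) N0.
  + move=> A B GA mB; rewrite (cyl_cond kN GA mB).
    by apply: eq_integral => w _; rewrite KXE.
Qed.

End Cylinders.

(** * Convergence in probability and tightness on varying spaces *)

Section InProbability.
Context {R : realType} (dO : nat -> measure_display)
  (Omega : forall N, measurableType (dO N)) (P : forall N, probability (Omega N) R).
Implicit Types (S : forall N, Omega N -> Prop) (Z W : forall N, Omega N -> R).

(** Formulated with a measurable exceptional set, so that [S] itself need not be measurable. *)
Definition whp S := forall dl : R, 0 < dl -> \forall N \near \oo,
  exists B, [/\ measurable B, (P N B <= dl%:E)%E & forall w, ~ B w -> S N w].

Definition cvgp Z (c : R) := forall e : R, 0 < e -> whp (fun N w => `|Z N w - c| <= e).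

Definition tightp W := forall dl : R, 0 < dl -> exists K : R, \forall N \near \oo,
  exists B, [/\ measurable B, (P N B <= dl%:E)%E & forall w, ~ B w -> `|W N w| <= K].

Lemma whp_imp S S' : (\forall N \near \oo, forall w, S N w -> S' N w) -> whp S -> whp S'.
Proof.
move=> SS' hS dl dl0; apply: filterS2 SS' (hS dl dl0) => N h [B [mB PB BS]].
by exists B; split => // w /BS /h.
Qed.

Lemma exceptional_union N (S S' : Omega N -> Prop) (dl dl' : R) :
  (exists B, [/\ measurable B, (P N B <= dl%:E)%E & forall w, ~ B w -> S w]) ->
  (exists B, [/\ measurable B, (P N B <= dl'%:E)%E & forall w, ~ B w -> S' w]) ->
  exists B, [/\ measurable B, (P N B <= (dl + dl')%:E)%E & forall w, ~ B w -> S w /\ S' w].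
Proof.
move=> [B [mB PB BS]] [B' [mB' PB' BS']]; exists (B `|` B'); split.
- exact: measurableU.
- by apply: (le_trans (measureU2 _ _ _)) => //; rewrite EFinD leeD.
- by move=> w /not_orP[/BS ? /BS'].
Qed.

Lemma whp_and S S' : whp S -> whp S' -> whp (fun N w => S N w /\ S' N w).
Proof.
move=> hS hS' dl dl0; have dl2 : 0 < dl / 2 by rewrite divr_gt0.
apply: filterS2 (hS _ dl2) (hS' _ dl2) => N h h'.
by have := exceptional_union h h'; rewrite -splitr.
Qed.

Lemma whp_near S : (\forall N \near \oo, forall w, S N w) -> whp S.
Proof.
move=> hS dl dl0; apply: filterS hS => N h; exists set0; split => //.
by rewrite measure0 lee_fin ltW.
Qed.

Lemma whp_null S : (forall N, (0 < N)%N ->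
  exists B, [/\ measurable B, P N B = 0%E & forall w, ~ B w -> S N w]) -> whp S.
Proof.
move=> hS dl dl0; apply: filterS (nbhs_infty_gt 0) => N /hS[B [mB PB BS]].
by exists B; split => //; rewrite PB lee_fin ltW.
Qed.

Lemma tightp_whp W dl : tightp W -> 0 < dl -> exists K : R, 0 < K /\ \forall N \near \oo,
  exists B, [/\ measurable B, (P N B <= dl%:E)%E & forall w, ~ B w -> `|W N w| <= K].
Proof.
move=> tW dl0; have [K hK] := tW _ dl0; exists (`|K| + 1); split.
  by rewrite ltr_wpDl.
apply: filterS hK => N [B [mB PB BK]]; exists B; split => // w /BK h.
by apply: (le_trans h); rewrite (le_trans (ler_norm _))// lerDl.
Qed.

Lemma tightpD W W' : tightp W -> tightp W' -> tightp (fun N w => W N w + W' N w).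
Proof.
move=> h h' dl dl0; have dl2 : 0 < dl / 2 by rewrite divr_gt0.
have [K hK] := h _ dl2; have [K' hK'] := h' _ dl2; exists (K + K').
apply: filterS2 hK hK' => N h1 h2.
have [B [mB PB BS]] := exceptional_union h1 h2; exists B; split => //.
  by rewrite (splitr dl).
by move=> w /BS[? ?]; apply: (le_trans (ler_normD _ _)); exact: lerD.
Qed.

Lemma tightp_le W W' (c : R) : 0 <= c -> whp (fun N w => `|W' N w| <= c * `|W N w|) ->
  tightp W -> tightp W'.
Proof.
move=> c0 hc h dl dl0; have dl2 : 0 < dl / 2 by rewrite divr_gt0.
have [K hK] := h _ dl2; exists (c * K).
apply: filterS2 hK (hc _ dl2) => N h1 h2.
have [B [mB PB BS]] := exceptional_union h1 h2; exists B; split => //.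
  by rewrite (splitr dl).
by move=> w /BS[? h3]; apply: (le_trans h3); rewrite ler_wpM2l.
Qed.

Lemma tightp_mul_small W Z : tightp W -> cvgp Z 0 -> cvgp (fun N w => W N w * Z N w) 0.
Proof.
move=> h hZ e e0 dl dl0; have dl2 : 0 < dl / 2 by rewrite divr_gt0.
have [K [K0 hK]] := tightp_whp h dl2.
have eK : 0 < e / K by rewrite divr_gt0.
apply: filterS2 hK (hZ _ eK _ dl2) => N h1 h2.
have [B [mB PB BS]] := exceptional_union h1 h2; exists B; split => //.
  by rewrite (splitr dl).
move=> w /BS[h3]; rewrite !subr0 normrM => h4.
by apply: (le_trans (ler_pM _ _ h3 h4)); rewrite ?normr_ge0// mulrC divfK// gt_eqF.
Qed.

Lemma near_sqrt (r : R) : \forall N \near \oo, r <= Num.sqrt (N%:R : R).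
Proof.
apply: filterS (nbhs_infty_ger (r ^+ 2)) => N h.
apply: (le_trans (ler_norm r)); rewrite -sqrtr_sqr ler_wsqrtr//.
Qed.

Lemma cvgp_ratio (Z L : forall N, Omega N -> R) (m p : R) : 0 < p ->
  cvgp Z (p * m) -> cvgp L p -> cvgp (fun N w => Z N w / L N w) m.
Proof.
move=> p0 hZ hL e e0.
pose k := 1 + `|m|; have k0 : 0 < k by rewrite ltr_wpDr.
(* The first bound keeps the denominator above [p / 2]; the second brings the numerator, at most
   [eta * (1 + |m|)], below [e * p / 2]. *)
pose eta := Num.min (p / 2) (e * (p / 2) / k).
have eta0 : 0 < eta by rewrite lt_min !divr_gt0 ?mulr_gt0 ?divr_gt0.
have e1 : eta <= p / 2 by rewrite ge_min lexx.
have e2 : eta * k <= e * (p / 2) by rewrite -ler_pdivlMr// ge_min lexx orbT.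
apply: whp_imp (whp_and (hZ _ eta0) (hL _ eta0)); apply: nearW => N w [hz hl].
have L0 : p / 2 <= L N w by move: hl; rewrite ler_norml; lra.
have Lp : 0 < L N w by apply: lt_le_trans L0; rewrite divr_gt0.
have -> : Z N w / L N w - m = (Z N w - p * m - m * (L N w - p)) / L N w.
  by rewrite -[in LHS](mulfK (lt0r_neq0 Lp) m) -mulrBl; congr (_ / _); ring.
rewrite normrM normfV (gtr0_norm Lp) ler_pdivrMr//.
apply: (@le_trans _ _ (eta * k)).
  apply: (le_trans (ler_normB _ _)); rewrite normrM /k mulrDr mulr1 lerD// mulrC ler_wpM2r//.
by apply: (le_trans e2); rewrite ler_wpM2l// ltW.
Qed.

End InProbability.

(** * Filter-null sets are avoided by the particles *)

Section Asymptotics.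
Context {R : realType} {dE} {E : measurableType dE} (M : fmodel R E)
  (dO : nat -> measure_display) (Omega : forall N, measurableType (dO N))
  (P : forall N, probability (Omega N) R)
  (X : forall N, nat -> nat -> Omega N -> E).
Local Notation mu := (fm_mu M).
Local Notation a0 := (fm_a0 M).
Local Notation a := (fm_a M).
Local Notation g := (fm_g M).
Local Notation pY := (pY mu a0 a g).
Local Notation Lop := (Lop mu a g).
Local Notation mf := (mf mu a0 a g).
Local Notation pi := (piM M).
Arguments X : clear implicits.
Hypothesis HX : forall N, is_particle_filter mu a0 a g (P N) N (X N).

Local Notation K N t w := (KX M N (X N) t w).
Definition emp t (h : E -> R) N (w : Omega N) : R := MN N (fun j => X N j t w) h.

Lemma X_measurable N j t : measurable_fun setT (X N j t). Proof. by case: (HX N). Qed.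

Lemma emp_measurable t h N : measurable_fun setT h -> measurable_fun setT (emp t h (N := N)).
Proof.
move=> mh; apply: measurable_funM => //; apply: measurable_sum => j.
by apply: measurableT_comp => //; exact: X_measurable.
Qed.

Lemma particle_avoid t N (A : set E) : measurable A ->
  (forall j, (j < N)%N -> P N (X N j t @^-1` A) = 0%E) ->
  exists B, [/\ measurable B, P N B = 0%E & forall w, ~ B w -> forall j, (j < N)%N -> ~ A (X N j t w)].
Proof.
move=> mA PA.
have mF (i : 'I_N) : measurable (X N i t @^-1` A).
  by rewrite -[Y in measurable Y]setTI; exact: X_measurable.
exists (\big[setU/set0]_(i < N) (X N i t @^-1` A)); split.
- exact: bigsetU_measurable.
- apply/eqP; rewrite eq_le measure_ge0 andbT.
  have := @probability_bigsetU_le _ _ _ (P N) 'I_N (index_enum _) _ 0 mF; rewrite mulr0.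
  by apply => i; rewrite PA.
- move=> w nB j jN Aj; apply: nB.
  by rewrite -(bigcup_mkord N (fun i => X N i t @^-1` A)); exists j.
Qed.

(** The law of each particle is absolutely continuous with respect to the filter. Inductively,
    [kap t x] charges a null set [A] at [t.+1] only for [x] in a null set at [t], which the
    particles avoid; the mixture of their kernels then gives [A] no mass. *)
Lemma particle_null t N (A : set E) : (0 < N)%N -> measurable A -> pi t A = 0%E ->
  forall j, (j < N)%N -> P N (X N j t @^-1` A) = 0%E.
Proof.
move=> N0; elim: t A => [|t IH] A mA piA j jN.
  have := cyl_cond (HX N) N0 (t := 0) jN (cylGT _ _ _ _) mA; rewrite setTI => ->.
  by apply: integral0_eq => w _; rewrite KXE// -piA piME.
have := cyl_cond (HX N) N0 (t := t.+1) jN (cylGT _ _ _ _) mA; rewrite setTI => ->.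
have mI : measurable_fun setT (fun x => (\1_A x)%:E : \bar R) by apply/measurable_EFinP; exact: measurable_indic.
have I0 x : (0 <= (\1_A x)%:E :> \bar R)%E by rewrite lee_fin.
have ind (m : {measure set E -> \bar R}) : (\int[m]_x (\1_A x)%:E = m A)%E by rewrite integral_indic// setIT.
pose A' := [set x | kap M t x A != 0%E].
have mk : measurable_fun setT (fun x => kap M t x A).
  by have := measurable_kap M t mI I0; under eq_fun do rewrite ind.
have mA' : measurable A'.
  have -> : A' = setT `&` (fun x => kap M t x A) @^-1` (~` [set 0%E]).
    by rewrite setTI; apply/seteqP; split => x /=; [move=> h /eqP; exact/negP|move=> h; apply/eqP].
  by apply: mk => //; exact: measurableC.
have piA' : pi t A' = 0%E.
  have int0 : (\int[pi t]_x kap M t x A = 0)%E.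
    have e1 : (\int[pi t.+1]_x (\1_A x)%:E = 0)%E by rewrite -piA; exact: ind.
    have := tonelli_kap M t mI I0; rewrite e1 mule0 => <-.
    by apply: eq_integral => x _; rewrite ind.
  have /(ae_eq_integral_abs (pi t) measurableT mk) [B [mB B0 sB]] :
      (\int[pi t]_x `|kap M t x A| = 0)%E by rewrite -int0; apply: eq_integral => x _; rewrite gee0_abs.
  apply/eqP; rewrite eq_le measure_ge0 andbT -B0 le_measure ?inE// => x /= kx; apply: sB => /= h.
  by have /eqP := kx; apply; exact: h.
have [F [mF PF FA']] := particle_avoid mA' (IH _ mA' piA').
pose KA (w : Omega N) := K N t.+1 w A.
have mKA : measurable_fun setT KA.
  have := ci_meas0 (particle_cond_iid (HX N) N0 t.+1) (ci_K0 (particle_cond_iid (HX N) N0 t.+1) mI I0).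
  by under eq_fun do rewrite ind.
transitivity (\int[P N]_w (cst 0%E w))%E; last exact: integral0.
apply: ae_eq_integral => //.
exists F; split => // w /= h; apply: contrapT => nF; apply: h => _.
rewrite -(ind (K N t.+1 w)) ge0_integral_PKS// big1 ?mul0e// => i _.
by rewrite ind; apply/eqP; apply: contrapT => /negP; exact: (FA' w nF i (ltn_ord i)).
Qed.

Lemma particle_ae t N (Q : E -> Prop) : (0 < N)%N -> {ae pi t, forall x, Q x} ->
  exists B, [/\ measurable B, P N B = 0%E & forall w, ~ B w -> forall j, (j < N)%N -> Q (X N j t w)].
Proof.
move=> N0 [A [mA A0 sA]].
have [B [mB PB BA]] := particle_avoid mA (particle_null N0 mA A0).
exists B; split => // w nB j jN; apply: contrapT => nQ; apply: (BA w nB j jN); exact: sA.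
Qed.

(** The signed version of [ge0_integral_PKS]. The null event removed is that some particle sits
    where [kap] does not integrate [psi]. *)
Lemma KX_Lop t N (psi : E -> R) : (0 < N)%N -> measurable_fun setT psi ->
  (pi t.+1).-integrable setT (EFin \o psi) ->
  exists B, [/\ measurable B, P N B = 0%E & forall w, ~ B w ->
    (K N t.+1 w).-integrable setT (EFin \o psi) /\
    \int[K N t.+1 w]_x psi x = emp t (Lop t.+1 psi) w / emp t (Lop t.+1 (cst 1)) w].
Proof.
move=> N0 mpsi ipsi.
have [B [mB PB Bi]] := particle_ae N0 (kap_ae_integrable mpsi ipsi).
exists B; split => // w /Bi {}Bi.
have mE : measurable_fun setT (EFin \o psi) by exact/measurable_EFinP.
have mp := measurable_funepos mE; have mn := measurable_funeneg mE.
pose s := \sum_(j < N) Lop t.+1 (cst 1) (X N j t w).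
have s0 : 0 < s by exact: (sum_Lop1_gt0 M t (fun j => X N j t w) N0).
pose p j := fine (\int[kap M t (X N j t w)]_x (EFin \o psi)^\+ x)%E.
pose n j := fine (\int[kap M t (X N j t w)]_x (EFin \o psi)^\- x)%E.
have pE (j : 'I_N) : (\int[kap M t (X N j t w)]_x (EFin \o psi)^\+ x = (p j)%:E)%E.
  by rewrite /p fineK//; apply: integrable_pos_fin_num => //; exact: Bi.
have nE (j : 'I_N) : (\int[kap M t (X N j t w)]_x (EFin \o psi)^\- x = (n j)%:E)%E.
  by rewrite /n fineK//; apply: integrable_neg_fin_num => //; exact: Bi.
have KpE : (\int[K N t.+1 w]_x (EFin \o psi)^\+ x = ((\sum_(j < N) p j) / s)%:E)%E.
  by rewrite ge0_integral_PKS// EFinM -sumEFin; congr (_ * _)%E; apply: eq_bigr => j _; exact: pE.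
have KnE : (\int[K N t.+1 w]_x (EFin \o psi)^\- x = ((\sum_(j < N) n j) / s)%:E)%E.
  by rewrite ge0_integral_PKS// EFinM -sumEFin; congr (_ * _)%E; apply: eq_bigr => j _; exact: nE.
split.
  apply/integrableP; split => //.
  rewrite (_ : (\int[_]_x _ = \int[K N t.+1 w]_x ((EFin \o psi)^\+ x + (EFin \o psi)^\- x))%E); last first.
    by apply: eq_integral => x _; exact: (congr1 (fun F => F x) (fune_abse (EFin \o psi))).
  by rewrite ge0_integralD// KpE KnE -EFinD ltry.
have Nn : (N%:R : R) != 0 by rewrite pnatr_eq0 -lt0n.
rewrite /Rintegral integralE [X in fine (X - _)]KpE [X in fine (_ - X)]KnE -EFinB /= -mulrBl -sumrB.
rewrite /emp /MN -/s invf_div mulrA divfK//.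
congr (_ / _); apply: eq_bigr => j _; rewrite LopE// pE nE//.
Qed.

Lemma emp_lin t c h k N (w : Omega N) :
  emp t (fun x => c * h x + k x) w = c * emp t h w + emp t k w.
Proof. by rewrite /emp /MN big_split/= -mulr_sumr; ring. Qed.

End Asymptotics.

(** * Laws of large numbers and tightness *)

Section Tail.
Context {R : realType} {d} {T : measurableType d}.
Implicit Types (h : T -> R) (L : R).

(** The positive part of [h - L]: [h] splits into the truncation [Num.min (h x) L] and this tail. *)
Definition tail L h x := h x - Num.min (h x) L.

Lemma tail_measurable L h : measurable_fun setT h -> measurable_fun setT (tail L h).
Proof. by move=> mh; apply: measurable_funB => //; exact: measurable_minr. Qed.

Lemma tail_ge0 L h x : 0 <= tail L h x.
Proof. by rewrite subr_ge0 ge_min lexx. Qed.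

Lemma tail_le L h x : 0 <= L -> 0 <= h x -> tail L h x <= h x.
Proof. by move=> L0 h0; rewrite gerBl le_min h0. Qed.

(** Above [2 * L] the excess [y - L] is more than half of [y]. This converts the indicator in
    Lindeberg's condition into [tail]. *)
Lemma indic_le_tail L (y : R) : 0 <= L -> y * (2 * L < y)%R%:R <= 2 * (y - Num.min y L).
Proof.
move=> L0; have [h|h] := ltP (2 * L) y; last by rewrite mulr0 mulr_ge0// subr_ge0 ge_min lexx.
by rewrite mulr1 min_r; lra.
Qed.

Lemma integral_le_cst (Q : probability T R) (f : T -> R) (c : R) : measurable_fun setT f ->
  (forall x, 0 <= f x <= c) -> (\int[Q]_x (f x)%:E <= c%:E)%E.
Proof.
move=> mf fc.
have fn x : `|f x| <= c by case/andP: (fc x) => f0 ?; rewrite ger0_norm.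
by rewrite (integral_EFin_bounded Q mf fn) lee_fin (le_trans (ler_norm _))// Rintegral_bounded_le.
Qed.

Lemma tail_integrable (Q : {measure set T -> \bar R}) L h : measurable_fun setT h ->
  (forall x, 0 <= h x) -> Q.-integrable setT (EFin \o h) -> 0 <= L ->
  Q.-integrable setT (EFin \o tail L h).
Proof.
move=> mh h0 ih L0; apply: (real_integrable_le (tail_measurable L mh) ih) => x.
by rewrite ger0_norm ?tail_ge0// tail_le.
Qed.

Lemma tail_small (Q : probability T R) h (e : R) : measurable_fun setT h ->
  (forall x, 0 <= h x) -> Q.-integrable setT (EFin \o h) -> 0 < e ->
  exists L, 0 <= L /\ \int[Q]_x tail L h x <= e.
Proof.
move=> mh h0 ih e0.
have cv : (\int[Q]_x (tail n%:R h x)%:E)%E @[n --> \oo] --> (\int[Q]_x (cst 0 x : R)%:E)%E.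
  apply: (@dominated_cvg _ _ _ Q setT measurableT _ _ (EFin \o h)) => //.
  - by move=> n; apply/measurable_EFinP; exact: tail_measurable.
  - move=> x _; apply: cvg_EFin; first by near=> n.
    apply: cvg_near_cst; near=> n => /=.
    have hn : h x <= n%:R by near: n; exact: nbhs_infty_ger.
    by rewrite /tail min_l// subrr.
  - by move=> n x _; rewrite /= lee_fin ger0_norm ?tail_ge0// tail_le.
have {cv} /fine_cvgP[_] : (\int[Q]_x (tail n%:R h x)%:E)%E @[n --> \oo] --> (0 : R)%:E.
  by move: cv; rewrite [X in _ --> X -> _](_ : _ = 0%E)//; exact: integral0.
move=> /cvgrPdist_le /(_ e e0) [n _ /(_ n (leqnn n))] /=; rewrite sub0r normrN => hn.
by exists n%:R; split => //; exact: le_trans (ler_norm _) hn.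
Unshelve. all: by end_near.
Qed.

End Tail.

Section LLN.
Context {R : realType} {dE} {E : measurableType dE} (M : fmodel R E)
  (dO : nat -> measure_display) (Omega : forall N, measurableType (dO N))
  (P : forall N, probability (Omega N) R)
  (X : forall N, nat -> nat -> Omega N -> E).
Arguments X : clear implicits.
Local Notation mu := (fm_mu M).
Local Notation a0 := (fm_a0 M).
Local Notation a := (fm_a M).
Local Notation g := (fm_g M).
Local Notation pY := (pY mu a0 a g).
Local Notation Lop := (Lop mu a g).
Local Notation mf := (mf mu a0 a g).
Local Notation pi := (piM M).
Hypothesis HX : forall N, is_particle_filter mu a0 a g (P N) N (X N).
Local Notation K N t w := (KX M N (X N) t w).
Local Notation em t h := (fun N w => @emp _ _ _ _ _ X t h N w).

(** Integrability belongs to the event, since without it the integral could be a default value. *)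
Definition kernel_lln t (h : E -> R) := forall e : R, 0 < e -> whp P (fun N w =>
  (K N t w).-integrable setT (EFin \o h) /\ `|\int[K N t w]_x h x - \int[pi t]_x h x| <= e).

(** The particles follow their kernel: Chebyshev for the truncation at [L], Markov for the tail, so
    that a first moment is enough. The tail under the random kernel is controlled by the hypothesis
    applied to [tail L h]. *)
Lemma lln_step t : (forall h : E -> R, measurable_fun setT h -> (pi t).-integrable setT (EFin \o h) ->
    kernel_lln t h) ->
  forall h : E -> R, measurable_fun setT h -> (forall x, 0 <= h x) -> (pi t).-integrable setT (EFin \o h) ->
  cvgp P (em t h) (\int[pi t]_x h x).
Proof.
move=> IH h mh h0 ih e e0 dl dl0.
pose eps := e / 4; have eps0 : 0 < eps by rewrite divr_gt0.
(* [e / 8] serves the Chebyshev and kernel errors; [eps * dl / 8] makes the probability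
   [2 * eta / eps] from Markov's inequality at most [dl / 4]. *)
pose eta := Num.min (e / 8) (eps * dl / 8).
have eta0 : 0 < eta by rewrite lt_min !divr_gt0// mulr_gt0.
have eta1 : eta <= e / 8 by rewrite ge_min lexx.
have eta2 : eta <= eps * dl / 8 by rewrite ge_min lexx orbT.
have [L [L0 Lsmall]] := tail_small mh h0 ih eta0.
have mtail := tail_measurable L mh; have itail := tail_integrable mh h0 ih L0.
have dl4 : 0 < dl / 4 by rewrite divr_gt0.
pose N1 : R := 4 * L ^+ 2 / (eta ^+ 2 * dl).
apply: filterS3 (filterI (nbhs_infty_gt 0) (nbhs_infty_ger N1)) (IH _ mh ih _ eta0 _ dl4)
  (IH _ mtail itail _ eta0 _ dl4) => N [N0 NN1] H1 H2.
have Np : 0 < (N%:R : R) by rewrite ltr0n.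
have CI := particle_cond_iid (HX N) N0 t.
pose hL x := Num.min (h x) L.
have mhL : measurable_fun setT hL by exact: measurable_minr.
have hL0 x : 0 <= hL x by rewrite le_min h0.
have hLL x : hL x <= L by rewrite ge_min lexx orbT.
have H3 := cond_chebyshev CI mhL (mulr_gt0 Np eta0) (sqr_ge0 L).
have H4 := cond_markov CI mtail (@tail_ge0 _ _ _ L h) (mulr_gt0 Np eps0) (ltW (mulr_gt0 (ltr0n R 2) eta0)).
have [B [mB PB BS]] := exceptional_union (exceptional_union H1 H2) (exceptional_union H3 H4).
exists B; split => //.
  apply: (le_trans PB); rewrite lee_fin.
  have -> : N%:R * L ^+ 2 / (N%:R * eta) ^+ 2 = L ^+ 2 / eta ^+ 2 / N%:R.
    by field; rewrite !gt_eqF.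
  have -> : N%:R * (2 * eta) / (N%:R * eps) = 2 * eta / eps by field; rewrite !gt_eqF.
  have q1 : L ^+ 2 / eta ^+ 2 / N%:R <= dl / 4.
    rewrite ler_pdivrMr// (le_trans _ (ler_wpM2l (ltW dl4) NN1))// /N1 le_eqVlt; apply/orP; left.
    by apply/eqP; field; rewrite !gt_eqF.
  have q2 : 2 * eta / eps <= dl / 4 by rewrite ler_pdivrMr//; lra.
  lra.
move=> w /BS[[[iK hK] [itK htK]] [hC hM]].
have msq : measurable_fun setT (fun x => hL x ^+ 2) by exact: measurable_funX.
have {}hC : `|\sum_(k < N) hL (X N k t w) - N%:R * \int[K N t w]_x hL x| <= N%:R * eta.
  apply: hC; apply: integral_le_cst => // x; rewrite sqr_ge0/=.
  by rewrite lerXn2r ?nnegrE ?(le_trans (hL0 x)).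
have tK0 : 0 <= \int[K N t w]_x tail L h x by apply: Rintegral_ge0 => x _; exact: tail_ge0.
have tKle : \int[K N t w]_x tail L h x <= 2 * eta by move: htK; rewrite ler_norml; lra.
have {}hM : \sum_(k < N) tail L h (X N k t w) <= N%:R * eps.
  by apply: hM; rewrite (integral_ltyE itK) lee_fin.
have KE : \int[K N t w]_x hL x = \int[K N t w]_x h x - \int[K N t w]_x tail L h x.
  rewrite -RintegralB//; apply: eq_Rintegral => x _; rewrite /hL /tail; ring.
have eE : \sum_(k < N) h (X N k t w) = \sum_(k < N) hL (X N k t w) + \sum_(k < N) tail L h (X N k t w).
  by rewrite -big_split; apply: eq_bigr => k _; rewrite /= /hL /tail; ring.
have t0 : 0 <= \sum_(k < N) tail L h (X N k t w) by apply: sumr_ge0 => k _; exact: tail_ge0.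
have dv (S y r : R) : `|S - N%:R * y| <= N%:R * r -> `|S / N%:R - y| <= r.
  move=> hS; have -> : S / N%:R - y = (S - N%:R * y) / N%:R by field; rewrite gt_eqF.
  by rewrite normrM normfV (gtr0_norm Np) ler_pdivrMr// (mulrC r).
have {}hM : (\sum_(k < N) tail L h (X N k t w)) / N%:R <= eps by rewrite ler_pdivrMr// mulrC.
have {}t0 : 0 <= (\sum_(k < N) tail L h (X N k t w)) / N%:R by rewrite divr_ge0// ltW.
move: (dv _ _ _ hC) hK; rewrite /emp /MN eE KE mulrDl !ler_norml.
by move: tK0 tKle hM t0 eta1 eps0 e0; rewrite /eps; lra.
Qed.

Lemma KX0 N w A : (0 < N)%N -> K N 0 w A = pi 0 A.
Proof. by move=> N0; rewrite KXE// piME. Qed.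

Lemma lln_signed t : (forall h : E -> R, measurable_fun setT h -> (forall x, 0 <= h x) ->
    (pi t).-integrable setT (EFin \o h) -> cvgp P (em t h) (\int[pi t]_x h x)) ->
  forall h : E -> R, measurable_fun setT h -> (pi t).-integrable setT (EFin \o h) ->
  cvgp P (em t h) (\int[pi t]_x h x).
Proof.
move=> Hp h mh ih e e0; have e2 : 0 < e / 2 by rewrite divr_gt0.
pose hp x := Num.max (h x) 0; pose hn x := hp x - h x.
have mhp : measurable_fun setT hp by exact: measurable_maxr.
have mhn : measurable_fun setT hn by exact: measurable_funB.
have hp0 x : 0 <= hp x by rewrite le_max lexx orbT.
have hn0 x : 0 <= hn x by rewrite subr_ge0 le_max lexx.
have ia : (pi t).-integrable setT (EFin \o (fun x => `|h x|)).
  exact: integrable_norm.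
have ihp : (pi t).-integrable setT (EFin \o hp).
  apply: (real_integrable_le mhp ia) => x; rewrite (ger0_norm (hp0 x)) /hp.
  by rewrite ge_max ler_norm normr_ge0.
have ihn : (pi t).-integrable setT (EFin \o hn).
  apply: (real_integrable_le mhn ia) => x; rewrite (ger0_norm (hn0 x)) /hn /hp.
  have := ler_norm (- h x); rewrite normrN; have := normr_ge0 (h x).
  by have [h0|h0] := leP (h x) 0; rewrite ?(max_l (ltW h0)) ?(max_r h0); lra.
have Ih : \int[pi t]_x h x = \int[pi t]_x hp x - \int[pi t]_x hn x.
  by rewrite -RintegralB//; apply: eq_Rintegral => x _; rewrite /hn; ring.
apply: whp_imp (whp_and (Hp _ mhp hp0 ihp _ e2) (Hp _ mhn hn0 ihn _ e2)).
apply: nearW => N w [h1 h2].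
have -> : emp X t h w = emp X t hp w - emp X t hn w.
  rewrite /emp /MN -mulrBl -sumrB; congr (_ / _); apply: eq_bigr => k _; rewrite /hn; ring.
by move: h1 h2; rewrite Ih !ler_norml; lra.
Qed.

(** At time 0 the kernel is the filter. At [t.+1] its integrals are ratios of empirical means at
    time [t], whose limits, [pY] times the filter integral and [pY], come from the induction
    hypothesis through [lln_step]. *)
Lemma kernel_lln_all t (h : E -> R) : measurable_fun setT h -> (pi t).-integrable setT (EFin \o h) ->
  kernel_lln t h.
Proof.
elim: t h => [|t IH] h mh ih e e0.
  apply: whp_near; apply: filterS (nbhs_infty_gt 0) => N N0 w.
  have eqm A : measurable A -> A `<=` setT -> K N 0 w A = pi 0 A by move=> _ _; exact: KX0.
  split; last first.
    rewrite /Rintegral (_ : (\int[K N 0 w]_x (h x)%:E = \int[pi 0]_x (h x)%:E)%E) ?subrr ?normr0 ?ltW//.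
    exact: eq_measure_integral.
  case/integrableP: ih => mE ih; apply/integrableP; split => //.
  by rewrite (_ : (\int[K N 0 w]_x `|(EFin \o h) x| = \int[pi 0]_x `|(EFin \o h) x|)%E)//;
    exact: eq_measure_integral.
have lln := lln_signed (lln_step IH).
have [iL IL] := Lop_integral mh ih.
have i1 : (pi t.+1).-integrable setT (EFin \o (cst 1 : E -> R)).
  exact: finite_measure_integrable_cst.
have [iL1 IL1] := Lop_integral (@measurable_cst _ _ _ _ setT (1 : R)) i1.
have c1 := lln _ (Lop_measurable M t mh) iL.
have c2 := lln _ (Lop_measurable M t (@measurable_cst _ _ _ _ setT (1 : R))) iL1.
rewrite IL in c1; rewrite IL1 Rintegral_prob_cst mulr1 in c2.
have c3 := cvgp_ratio (pY_gt0 M t) c1 c2.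
have c4 : whp P (fun N w => (K N t.+1 w).-integrable setT (EFin \o h) /\
    \int[K N t.+1 w]_x h x = emp X t (Lop t.+1 h) w / emp X t (Lop t.+1 (cst 1)) w).
  by apply: whp_null => N N0; exact: (KX_Lop HX N0 mh ih).
apply: whp_imp (whp_and c4 (c3 _ e0)); apply: nearW => N w [[? ->] ?].
by split.
Qed.

Lemma lln t (h : E -> R) : measurable_fun setT h -> (pi t).-integrable setT (EFin \o h) ->
  cvgp P (em t h) (\int[pi t]_x h x).
Proof. by apply: lln_signed; apply: lln_step => k; exact: kernel_lln_all. Qed.

Definition fluc t (psi : E -> R) N (w : Omega N) : R :=
  Num.sqrt N%:R * (emp X t psi w - mf t psi).

(** The conditional mean of [fluc] given the past, that is, the rescaled conditional bias. *)
Definition kfluc t (psi : E -> R) N (w : Omega N) : R :=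
  Num.sqrt N%:R * (\int[K N t w]_x psi x - mf t psi).

Lemma kfluc0 psi N (w : Omega N) : (0 < N)%N -> measurable_fun setT psi -> kfluc 0 psi w = 0.
Proof.
move=> N0 mpsi; rewrite /kfluc mf_piM// /Rintegral.
rewrite (_ : (\int[K N 0 w]_x (psi x)%:E = \int[pi 0]_x (psi x)%:E)%E) ?subrr ?mulr0//.
by apply: eq_measure_integral => A _ _; exact: KX0.
Qed.

Lemma mf_Dop t psi : L2 (pi t.+1) psi -> mf t (Dop M t.+1 psi) = 0.
Proof.
move=> Lpsi; have LD := Dop_L2 Lpsi; rewrite (mf_piM M _ (L2_measurable LD)) DopE.
have mc := L2_measurable (L2B_cst (mf t.+1 psi) Lpsi).
have [iL IL] := Lop_integral mc (L2_integrable (L2B_cst (mf t.+1 psi) Lpsi)).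
have Im : \int[pi t.+1]_x (psi x - mf t.+1 psi) = 0.
  rewrite (mf_piM M _ (L2_measurable Lpsi)) RintegralB ?Rintegral_prob_cst ?subrr//.
  - exact: L2_integrable.
  - exact: L2_integrable (L2_cst _ _).
rewrite Im mulr0 in IL; move: iL IL.
set F := Lop _ _; set p := pY _; clearbody F p => iF IF.
under eq_Rintegral do rewrite mulrC.
by rewrite RintegralZl// IF mulr0.
Qed.

(* [pY / emp (L 1)] tends to one, so conditioning on the past transports the
   fluctuation of [psi] at time [t.+1] to that of [Dop psi] at time [t]. *)
Lemma kflucS t psi N : (0 < N)%N -> L2 (pi t.+1) psi ->
  exists B, [/\ measurable B, P N B = 0%E & forall w, ~ B w ->
    kfluc t.+1 psi w = fluc t (Dop M t.+1 psi) w * (pY t.+1 / emp X t (Lop t.+1 (cst 1)) w)].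
Proof.
move=> N0 Lpsi; have Lc := L2B_cst (mf t.+1 psi) Lpsi.
have [B [mB PB BK]] := KX_Lop HX N0 (L2_measurable Lc) (L2_integrable Lc).
have [B' [mB' PB' BK']] := KX_Lop HX N0 (L2_measurable Lpsi) (L2_integrable Lpsi).
exists (B `|` B'); split; first exact: measurableU.
  apply/eqP; rewrite eq_le measure_ge0 andbT (le_trans (measureU2 _ _ _))//.
  by rewrite [X in (X + _)%E]PB [X in (_ + X)%E]PB' adde0.
move=> w /not_orP[/BK[iK KE] /BK'[iK' _]].
have e : \int[K N t.+1 w]_x psi x - mf t.+1 psi = \int[K N t.+1 w]_x (psi x - mf t.+1 psi).
  rewrite RintegralB// ?Rintegral_prob_cst//; exact: L2_integrable (L2_cst _ _).
rewrite /kfluc /fluc (mf_Dop Lpsi) subr0 e KE.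
have -> : emp X t (Dop M t.+1 psi) w = emp X t (Lop t.+1 (fun x => psi x - mf t.+1 psi)) w / pY t.+1.
  by rewrite /emp /MN DopE -mulr_suml; ring.
have := pY_gt0 M t; move: (emp X t _ w) (emp X t _ w) (pY t.+1) => L A p p0.
by rewrite -mulrA (mulrA (A / p)) divfK// gt_eqF.
Qed.

Lemma ratio_cvg1 t : cvgp P (fun N w => pY t.+1 / emp X t (Lop t.+1 (cst 1)) w) 1.
Proof.
have i1 : (pi t.+1).-integrable setT (EFin \o (cst 1 : E -> R)).
  exact: finite_measure_integrable_cst.
have [iL1 IL1] := Lop_integral (@measurable_cst _ _ _ _ setT (1 : R)) i1.
have c2 := lln (Lop_measurable M t (@measurable_cst _ _ _ _ setT (1 : R))) iL1.
rewrite IL1 Rintegral_prob_cst mulr1 in c2.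
apply: (cvgp_ratio (pY_gt0 M t)) c2 => e e0; apply: whp_near; apply: nearW => N w.
by rewrite mulr1 subrr normr0 ltW.
Qed.

(** Given the past, [fluc - kfluc] is a normalised centered sum; its conditional second moment is at
    most that of [psi] under the kernel, which is bounded with high probability. *)
Lemma fluc_kfluc_tight t psi : L2 (pi t) psi -> tightp P (fun N w => kfluc t psi (N := N) w) ->
  tightp P (fun N w => fluc t psi (N := N) w).
Proof.
move=> Lpsi tK; have mpsi := L2_measurable Lpsi.
have isq := L2_sqr_integrable Lpsi.
suff tS : tightp P (fun N w => fluc t psi (N := N) w - kfluc t psi (N := N) w).
  apply: tightp_le (tightpD tS tK) => //.
  by apply: whp_near; apply: nearW => N w; rewrite mul1r subrK.
move=> dl dl0; have dl2 : 0 < dl / 2 by rewrite divr_gt0.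
pose c := \int[pi t]_x (psi x ^+ 2) + 1.
have c0 : 0 < c by rewrite ltr_wpDl// Rintegral_ge0// => x _; exact: sqr_ge0.
pose R0 := Num.sqrt (2 * c / dl).
have R00 : 0 < R0 by rewrite sqrtr_gt0 divr_gt0// mulr_gt0.
have R02 : R0 ^+ 2 = 2 * c / dl by rewrite sqr_sqrtr// divr_ge0 ?mulr_ge0 ?ltW.
exists R0; apply: filterS2 (nbhs_infty_gt 0)
  (kernel_lln_all (measurable_funX 2 mpsi) isq ltr01 dl2) => N N0 H1.
have Np : 0 < (N%:R : R) by rewrite ltr0n.
have sN : 0 < Num.sqrt (N%:R : R) by rewrite sqrtr_gt0.
have sN2 : Num.sqrt (N%:R : R) ^+ 2 = N%:R by rewrite sqr_sqrtr// ltW.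
have CI := particle_cond_iid (HX N) N0 t.
have H2 := cond_chebyshev CI mpsi (mulr_gt0 sN R00) (ltW c0).
have [B [mB PB BS]] := exceptional_union H1 H2; exists B; split => //.
  apply: (le_trans PB); rewrite lee_fin exprMn sN2 R02.
  rewrite le_eqVlt; apply/orP; left; apply/eqP; field.
  by rewrite !gt_eqF.
move=> w /BS[[iK hK] hC].
have {}hC : `|\sum_(k < N) psi (X N k t w) - N%:R * \int[K N t w]_x psi x| <= Num.sqrt N%:R * R0.
  apply: hC; rewrite (integral_ltyE iK) lee_fin /c.
  by move: hK; rewrite ler_norml; lra.
have -> : fluc t psi w - kfluc t psi w =
    (\sum_(k < N) psi (X N k t w) - N%:R * \int[K N t w]_x psi x) / Num.sqrt N%:R.
  rewrite /fluc /kfluc /emp /MN -mulrBr opprB addrA subrK -{2 3}sN2; field.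
  by rewrite gt_eqF.
by rewrite normrM normfV (gtr0_norm sN) ler_pdivrMr// (mulrC R0).
Qed.

(** By [kflucS] the bias at [t.+1] is the fluctuation of [Dop psi] at [t] times a ratio, which is at
    most 2 with high probability. *)
Lemma fluc_tight t psi : L2 (pi t) psi -> tightp P (fun N w => fluc t psi (N := N) w).
Proof.
elim: t psi => [|t IH] psi Lpsi; apply: fluc_kfluc_tight => //.
  move=> dl dl0; exists 0; apply: filterS (nbhs_infty_gt 0) => N N0; exists set0; split => //.
    by rewrite measure0 lee_fin ltW.
  by move=> w _; rewrite kfluc0 ?normr0//; exact: L2_measurable Lpsi.
apply: (@tightp_le _ _ _ _ (fun N w => fluc t (Dop M t.+1 psi) (N := N) w) _ 2) => //;
  last exact: (IH _ (Dop_L2 Lpsi)).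
have n1 : whp P (fun N w => kfluc t.+1 psi (N := N) w = fluc t (Dop M t.+1 psi) w *
    (pY t.+1 / emp X t (Lop t.+1 (cst 1)) w)).
  by apply: whp_null => N N0; exact: kflucS.
apply: whp_imp (whp_and n1 (ratio_cvg1 t ltr01)); apply: nearW => N w [-> h].
rewrite normrM mulrC ler_wpM2r//.
by move: h; move: (pY _ / _) => r; rewrite !ler_norml; lra.
Qed.

End LLN.

(** * Central limit theorem *)

Section CosBounds.
Context {R : realType}.

Lemma normr_sin_le (x : R) : `|sin x| <= `|x|.
Proof.
have [x0|/ltW x0] := leP 0 x; last first.
  rewrite -normrN -sinN -[leRHS]normrN; move: x0; rewrite -oppr_ge0; move: (- x) => {}x x0.
  rewrite (ger0_norm x0) ler_norml sin_le_id// andbT.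
  have := sin_ge_cubic x0; have := sin_geN1 x; nra.
rewrite (ger0_norm x0) ler_norml sin_le_id// andbT.
have := sin_ge_cubic x0; have := sin_geN1 x; nra.
Qed.

Lemma cos_lip (x y : R) : `|cos x - cos y| <= `|x - y|.
Proof.
pose u := (x + y) / 2; pose h := (x - y) / 2.
have -> : cos x - cos y = - (2 * (sin u * sin h)).
  have -> : x = u + h by rewrite /u /h; field.
  have -> : y = u - h by rewrite /u /h; field.
  by rewrite cosD cosB; ring.
have hE : `|x - y| = 2 * `|h|.
  by rewrite /h normrM normfV [`|2|]ger0_norm//; field.
rewrite normrN !normrM [`|2|]ger0_norm// hE ler_pM2l// -[leRHS]mul1r.
by apply: ler_pM => //; [rewrite ler_norml sin_geN1 sin_le1|exact: normr_sin_le].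
Qed.

Lemma expRN_lip (x y : R) : 0 <= x -> 0 <= y -> `|expR (- x) - expR (- y)| <= `|x - y|.
Proof.
wlog xy : x y / x <= y => [h|] x0 y0.
  have [xy|/ltW yx] := leP x y; first exact: h.
  by rewrite distrC (distrC x); exact: h.
have e1 : expR (- x) <= 1 by rewrite -[leRHS]expR0 ler_expR oppr_le0.
have e2 := expR_ge1Dx (x - y).
have -> : expR (- x) - expR (- y) = expR (- x) * (1 - expR (x - y)).
  by rewrite mulrBr mulr1 -expRD; congr (_ - expR _); ring.
have e3 : expR (x - y) <= 1 by rewrite -[leRHS]expR0 ler_expR subr_le0.
rewrite ger0_norm ?mulr_ge0 ?expR_ge0 ?subr_ge0// ler0_norm ?subr_le0//.
have := expR_ge0 (- x); nra.
Qed.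

Lemma normr_cos_le1 (x : R) : `|cos x| <= 1.
Proof. by rewrite ler_norml cos_geN1 cos_le1. Qed.

(** The linear term has mean zero and the quadratic one gives [1 - v], compared with [exp (- v)] at
    cost [v ^+ 2]. The majorant [k] stands for the Lindeberg term. *)
Lemma Rintegral_cos_second_order {d} {T : measurableType d} (Q : probability T R) (b k : T -> R)
    (v dd al : R) : L2 Q b -> \int[Q]_z b z = 0 -> v = (\int[Q]_z (b z ^+ 2)) / 2 -> 0 <= dd ->
  Q.-integrable setT (EFin \o k) ->
  (forall z, b z ^+ 2 * (dd < `|b z|)%R%:R <= k z) ->
  `|\int[Q]_z cos (al + b z) - expR (- v) * cos al| <= 2 * (\int[Q]_z k z + 2 * dd * v) + v ^+ 2.
Proof.
move=> Lb b0 vE dd0 ik bk.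
have mb := L2_measurable Lb; have ib := L2_integrable Lb; have ib2 := L2_sqr_integrable Lb.
have v0 : 0 <= v by rewrite vE divr_ge0// Rintegral_ge0// => x _; exact: sqr_ge0.
pose f x := cos (al + b x).
pose h x := - sin al * b x + (- (cos al / 2) * b x ^+ 2 + cos al).
have mf : measurable_fun setT f.
  by apply: (measurableT_comp (@measurable_cosT R)); exact: measurable_funD.
have if_ : Q.-integrable setT (EFin \o f).
  exact: (bounded_integrable Q mf (fun x => normr_cos_le1 _)).
have ic : Q.-integrable setT (EFin \o (fun=> cos al)) by exact: L2_integrable (L2_cst _ _).
have ih2 : Q.-integrable setT (EFin \o (fun x => - (cos al / 2) * b x ^+ 2 + cos al)).
  by apply: real_integrableD => //; exact: real_integrableZl.
have ih : Q.-integrable setT (EFin \o h).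
  by apply: real_integrableD => //; exact: real_integrableZl.
have Ih : \int[Q]_x h x = (1 - v) * cos al.
  rewrite RintegralD//; last exact: real_integrableZl.
  rewrite RintegralD//; last exact: real_integrableZl.
  by rewrite !RintegralZl// b0 Rintegral_prob_cst vE; field.
have ie : Q.-integrable setT (EFin \o (fun x => 2 * (k x + dd * b x ^+ 2))).
  by apply: real_integrableZl; apply: real_integrableD => //; exact: real_integrableZl.
have ifh : Q.-integrable setT (EFin \o (fun x => f x - h x)).
  by rewrite (_ : (fun x => f x - h x) = (fun x => -1 * h x + f x));
   [apply: real_integrableD => //; exact: real_integrableZl|apply/funext => x; ring].
have s1 : `|\int[Q]_x f x - \int[Q]_x h x| <= 2 * (\int[Q]_x k x + 2 * dd * v).
  rewrite -RintegralB//; apply: (le_trans (le_normr_Rintegral _ ifh)) => //.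
  apply: (@le_trans _ _ (\int[Q]_x (2 * (k x + dd * b x ^+ 2)))).
    apply: le_Rintegral => //; first exact: integrable_norm.
    move=> x _; have := cosD_taylor2 al (b x) dd0; have := bk x; rewrite /f /h.
    rewrite [_ - _ - _](_ : _ = - sin al * b x + (- (cos al / 2) * b x ^+ 2 + cos al)); last by field.
    move=> h1 h2; apply: (le_trans h2); lra.
  rewrite RintegralZl//; last by apply: real_integrableD => //; exact: real_integrableZl.
  rewrite RintegralD//; last exact: real_integrableZl.
  by rewrite RintegralZl// vE le_eqVlt; apply/orP; left; apply/eqP; field.
have s2 : `|(1 - v) * cos al - expR (- v) * cos al| <= v ^+ 2.
  rewrite -mulrBl normrM distrC -[leRHS]mulr1.
  by apply: ler_pM => //; [exact: expRN_taylor1|exact: normr_cos_le1].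
rewrite -[X in `|X|](subrKA (\int[Q]_x h x)).
apply: (le_trans (ler_normD _ _)); apply: lerD => //.
by rewrite Ih.
Qed.

End CosBounds.

Section CLT.
Context {R : realType} {dE} {E : measurableType dE} (M : fmodel R E)
  (dO : nat -> measure_display) (Omega : forall N, measurableType (dO N))
  (P : forall N, probability (Omega N) R)
  (X : forall N, nat -> nat -> Omega N -> E).
Arguments X : clear implicits.
Local Notation mu := (fm_mu M).
Local Notation a0 := (fm_a0 M).
Local Notation a := (fm_a M).
Local Notation g := (fm_g M).
Local Notation pY := (pY mu a0 a g).
Local Notation Lop := (Lop mu a g).
Local Notation mf := (mf mu a0 a g).
Local Notation pi := (piM M).
Hypothesis HX : forall N, is_particle_filter mu a0 a g (P N) N (X N).
Local Notation K N t w := (KX M N (X N) t w).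
Local Notation fl t psi w := (fluc M X t psi w).
Local Notation kfl t psi w := (kfluc M X t psi w).

Lemma kernel_cov t phi : L2 (pi t) phi -> forall e : R, 0 < e ->
  whp P (fun N w => L2 (K N t w) phi /\ `|cov (K N t w) phi phi - cov (pi t) phi phi| <= e).
Proof.
move=> Lphi e e0; have mphi := L2_measurable Lphi.
pose m := \int[pi t]_x phi x; pose k := 2 * `|m| + 2.
have k0 : 0 < k by rewrite /k; have := normr_ge0 m; lra.
(* The difference of squared means factors as [(u - m) * (u - m + 2 * m)]; since [e1 <= 1], the
   total error is at most [e1 * (2 + 2 * |m|)]. *)
pose e1 := Num.min 1 (e / k).
have e10 : 0 < e1 by rewrite lt_min ltr01 divr_gt0.
have e11 : e1 <= 1 by rewrite ge_min lexx.
have e12 : e1 * k <= e by rewrite -ler_pdivlMr// ge_min lexx orbT.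
have h1 := kernel_lln_all HX mphi (L2_integrable Lphi) e10.
have h2 := kernel_lln_all HX (measurable_funX 2 mphi) (L2_sqr_integrable Lphi) e10.
apply: whp_imp (whp_and h1 h2); apply: nearW => N w [[i1 c1] [i2 c2]]; split.
  by split => //; rewrite (integral_ltyE i2) ltry.
rewrite /cov -!expr2 -/m.
move: c1 c2; rewrite -/m; set u := \int[_]_x phi x; set q := \int[K N t w]_x _; set q' := \int[_]_x _.
move=> c1 c2.
rewrite (_ : q - u ^+ 2 - (q' - m ^+ 2) = (q - q') - (u - m) * (u - m + 2 * m)); last by ring.
apply: (le_trans (ler_normB _ _)); rewrite normrM.
have c3 : `|u - m + 2 * m| <= 1 + 2 * `|m|.
  apply: (le_trans (ler_normD _ _)); rewrite normrM [`|2|]ger0_norm// lerD2r.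
  exact: le_trans c1 e11.
apply: (le_trans _ e12); rewrite /k.
have := ler_pM (normr_ge0 _) (normr_ge0 _) c1 c3; lra.
Qed.

Section Step.
Variables (t : nat) (phi : E -> R) (A : forall N, Omega N -> R).
Arguments A : clear implicits.
Hypothesis Lphi : L2 (pi t) phi.
Hypothesis mA : forall N, (0 < N)%N ->
  measurable_fun setT (A N : g_sigma_algebraType (cylG N (X N) t 0) -> R).

(** The second-order expansion for the increment [(phi - m) / sqrt N], with [m] the kernel mean. The
    first condition on [N] makes [|m|] at most half of [dd * sqrt N]; with the second, an increment
    above [dd] forces [phi ^+ 2 > 2 * L], so that the tail dominates it. *)
Lemma clt_step_bound N (w : Omega N) (c L eta dd al : R) : 0 < c -> 0 <= L -> 0 < dd -> (0 < N)%N ->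
  (\int[K N t w]_x (phi x ^+ 2)%:E <= c%:E)%E ->
  (\int[K N t w]_x (tail L (fun x => phi x ^+ 2) x)%:E <= (2 * eta)%:E)%E ->
  2 * Num.sqrt c <= dd * Num.sqrt N%:R -> 8 * L <= dd ^+ 2 * N%:R ->
  `|\int[K N t w]_x cos (al + (phi x - \int[K N t w]_z phi z) / Num.sqrt N%:R) -
    expR (- (cov (K N t w) phi phi / (2 * N%:R))) * cos al| <=
  (32 * eta + 2 * dd * c + c ^+ 2 / (4 * N%:R)) / N%:R.
Proof.
move=> c0 L0 dd0 N0 Kc Ktail ddN LN; have mphi := L2_measurable Lphi.
have Np : 0 < (N%:R : R) by rewrite ltr0n.
have sN : 0 < Num.sqrt (N%:R : R) by rewrite sqrtr_gt0.
have sN2 : Num.sqrt (N%:R : R) ^+ 2 = N%:R by rewrite sqr_sqrtr// ltW.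
move: (K N t w) Kc Ktail => Q Qc Qtail.
have LQ : L2 Q phi by split => //; exact: le_lt_trans Qc (ltry _).
pose m := \int[Q]_x phi x.
have Q2 := integral_ltyE (L2_sqr_integrable LQ).
have q2 : \int[Q]_x (phi x ^+ 2) <= c by rewrite -lee_fin -Q2.
have m2 : m ^+ 2 <= c.
  have := sqr_Rintegral_le mphi ltr01 (probability_le1 Q measurableT).
  by rewrite mul1e Q2 lee_fin => h; exact: le_trans h q2.
have mc : `|m| <= Num.sqrt c by rewrite -sqrtr_sqr ler_wsqrtr.
have cov0 := cov_ge0 LQ.
have covc : cov Q phi phi <= c.
  by apply: le_trans q2; rewrite /cov -expr2 gerBl sqr_ge0.
have msq : measurable_fun setT (fun x => phi x ^+ 2) by exact: measurable_funX.
have sq0 x : 0 <= phi x ^+ 2 by exact: sqr_ge0.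
have itail := tail_integrable msq sq0 (L2_sqr_integrable LQ) L0.
have qt : \int[Q]_x tail L (fun x => phi x ^+ 2) x <= 2 * eta by rewrite -lee_fin -(integral_ltyE itail).
pose b x := (Num.sqrt (N%:R : R))^-1 * (phi x - m).
have Lb : L2 Q b by apply: L2Z; exact: L2B_cst.
have Ib0 : \int[Q]_x b x = 0.
  rewrite RintegralZl//; last exact: L2_integrable (L2B_cst _ LQ).
  rewrite RintegralB ?Rintegral_prob_cst ?subrr ?mulr0//; first exact: L2_integrable.
  exact: L2_integrable (L2_cst _ _).
have Ic : \int[Q]_x ((phi x - m) ^+ 2) = cov Q phi phi.
  by rewrite /Rintegral (integral_sqr_centered LQ).
have Ib2 : \int[Q]_x (b x ^+ 2) = N%:R^-1 * cov Q phi phi.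
  rewrite -Ic -RintegralZl//; last exact: L2_sqr_integrable (L2B_cst _ LQ).
  by apply: eq_Rintegral => x _; rewrite /b exprMn exprVn sN2.
(* 8 is 4, from [(phi - m) ^+ 2 <= 4 * phi ^+ 2] on large increments, times 2, from
   [indic_le_tail]. *)
pose k x := 8 / N%:R * tail L (fun x => phi x ^+ 2) x.
have ik : Q.-integrable setT (EFin \o k) by exact: real_integrableZl.
have bk x : b x ^+ 2 * (dd < `|b x|)%R%:R <= k x.
  have k0 : 0 <= k x by rewrite mulr_ge0 ?divr_ge0 ?tail_ge0// ltW.
  have [h|h] := ltP dd `|b x|; last by rewrite mulr0.
  have hb : dd * Num.sqrt N%:R < `|phi x - m|.
    by move: h; rewrite /b normrM normfV (gtr0_norm sN) mulrC ltr_pdivlMr.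
  have p1 : dd * Num.sqrt N%:R / 2 < `|phi x|.
    have := ler_normB (phi x) m; lra.
  have p2 : `|phi x - m| <= 2 * `|phi x|.
    have := ler_normB (phi x) m; lra.
  have p3 : (phi x - m) ^+ 2 <= 4 * phi x ^+ 2.
    rewrite -[(phi x - m) ^+ 2]real_normK ?num_real// -[phi x ^+ 2]real_normK ?num_real//.
    have := normr_ge0 (phi x - m); have := normr_ge0 (phi x); nra.
  have p4 : 2 * L < phi x ^+ 2.
    have : (dd * Num.sqrt N%:R / 2) ^+ 2 < `|phi x| ^+ 2.
      by rewrite ltrXn2r// ?nnegrE ?normr_ge0// ?divr_ge0 ?mulr_ge0 ?ltW.
    by rewrite real_normK ?num_real// !exprMn sN2 exprVn; lra.
  have p5 := indic_le_tail (phi x ^+ 2) L0; rewrite p4 mulr1 in p5.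
  rewrite mulr1 /b exprMn exprVn sN2 /k (mulrC 8) -mulrA ler_wpM2l ?invr_ge0 ?(ltW Np)// /tail.
  by lra.
have := Rintegral_cos_second_order al Lb Ib0 (erefl _) (ltW dd0) ik bk.
rewrite Ib2 (_ : (N%:R^-1 * cov Q phi phi) / 2 = cov Q phi phi / (2 * N%:R)); last by field; rewrite gt_eqF.
under eq_Rintegral => x _ do rewrite /b (mulrC _ (phi x - m)).
move/le_trans; apply.
rewrite RintegralZl// -subr_ge0.
rewrite (_ : _ - _ = (16 * (2 * eta - \int[Q]_x tail L (fun x => phi x ^+ 2) x) +
  2 * dd * (c - cov Q phi phi) + (c ^+ 2 - cov Q phi phi ^+ 2) / (4 * N%:R)) / N%:R); last by field; rewrite gt_eqF.
rewrite divr_ge0 ?(ltW Np)// !addr_ge0//.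
- by rewrite mulr_ge0// subr_ge0.
- by rewrite !mulr_ge0 ?subr_ge0// ltW.
- by rewrite divr_ge0 ?mulr_ge0 ?(ltW Np)// subr_ge0 lerXn2r ?nnegrE ?(ltW c0).
Qed.

Lemma clt_step (eps : R) : 0 < eps -> \forall N \near \oo,
  `|\int[P N]_w cos (A N w + (fl t phi w - kfl t phi w)) -
    expR (- (cov (pi t) phi phi / 2)) * \int[P N]_w cos (A N w)| <= eps.
Proof.
move=> eps0; have mphi := L2_measurable Lphi.
have msq : measurable_fun setT (fun x => phi x ^+ 2) by exact: measurable_funX.
have sq0 x : 0 <= phi x ^+ 2 by exact: sqr_ge0.
have isq := L2_sqr_integrable Lphi.
pose c := \int[pi t]_x (phi x ^+ 2) + 1.
have c0 : 0 < c by rewrite ltr_wpDl// Rintegral_ge0// => x _; exact: sqr_ge0.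
(* [eta] and [dd] make the first two error terms of [clt_step_bound] equal to [2 / 25 * eps] each;
   the third is at most [eps / 12] for large [N], and the sum stays below [eps / 4]. *)
pose eta := eps / 400; have eta0 : 0 < eta by rewrite divr_gt0.
pose dd := eps / (25 * c); have dd0 : 0 < dd by rewrite divr_gt0// mulr_gt0.
have [L [L0 Lsmall]] := tail_small msq sq0 isq eta0.
pose h := tail L (fun x => phi x ^+ 2).
have mh : measurable_fun setT h by exact: tail_measurable.
have h0 x : 0 <= h x by exact: tail_ge0.
have ih : (pi t).-integrable setT (EFin \o h) by exact: tail_integrable.
(* An event of the past, of probability tending to one, on which [clt_step_bound] applies. *)
pose S N := [set w : Omega N | (\int[K N t w]_x (phi x ^+ 2)%:E <= c%:E)%E] `&`
  [set w : Omega N | (\int[K N t w]_x (h x)%:E <= (2 * eta)%:E)%E].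
have whpS : whp P (fun N w => S N w).
  apply: whp_imp (whp_and (kernel_lln_all HX msq isq ltr01) (kernel_lln_all HX mh ih eta0)).
  apply: nearW => N w [[i1 c1] [i2 c2]]; split => /=; rewrite integral_ltyE// lee_fin.
    by move: c1; rewrite /c ler_norml; lra.
  by move: c2; rewrite ler_norml; lra.
have e16 : 0 < eps / 16 by rewrite divr_gt0.
have e4 : 0 < eps / 4 by rewrite divr_gt0.
apply: filterS3 (filterI (nbhs_infty_gt 0) (filterI (near_sqrt (2 * Num.sqrt c / dd))
   (filterI (nbhs_infty_ger (8 * L / dd ^+ 2)) (nbhs_infty_ger (3 * c ^+ 2 / eps)))))
  (whpS _ e16) (whp_and whpS (kernel_cov Lphi e4) e16) => N [N0 [N1 [N2 N3]]] H1 H2.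
have Np : 0 < (N%:R : R) by rewrite ltr0n.
have sN : 0 < Num.sqrt (N%:R : R) by rewrite sqrtr_gt0.
have sN2 : Num.sqrt (N%:R : R) ^+ 2 = N%:R by rewrite sqr_sqrtr// ltW.
have CI := particle_cond_iid (HX N) N0 t.
have mS : measurable (S N : set (g_sigma_algebraType (cylG N (X N) t 0))).
  apply: measurableI.
  - have := emeasurable_fun_infty_c measurableT (ci_K0 CI (h := fun x => (phi x ^+ 2)%:E)
      (proj2 (measurable_EFinP _ _) msq) (fun x => sq0 x)) c%:E.
    by rewrite setTI.
  - have := emeasurable_fun_infty_c measurableT (ci_K0 CI (h := fun x => (h x)%:E)
      (proj2 (measurable_EFinP _ _) mh) (fun x => h0 x)) (2 * eta)%:E.
    by rewrite setTI.
(* In this form measurability in [w] comes from [ci_K]; the identification with [cov] needs [phi]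
   square integrable under the kernel. *)
pose V (w : Omega N) := (\int[K N t w]_x ((phi x - \int[K N t w]_z phi z) ^+ 2)%:E)%E.
pose v (w : Omega N) := fine (V w) / (2 * N%:R).
have mm := ci_KR CI mphi.
pose beta (z : g_sigma_algebraType (cylG N (X N) t 0) * E) :=
  (phi z.2 - \int[K N t z.1]_x phi x) / Num.sqrt N%:R.
have mdiff : measurable_fun setT (fun z : g_sigma_algebraType (cylG N (X N) t 0) * E =>
    phi z.2 - \int[K N t z.1]_x phi x).
  apply: measurable_funB; first exact: measurableT_comp.
  exact: (measurableT_comp mm measurable_fst).
have mbeta : measurable_fun setT beta by exact: measurable_funM.
have mv : measurable_fun setT (v : g_sigma_algebraType (cylG N (X N) t 0) -> R).
  apply: measurable_funM => //; apply: measurableT_comp => //.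
  apply: (ci_K CI (Psi := fun z : g_sigma_algebraType (cylG N (X N) t 0) * E =>
    ((phi z.2 - \int[K N t z.1]_x phi x) ^+ 2)%:E)).
  - by apply/measurable_EFinP; exact: measurable_funX.
  - by move=> z; rewrite lee_fin sqr_ge0.
have v0 w : 0 <= v w.
  rewrite divr_ge0// fine_ge0// integral_ge0// => x _; rewrite lee_fin; exact: sqr_ge0.
have SL w : S N w -> L2 (K N t w) phi by case=> h1 _; split => //; exact: le_lt_trans h1 (ltry _).
have vE w : L2 (K N t w) phi -> v w = cov (K N t w) phi phi / (2 * N%:R).
  by move=> LK; rewrite /v /V (integral_sqr_centered LK).
pose e := (32 * eta + 2 * dd * c + c ^+ 2 / (4 * N%:R)) / N%:R.
have e0 : 0 <= e.
  have q1 : 0 <= dd * c by rewrite mulr_ge0// ltW.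
  have q2 : 0 <= c ^+ 2 / (4 * N%:R) by rewrite divr_ge0 ?sqr_ge0.
  by rewrite /e divr_ge0//; lra.
have Ne : N%:R * e <= eps / 4.
  rewrite /e mulrC divfK ?gt_eqF//.
  have q1 : 2 * dd * c = 2 / 25 * eps by rewrite /dd; field; rewrite gt_eqF.
  have q2 : c ^+ 2 / (4 * N%:R) <= eps / 12.
    rewrite ler_pdivrMr ?mulr_gt0//.
    move: N3; rewrite ler_pdivrMr//; lra.
  by rewrite q1 /eta; lra.
have bnd w : S N w -> forall al, `|\int[K N t w]_x cos (al + beta (w, x)) - expR (- v w) * cos al| <= e.
  move=> Sw al; rewrite (vE w (SL _ Sw)); case: Sw => S1 S2.
  apply: (clt_step_bound al c0 L0 dd0 N0 S1 S2).
  - by move: N1; rewrite ler_pdivrMr// (mulrC dd).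
  - by move: N2; rewrite ler_pdivrMr ?exprn_gt0// (mulrC (dd ^+ 2)).
have := cond_cos CI e0 (mA N0) mv v0 mbeta mS bnd.
have -> : \int[P N]_w (\1_(S N) w * cos (A N w + \sum_(k < N) beta (w, X N k t w))) =
    \int[P N]_w (\1_(S N) w * cos (A N w + (fl t phi w - kfl t phi w))).
  apply: eq_Rintegral => w _; congr (_ * cos (_ + _)).
  rewrite /beta/= -mulr_suml sumrB sumr_const card_ord /fluc /kfluc /emp /MN -mulrBr opprB addrA subrK.
  move: (\sum_(k < N) _) (\int[_]_x _) sN sN2 => a1 a2.
  move: (Num.sqrt _) => s s0 s2; rewrite -(mulr_natl a2 N) -s2; field.
  by rewrite gt_eqF.
set F := fun w => cos (A N w + (fl t phi w - kfl t phi w)).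
move=> sB.
have mAN : measurable_fun setT (A N) := ci_meas0 CI (mA N0).
have mk : measurable_fun setT (fun w : Omega N => kfl t phi w).
  have mm' : measurable_fun setT (fun w : Omega N => \int[K N t w]_x phi x) := ci_meas0 CI mm.
  by apply: measurable_funM => //; exact: measurable_funB.
have mfl : measurable_fun setT (fun w : Omega N => fl t phi w).
  by apply: measurable_funM => //; apply: measurable_funB => //; exact: (emp_measurable HX).
have mI : measurable_fun setT (\1_(S N) : Omega N -> R) := ci_meas0 CI (ci_indic mS).
have mcosT (f : Omega N -> R) : measurable_fun setT f -> measurable_fun setT (fun w => cos (f w)).
  by move=> mf_; exact: (measurableT_comp (@measurable_cosT R) mf_).
have mF : measurable_fun setT F.
  by apply: mcosT; apply: measurable_funD => //; exact: measurable_funB.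
have Ib w : `|\1_(S N) w : R| <= 1 by rewrite ger0_norm// indicE; case: (_ \in _) => /=.
have Fb w : `|F w| <= 1 by exact: normr_cos_le1.
have IFb w : `|\1_(S N) w * F w| <= 1 by rewrite normrM mulr_ile1.
(* Three comparisons: restriction to [S N] in [sA], integration of the new particles in [sB],
   replacement of the conditional variance by its limit in [sC]. *)
have sA : `|\int[P N]_w F w - \int[P N]_w (\1_(S N) w * F w)| <= eps / 8.
  have [B [mB PB BS]] := H1.
  have := @Rintegral_dist_le _ _ _ (P N) F (fun w => \1_(S N) w * F w) 1 0 (eps / 16) B mF
    (measurable_funM mI mF) Fb IFb mB PB.
  have -> : 0 + 2 * 1 * (eps / 16) = eps / 8 by field.
  by apply => // w /BS Sw; rewrite indicE mem_set// mul1r subrr normr0.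
have ex1 x : 0 <= x -> `|expR (- x)| <= 1 :> R.
  by move=> x0; rewrite ger0_norm ?expR_ge0// -[leRHS]expR0 ler_expR oppr_le0.
have cv0 := cov_ge0 Lphi.
have sC : `|\int[P N]_w (\1_(S N) w * (expR (- (N%:R * v w)) * cos (A N w))) -
    \int[P N]_w (expR (- (cov (pi t) phi phi / 2)) * cos (A N w))| <= eps / 4.
  have [B [mB PB BS]] := H2.
  have mv' : measurable_fun setT v := ci_meas0 CI mv.
  have m1 : measurable_fun setT (fun w => \1_(S N) w * (expR (- (N%:R * v w)) * cos (A N w))).
    apply: measurable_funM => //; apply: measurable_funM; last exact: mcosT.
    apply: measurableT_comp => //; apply: measurableT_comp => //; exact: measurable_funM.
  have m2 : measurable_fun setT (fun w => expR (- (cov (pi t) phi phi / 2)) * cos (A N w)).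
    by apply: measurable_funM => //; exact: mcosT.
  have := @Rintegral_dist_le _ _ _ (P N) _ _ 1 (eps / 8) (eps / 16) B m1 m2.
  have -> : eps / 8 + 2 * 1 * (eps / 16) = eps / 4 by field.
  apply => //.
  - move=> w; rewrite !normrM mulr_ile1 ?mulr_ge0// mulr_ile1 ?normr_cos_le1// ex1//.
    by rewrite mulr_ge0// ltW.
  - move=> w; rewrite normrM mulr_ile1 ?normr_cos_le1// ex1// divr_ge0//.
  - move=> w /BS[Sw [LK ck]]; rewrite indicE mem_set// mul1r -mulrBl normrM -[leRHS]mulr1.
    apply: ler_pM => //; last exact: normr_cos_le1.
    apply: (le_trans (expRN_lip _ _)); [by rewrite mulr_ge0// ltW|by rewrite divr_ge0|].
    rewrite vE// (_ : N%:R * _ - _ = (cov (K N t w) phi phi - cov (pi t) phi phi) / 2); last by field; rewrite gt_eqF.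
    by rewrite normrM normfV [`|2|]ger0_norm//; lra.
  - by rewrite divr_ge0// ltW.
have -> : expR (- (cov (pi t) phi phi / 2)) * \int[P N]_w cos (A N w) =
    \int[P N]_w (expR (- (cov (pi t) phi phi / 2)) * cos (A N w)).
  rewrite RintegralZl//; exact: (bounded_integrable (P N) (mcosT _ mAN) (fun w => normr_cos_le1 _)).
move: sA sB sC Ne.
set i1 := \int[P N]_w F w; set i2 := \int[P N]_w (\1_(S N) w * F w).
set i3 := \int[P N]_w (\1_(S N) w * (expR _ * _)); set i4 := \int[P N]_w (expR _ * _).
rewrite -/i2 => sA sB sC Ne.
have {}sB := le_trans sB Ne.
by move: sA sB sC; rewrite !ler_norml; lra.
Qed.

End Step.

End CLT.

Section CLT.
Context {R : realType} {dE} {E : measurableType dE} (M : fmodel R E)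
  (dO : nat -> measure_display) (Omega : forall N, measurableType (dO N))
  (P : forall N, probability (Omega N) R)
  (X : forall N, nat -> nat -> Omega N -> E).
Arguments X : clear implicits.
Local Notation mu := (fm_mu M).
Local Notation a0 := (fm_a0 M).
Local Notation a := (fm_a M).
Local Notation g := (fm_g M).
Local Notation pY := (pY mu a0 a g).
Local Notation Lop := (Lop mu a g).
Local Notation mf := (mf mu a0 a g).
Local Notation pi := (piM M).
Hypothesis HX : forall N, is_particle_filter mu a0 a g (P N) N (X N).
Local Notation K N t w := (KX M N (X N) t w).
Local Notation fl t psi w := (fluc M X t psi w).
Local Notation kfl t psi w := (kfluc M X t psi w).

Lemma fluc_lin t c f h N (w : Omega N) : L2 (pi t) f -> L2 (pi t) h ->
  fl t (fun x => c * f x + h x) w = c * fl t f w + fl t h w.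
Proof. by move=> Lf Lh; rewrite /fluc emp_lin mf_lin//; ring. Qed.

Lemma fluc_scale t c f N (w : Omega N) : L2 (pi t) f -> fl t (fun x => c * f x) w = c * fl t f w.
Proof.
move=> Lf; rewrite /fluc (mf_piM M _ (L2_measurable Lf)) (mf_piM M _ (L2_measurable (L2Z c Lf))).
rewrite RintegralZl//; last exact: L2_integrable.
by rewrite /emp /MN -mulr_sumr; ring.
Qed.

Lemma fluc_measurable t psi N : measurable_fun setT psi -> measurable_fun setT (fun w : Omega N => fl t psi w).
Proof.
by move=> mpsi; apply: measurable_funM => //; apply: measurable_funB => //; exact: (emp_measurable HX).
Qed.

Lemma past_fluc_measurable s t psi N : (s < t)%N -> measurable_fun setT psi ->
  measurable_fun setT ((fun w => fl s psi w) : g_sigma_algebraType (cylG N (X N) t 0) -> R).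
Proof.
move=> st mpsi; apply: measurable_funM => //; apply: measurable_funB => //.
apply: measurable_funM => //; apply: measurable_sum => j.
exact: (measurableT_comp mpsi (@past_measurable _ _ _ _ _ (X N) _ _ _ (ltn_ord j) st)).
Qed.

(** What is left of the argument of the cosine once the randomness of time [t] is integrated out;
    the last coordinate survives through its bias. *)
Definition past_part t (phi : nat -> E -> R) (th : R) N (w : Omega N) : R :=
  \sum_(s < t) fl s (phi s) w + kfl t (phi t) w + th.

Lemma past_part_measurable t phi th N : (0 < N)%N -> (forall s, (s <= t)%N -> L2 (pi s) (phi s)) ->
  measurable_fun setT (past_part t phi th (N := N) : g_sigma_algebraType (cylG N (X N) t 0) -> R).
Proof.
move=> N0 L; apply: measurable_funD => //; apply: measurable_funD.
  apply: measurable_sum => s; apply: past_fluc_measurable => //.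
  exact: L2_measurable (L _ (ltnW (ltn_ord s))).
apply: measurable_funM => //; apply: measurable_funB => //.
exact: (ci_KR (particle_cond_iid (HX N) N0 t) (L2_measurable (L _ (leqnn t)))).
Qed.

Lemma clt_from_past t phi th (l : R) : (forall s, (s <= t)%N -> L2 (pi s) (phi s)) ->
  (\int[P N]_w cos (past_part t phi th (N := N) w)) @[N --> \oo] --> l ->
  (\int[P N]_w cos (\sum_(s < t.+1) fl s (phi s) w + th)) @[N --> \oo] -->
    expR (- (cov (pi t) (phi t) (phi t) / 2)) * l.
Proof.
move=> L cA; apply/cvgrPdist_le => e e0; have e2 : 0 < e / 2 by rewrite divr_gt0.
move/cvgrPdist_le : cA => /(_ _ e2) cA.
have st := clt_step HX (L t (leqnn t)) (A := past_part t phi th)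
  (fun N N0 => past_part_measurable th N0 L) e2.
apply: filterS2 cA st => N h1 h2.
have ev1 : 0 <= expR (- (cov (pi t) (phi t) (phi t) / 2)) <= 1.
  by rewrite expR_ge0/= -[leRHS]expR0 ler_expR oppr_le0 divr_ge0// cov_ge0//; exact: L.
move: ev1 h2; set ex := expR _ => /andP[ex0 ex1].
have -> : \int[P N]_w cos (past_part t phi th w + (fl t (phi t) w - kfl t (phi t) w)) =
    \int[P N]_w cos (\sum_(s < t.+1) fl s (phi s) w + th).
  by apply: eq_Rintegral => w _; congr cos; rewrite big_ord_recr /past_part /=; ring.
set i1 := \int[P N]_w _; move: h1; set i2 := \int[P N]_w _ => h1 h2.
have h3 : `|ex * (l - i2)| <= e / 2.
  rewrite normrM (ger0_norm ex0); apply: le_trans h1.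
  by rewrite -[leRHS]mul1r ler_wpM2r.
by move: h2 h3; rewrite mulrBr !ler_norml; lra.
Qed.

Lemma clt t phi th : (forall s, (s <= t)%N -> L2 (pi s) (phi s)) ->
  (\int[P N]_w cos (\sum_(s < t.+1) fl s (phi s) w + th)) @[N --> \oo] -->
    expR (- (vq M t phi / 2)) * cos th.
Proof.
elim: t phi => [|t IH] phi L.
  (* At time 0 there is no bias, and the past part reduces to [th]. *)
  rewrite vq0; apply: clt_from_past => //; apply: cvg_near_cst.
  apply: filterS (nbhs_infty_gt 0) => N N0; rewrite -[RHS](Rintegral_prob_cst (P N)).
  apply: eq_Rintegral => w _; rewrite /past_part big_ord0 kfluc0// ?add0r//.
  exact: L2_measurable (L 0 (leqnn 0)).
rewrite vqS (_ : expR _ = expR (- (cov (pi t.+1) (phi t.+1) (phi t.+1) / 2)) *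
    expR (- (vq M t (fold_last M t phi) / 2))); last first.
  by rewrite -expRD; congr expR; ring.
rewrite -mulrA; apply: clt_from_past => //.
have LF := fold_last_L2 L; have Lt := L t (leqnSn t); have LD := Dop_L2 (L t.+1 (leqnn _)).
apply/cvgrPdist_le => e e0; have e2 : 0 < e / 2 by rewrite divr_gt0.
have e4 : 0 < e / 4 by rewrite divr_gt0.
have e8 : 0 < e / 8 by rewrite divr_gt0.
have /cvgrPdist_le/(_ _ e2) cI := IH _ LF.
have n1 : whp P (fun N w => kfl t.+1 (phi t.+1) w = fl t (Dop M t.+1 (phi t.+1)) w *
    (pY t.+1 / emp X t (Lop t.+1 (cst 1)) w)).
  by apply: whp_null => N N0; exact: (kflucS HX N0 (L t.+1 (leqnn _))).
(* The bias differs from the fluctuation of [Dop] by a tight variable times a ratio minus one, hence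
   negligibly. *)
have r0 : cvgp P (fun N w => pY t.+1 / emp X t (Lop t.+1 (cst 1)) w - 1) 0.
  by move=> e' e'0; apply: whp_imp (ratio_cvg1 HX t e'0); apply: nearW => N w; rewrite subr0.
have sm := tightp_mul_small (fluc_tight HX LD) r0 e4.
apply: filterS3 (nbhs_infty_gt 0) cI (whp_and n1 sm e8) => N N0 h1 [B [mB PB BS]].
(* Fluctuations are linear in the test function, so adding that of [Dop] to coordinate [t] gives the
   sum for [fold_last], to which the induction hypothesis applies. *)
have sumE (w : Omega N) : \sum_(s < t.+1) fl s (fold_last M t phi s) w =
    \sum_(s < t.+1) fl s (phi s) w + fl t (Dop M t.+1 (phi t.+1)) w.
  rewrite !big_ord_recr/= -addrA; congr (_ + _).
    by apply: eq_bigr => s _; rewrite /fold_last (ltn_eqF (ltn_ord s)).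
  rewrite /fold_last eqxx.
  have := fluc_lin 1 w Lt LD; rewrite mul1r => <-.
  rewrite (_ : (fun x => 1 * phi t x + _) = (fun x => phi t x + Dop M t.+1 (phi t.+1) x))//.
  by apply/funext => x; rewrite mul1r.
have mc (f : Omega N -> R) : measurable_fun setT f -> measurable_fun setT (fun w => cos (f w)).
  by move=> mf_; exact: (measurableT_comp (@measurable_cosT R) mf_).
have := @Rintegral_dist_le _ _ _ (P N)
  (fun w => cos (\sum_(s < t.+1) fl s (fold_last M t phi s) w + th))
  (fun w => cos (past_part t.+1 phi th w)) 1 (e / 4) (e / 8) B.
have -> : e / 4 + 2 * 1 * (e / 8) = e / 2 by field.
move=> D; have {}D := D _ _ (fun w => normr_cos_le1 _) (fun w => normr_cos_le1 _) mB PB _ (ltW e4).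
have {D} D : `|\int[P N]_w cos (\sum_(s < t.+1) fl s (fold_last M t phi s) w + th) -
    \int[P N]_w cos (past_part t.+1 phi th w)| <= e / 2.
  apply: D.
  - apply: mc; apply: measurable_funD => //; apply: measurable_sum => s.
    by apply: fluc_measurable; apply: L2_measurable; apply: LF; rewrite -ltnS.
  - apply: mc; apply: (ci_meas0 (particle_cond_iid (HX N) N0 t.+1)).
    exact: past_part_measurable.
  - move=> w /BS[kE]; rewrite subr0 => hs; apply: (le_trans (cos_lip _ _)).
    rewrite sumE /past_part kE distrC.
    move: hs; move: (fl t _ w) (pY _ / _) (\sum_(s < t.+1) _) => f1 r1 s1.
    by rewrite (_ : s1 + f1 * r1 + th - (s1 + f1 + th) = f1 * (r1 - 1)); last ring.
by move: h1 D; rewrite !ler_norml; lra.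
Qed.

End CLT.

(** Passes from the property to the bundled structure on the same measure, so that [mu] can be
    substituted. *)
Lemma sigma_finite_measureP {d} {T : measurableType d} {R : realType} (mu : {measure set T -> \bar R}) :
  sigma_finite setT mu ->
  exists nu : {sigma_finite_measure set T -> \bar R}, (nu : {measure set T -> \bar R}) = mu.
Proof.
case: mu => m cm h.
pose mu : {measure set T -> \bar R} := Measure.Pack cm.
pose nu : {sigma_finite_measure set T -> \bar R} :=
  HB.pack m cm (Measure_isSigmaFinite.Build d T R mu h).
by exists nu.
Qed.

(** * Joint convergence to the Gaussian vector *)

Section JointCLT.
Context {R : realType} {dE} {E : measurableType dE} (M : fmodel R E).
Local Notation mu := (fm_mu M).
Local Notation a0 := (fm_a0 M).
Local Notation a := (fm_a M).
Local Notation g := (fm_g M).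

Lemma Vvar_finite t psi : measurable_fun setT psi -> (sigma2 mu a0 a g t psi < +oo)%E ->
  (Vvar mu a0 a g t psi < +oo)%E.
Proof. by move=> mpsi s2; rewrite (Vvar_Bf (sigma2_L2 mpsi s2)) ltry. Qed.

Lemma particle_filter_clt (dO : nat -> measure_display) (Omega : forall N, measurableType (dO N))
    (P : forall N, probability (Omega N) R) (X : forall N, nat -> nat -> Omega N -> E) :
  (forall N, is_particle_filter mu a0 a g (P N) N (@X N)) ->
  forall (t : nat) (psi : nat -> E -> R), (forall s, measurable_fun setT (psi s)) ->
  (forall s, (s <= t)%N -> (sigma2 mu a0 a g s (psi s) < +oo)%E) ->
  exists (dL : measure_display) (OmegaL : measurableType dL)
         (PL : probability OmegaL R) (ZL : OmegaL -> 'rV[R]_t.+1),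
    gaussian_vector PL ZL (Sigma mu a0 a g t psi) /\
    cvg_in_law P (fun N w => \row_(s < t.+1)
      (Num.sqrt N%:R * (MN N (fun j => @X N j s w) (psi s) - mf mu a0 a g s (psi s)))) PL ZL.
Proof.
move=> HX t psi mpsi s2.
have L s : (s <= t)%N -> L2 (piM M s) (psi s) by move=> st; apply: sigma2_L2 (s2 s st).
have Lu (u : 'rV[R]_t.+1) s : (s <= t)%N -> L2 (piM M s) (fun x => u 0 (inord s) * psi s x).
  by move=> st; apply: L2Z; exact: L.
have psd (u : 'rV[R]_t.+1) : 0 <= \sum_i \sum_j u 0 i * Sigma mu a0 a g t psi i j * u 0 j.
  by rewrite (Sigma_quad u L); apply: vq_ge0; exact: Lu.
have [dL [OmegaL [PL [ZL [mZL gZL cZL]]]]] := gaussian_vector_exists (Sigma_sym M psi) psd.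
exists dL, OmegaL, PL, ZL; split => //.
have ZE N (w : Omega N) (i : 'I_t.+1) : (\row_(s < t.+1)
      (Num.sqrt N%:R * (MN N (fun j => @X N j s w) (psi s) - mf mu a0 a g s (psi s)))) 0 i =
    fluc M X i (psi i) w by rewrite mxE.
apply: levy_continuity => //.
- move=> N i; under eq_fun do rewrite ZE; exact: (fluc_measurable HX).
- move=> u th; rewrite cZL (Sigma_quad u L).
  have e N : \int[P N]_w cos (dot u (\row_(s < t.+1)
      (Num.sqrt N%:R * (MN N (fun j => @X N j s w) (psi s) - mf mu a0 a g s (psi s)))) + th) =
      \int[P N]_w cos (\sum_(s < t.+1) fluc M X s (fun x => u 0 (inord s) * psi s x) w + th).
    apply: eq_Rintegral => w _; congr (cos (_ + _)); apply: eq_bigr => i _.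
    by rewrite ZE inord_val (fluc_scale X (u 0 i) w (L i (leq_ord i))).
  have := @clt _ _ _ M _ _ P X HX t (fun s x => u 0 (inord s) * psi s x) th (Lu u).
  by rewrite -(funext e).
(* Each coordinate has its own constant from [fluc_tight]; the sum of absolute values serves all of
   them at once. *)
- move=> dl dl0; have tS s : exists K : R, (s <= t)%N -> \forall N \near \oo, exists B,
      [/\ measurable B, (P N B <= dl%:E)%E & forall w, ~ B w -> `|fluc M X s (psi s) w| <= K].
    have [st|] := leqP s t; last by exists 0.
    by have [K hK] := fluc_tight HX (L s st) dl0; exists K.
  have [K hK] := choice tS.
  exists (\sum_(s < t.+1) `|K s|).
  have : \forall N \near \oo, forall i : 'I_t.+1, exists B,
      [/\ measurable B, (P N B <= dl%:E)%E & forall w, ~ B w -> `|fluc M X i (psi i) w| <= K i].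
    by apply: filter_forall => i; exact: hK (leq_ord i).
  apply: filterS => N hN i; have [B [mB PB BK]] := hN i; exists B; split => // w /BK h.
  rewrite ZE; apply: (le_trans h); apply: (le_trans (ler_norm _)).
  rewrite (bigD1 i)//= lerDl; exact: sumr_ge0.
Qed.

End JointCLT.

Theorem theorem4 (R : realType)
  (* state space: complete separable metric space with its Borel sigma-field *)
  (T : completePseudoMetricType R) (hT : hausdorff_space T)
  (sepT : exists S : set T, countable S /\ dense S)
  (mu : {measure set (Borel T) -> \bar R}) (mu_sfin : sigma_finite setT mu)
  (* observation space *)
  (dY : measure_display) (Y : measurableType dY) (nu : {measure set Y -> \bar R})
  (a0 : Borel T -> R) (a : nat -> Borel T -> Borel T -> R)
  (b : nat -> Borel T -> Y -> R) (C : nat -> Y -> R)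
  (y : nat -> Y) (* fixed observations y_1, y_2, ... *)
  (* model: densities *)
  (ha0m : measurable_fun setT a0) (ha0p : forall x, 0 <= a0 x)
  (ha01 : (\int[mu]_x (a0 x)%:E = 1)%E)
  (ham : forall t, (0 < t)%N ->
     measurable_fun setT (fun p : Borel T * Borel T => a t p.1 p.2))
  (hap : forall t x z, (0 < t)%N -> 0 <= a t x z)
  (ha1 : forall t x, (0 < t)%N -> (\int[mu]_z (a t x z)%:E = 1)%E)
  (hbm : forall t, (0 < t)%N ->
     measurable_fun setT (fun p : Borel T * Y => b t p.1 p.2))
  (hb1 : forall t x, (0 < t)%N -> (\int[nu]_v (b t x v)%:E = 1)%E)
  (* assumptions of the theorem *)
  (ha_cont : forall t, (0 < t)%N -> forall x : T,
     ((fun x' : T => \int[mu]_z (`|a t x' z - a t x z|)%:E) x' @[x' --> x]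
        --> 0%E)%E)
  (hb_bnd : forall t x v, (0 < t)%N -> 0 < b t x v <= C t v) :
  let g := fun t x => b t x (y t) in
  (* (1) V_t(psi) is finite *)
  (forall (t : nat) (psi : Borel T -> R), measurable_fun setT psi ->
     (sigma2 mu a0 a g t psi < +oo)%E -> (Vvar mu a0 a g t psi < +oo)%E) /\
  (* (2) joint CLT for the Monte Carlo filter *)
  (forall (dO : nat -> measure_display) (Omega : forall N, measurableType (dO N))
     (P : forall N, probability (Omega N) R)
     (X : forall N, nat -> nat -> Omega N -> Borel T),
     (forall N, is_particle_filter mu a0 a g (P N) N (X N)) ->
     forall (t : nat) (psi : nat -> Borel T -> R),
       (forall s, measurable_fun setT (psi s)) ->
       (forall s, (s <= t)%N -> (sigma2 mu a0 a g s (psi s) < +oo)%E) ->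
       exists (dL : measure_display) (OmegaL : measurableType dL)
              (PL : probability OmegaL R) (ZL : OmegaL -> 'rV[R]_t.+1),
         gaussian_vector PL ZL (Sigma mu a0 a g t psi) /\
         cvg_in_law P
           (fun N w => \row_(s < t.+1)
              (Num.sqrt N%:R * (MN N (fun j => X N j s w) (psi s)
                                - mf mu a0 a g s (psi s))))
           PL ZL).

Proof.
move=> g.
have [mu' e] := sigma_finite_measureP mu_sfin; subst mu.
have gm t : measurable_fun setT (g t.+1).
  exact: (measurable_fun_pair1 (y t.+1) (hbm t.+1 (ltn0Sn t))).
(* With the observations fixed, the likelihood bound becomes [C t (y t)], and conditions stated for
   [0 < t] are read at [t.+1]. *)
pose M := @FModel R _ (Borel T) mu' a0 a g (fun t => C t (y t)) ha0m ha0p ha01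
  (fun t => ham t.+1 (ltn0Sn t)) (fun t x z => hap t.+1 x z (ltn0Sn t))
  (fun t x => ha1 t.+1 x (ltn0Sn t)) gm
  (fun t x => proj1 (andP (hb_bnd t.+1 x (y t.+1) (ltn0Sn t))))
  (fun t x => proj2 (andP (hb_bnd t.+1 x (y t.+1) (ltn0Sn t)))).
split.
- exact: (@Vvar_finite _ _ _ M).
- exact: (@particle_filter_clt _ _ _ M).
Qed.
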